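(* Fix $q\in[2,\infty]$. If $n\ge1$ and $X=(X_1,\ldots,X_n)$ is a random vector uniformly distributed on $B_q^n$, then for all real numbers $a_1,\ldots,a_n$ and every $p\ge1$, $$A_p\Big\|\sum_{i=1}^n a_iX_i\Big\|_2\le\Big\|\sum_{i=1}^n a_iX_i\Big\|_p\le B_p\Big\|\sum_{i=1}^n a_iX_i\Big\|_2,$$ where $$A_p=\begin{cases}\gamma_p,& p\in[1,2)\\ \frac{3^{1/2}}{(p+1)^{1/p}},& p\in[2,\infty)\end{cases}\qquad\text{and}\qquad B_p=\begin{cases}\frac{3^{1/2}}{(p+1)^{1/p}},& p\in[1,2)\\ \gamma_p,& p\in[2,\infty).\end{cases}$$ These constants are sharp: for each fixed $q\in[2,\infty]$ and $p\ge1$, $A_p$ is the largest and $B_p$ is the smallest constant for which the inequality holds for all $n\ge1$ and all real $a_1,\ldots,a_n$.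
   Context: For a real random variable $S$ and $r>0$, $\|S\|_r=(\mathbb{E}|S|^r)^{1/r}$. For $0<q<\infty$, $B_q^n=\{x\in\mathbb{R}^n:\ |x_1|^q+\cdots+|x_n|^q\le1\}$, and $B_\infty^n=[-1,1]^n$. The constant $\gamma_p=\sqrt{2}\Big(\frac{\Gamma(\frac{p+1}{2})}{\sqrt{\pi}}\Big)^{1/p}$ is $\|G\|_p$ for a standard Gaussian random variable $G$. *)

(* Defs.v *)
From HB Require Import structures.
From mathcomp Require Import all_boot all_order all_algebra.
From mathcomp Require Import all_classical all_reals all_analysis.

Set Implicit Arguments.
Unset Strict Implicit.
Unset Printing Implicit Defensive.
Import Order.TTheory GRing.Theory Num.Theory.
Import numFieldNormedType.Exports.
Local Open Scope classical_set_scope.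
Local Open Scope ring_scope.

(* Lebesgue measure on R^n, with R^n encoded as [n.-tuple R] and its product
   sigma-algebra: the one-point mass for n = 0, and the image under
   (x, t) |-> x :: t of the product of the Lebesgue measure on R with the
   Lebesgue measure on R^n for n.+1. *)

Section cons_measure.
Context d (T : measurableType d) (R : realType) (n : nat).

Definition cons_pair (xt : T * n.-tuple T) : n.+1.-tuple T :=
  [the n.+1.-tuple T of xt.1 :: xt.2].

Lemma measurable_cons_pair : measurable_fun [set: T * n.-tuple T] cons_pair.
Proof. exact: measurable_cons measurable_fst measurable_snd. Qed.

Definition uncons_tuple (t : n.+1.-tuple T) : T * n.-tuple T :=
  (thead t, [tuple of behead t]).

Lemma measurable_uncons_tuple : measurable_fun [set: n.+1.-tuple T] uncons_tuple.
Proof.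
apply: measurable_fun_pair; last exact: measurable_behead.
exact: measurable_tnth.
Qed.

Lemma cons_pairK : cancel cons_pair uncons_tuple.
Proof. by move=> [x t]; congr pair; apply/val_inj. Qed.

Variables (m1 : {sigma_finite_measure set T -> \bar R})
  (m2 : {sigma_finite_measure set (n.-tuple T) -> \bar R}).

Definition cons_measure : set (n.+1.-tuple T) -> \bar R :=
  pushforward (m1 \x m2)%E cons_pair.

Let cons_measure0 : cons_measure set0 = 0%E.
Proof. by rewrite /cons_measure /pushforward preimage_set0 measure0. Qed.

Let cons_measure_ge0 A : (0 <= cons_measure A)%E.
Proof. by rewrite /cons_measure /pushforward measure_ge0. Qed.

Let cons_measure_sigma_additive : semi_sigma_additive cons_measure.
Proof.
move=> F mF tF mUF; rewrite /cons_measure /pushforward preimage_bigcup.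
apply: measure_semi_sigma_additive.
- by move=> k; rewrite -[X in measurable X]setTI; exact: measurable_cons_pair.
- apply/trivIsetP => /= i j _ _ ij; rewrite -preimage_setI.
  by move/trivIsetP : tF => /(_ _ _ _ _ ij) ->//; rewrite preimage_set0.
- rewrite -preimage_bigcup -[X in measurable X]setTI.
  exact: measurable_cons_pair.
Qed.

HB.instance Definition _ := isMeasure.Build _ _ _ cons_measure
  cons_measure0 cons_measure_ge0 cons_measure_sigma_additive.

Lemma cons_measure_sigma_finite : sigma_finite setT cons_measure.
Proof.
have /sigma_finiteP[F [TF ndF Foo]] := sigma_finiteT m1.
have /sigma_finiteP[G [TG ndG Goo]] := sigma_finiteT m2.
exists (fun k => uncons_tuple @^-1` (F k `*` G k)).
  rewrite -preimage_bigcup (_ : \bigcup_k (F k `*` G k) = setT)//.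
  apply/seteqP; split=> // -[x t] _.
  have [k _ Fkx] : (\bigcup_k F k) x by rewrite -TF.
  have [l _ Glt] : (\bigcup_k G k) t by rewrite -TG.
  exists (maxn k l) => //; split.
  - by move: x Fkx; exact/subsetPset/ndF/leq_maxl.
  - by move: t Glt; exact/subsetPset/ndG/leq_maxr.
move=> k; have [mF Fk] := Foo k; have [mG Gk] := Goo k; split.
  rewrite -[X in measurable X]setTI; apply: measurable_uncons_tuple => //.
  exact: measurableX.
rewrite /cons_measure /pushforward -comp_preimage (_ : _ \o _ = id); last first.
  by apply/funext => xt /=; rewrite cons_pairK.
by rewrite preimage_id product_measure1E// lte_mul_pinfty// ge0_fin_numE.
Qed.

HB.instance Definition _ := @Measure_isSigmaFinite.Build _ _ _
  cons_measure cons_measure_sigma_finite.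

End cons_measure.

(* [lebesgue_measure] is attached to [measurableTypeR R], which has the same
   measurable sets as the canonical structure on R but another display. *)
Section lebesgue_line.
Context (R : realType).

Definition lebesgue_line : set R -> \bar R := @lebesgue_measure R.

Let lebesgue_line0 : lebesgue_line set0 = 0%E.
Proof. exact: (measure0 (@lebesgue_measure R)). Qed.

Let lebesgue_line_ge0 A : (0 <= lebesgue_line A)%E.
Proof. exact: (measure_ge0 (@lebesgue_measure R)). Qed.

Let lebesgue_line_sigma_additive : semi_sigma_additive lebesgue_line.
Proof. exact: (@measure_semi_sigma_additive _ _ _ (@lebesgue_measure R)). Qed.

HB.instance Definition _ := isMeasure.Build _ _ _ lebesgue_line
  lebesgue_line0 lebesgue_line_ge0 lebesgue_line_sigma_additive.

Let lebesgue_line_sigma_finite : sigma_finite setT lebesgue_line.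
Proof. exact: (sigma_finiteT (@lebesgue_measure R)). Qed.

HB.instance Definition _ := @Measure_isSigmaFinite.Build _ _ _
  lebesgue_line lebesgue_line_sigma_finite.

End lebesgue_line.

Fixpoint lebesgue_tuple (R : realType) (n : nat) :
    {sigma_finite_measure set (n.-tuple R) -> \bar R} :=
  match n with
  | 0 => \d_([tuple] : 0.-tuple R)
  | k.+1 => cons_measure (@lebesgue_line R) (lebesgue_tuple R k)
  end.

Lemma measurable_box d (T : measurableType d) n (A : 'I_n -> set T) :
  (forall i, measurable (A i)) ->
  measurable [set x : n.-tuple T | forall i, A i (tnth x i)].
Proof.
move=> mA; pose B i := (fun x : n.-tuple T => tnth x i) @^-1` A i.
rewrite (_ : [set _ | _] = \bigcap_(i in [set: 'I_n]) B i); last first.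
  by apply/seteqP; split=> x h i; [move=> _; exact: (h i)|exact: (h i I)].
apply: fin_bigcap_measurable => // i _.
by rewrite -[X in measurable X]setTI; exact: measurable_tnth.
Qed.

Lemma lebesgue_tuple_box (R : realType) n (A : 'I_n -> set R) :
  (forall i, measurable (A i)) ->
  (lebesgue_tuple R n [set x | forall i, A i (tnth x i)] =
   \prod_(i < n) lebesgue_measure (A i))%E.
Proof.
elim: n A => [|n IHn] A mA /=.
  by rewrite big_ord0 diracE mem_set// => -[].
rewrite big_ord_recl /cons_measure /pushforward.
rewrite (_ : _ @^-1` _ =
  A ord0 `*` [set t | forall i, A (lift ord0 i) (tnth t i)]); last first.
  apply/seteqP; split=> -[x t] /=.
    by move=> h; split=> [|i]; [exact: (h ord0)|have := h (lift ord0 i); rewrite tnthS].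
  move=> [h0 h] i; case: (unliftP ord0 i) => [j ->|->]; last exact: h0.
  by rewrite tnthS; exact: h.
have mbox : measurable [set t : n.-tuple R |
    forall i, A (lift ord0 i) (tnth t i)] by exact: (@measurable_box _ _ _ (fun i => A (lift ord0 i)) (fun i => mA _)).
rewrite product_measure1E//; congr (_ * _)%E.
exact: (IHn (fun i => A (lift ord0 i)) (fun i => mA _)).
Qed.

(* The unit ball B_q^n, for q in ]0, +oo]. *)
Definition lq_ball (R : realType) (q : \bar R) (n : nat) : set (n.-tuple R) :=
  match q with
  | r%:E => [set x | \sum_(i < n) `|tnth x i| `^ r <= 1]
  | +oo%E => [set x | forall i, `|tnth x i| <= 1]
  | -oo%E => set0
  end.

Arguments lq_ball {R} q n.

Definition uniformly_distributed d (T : measurableType d) (R : realType)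
    (P : probability T R) (n : nat) (X : {RV P >-> n.-tuple R})
    (K : set (n.-tuple R)) : Prop :=
  forall A : set (n.-tuple R), measurable A ->
    (distribution P X A = lebesgue_tuple R n (K `&` A) / lebesgue_tuple R n K)%E.

Definition lincomb d (T : measurableType d) (R : realType)
    (P : probability T R) (n : nat) (X : {RV P >-> n.-tuple R})
    (a : 'I_n -> R) (w : T) : R :=
  \sum_(i < n) a i * tnth (X w) i.

Definition Gamma (R : realType) (s : R) : R :=
  Rintegral (@lebesgue_measure R) `]0, +oo[ (fun t => t `^ (s - 1) * expR (- t)).

Definition gamma_const (R : realType) (p : R) : R :=
  Num.sqrt 2 * (Gamma ((p + 1) / 2) / Num.sqrt pi) `^ p^-1.

Definition cube_const (R : realType) (p : R) : R :=
  Num.sqrt 3 / (p + 1) `^ p^-1.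

Definition A_const (R : realType) (p : R) : R :=
  if p < 2 then gamma_const p else cube_const p.

Definition B_const (R : realType) (p : R) : R :=
  if p < 2 then cube_const p else gamma_const p.

Definition lower_moment_bound (R : realType) (q : \bar R) (p A : R) : Prop :=
  forall (n : nat), (1 <= n)%N ->
  forall (d : measure_display) (T : measurableType d) (P : probability T R)
    (X : {RV P >-> n.-tuple R}),
  uniformly_distributed X (lq_ball q n) ->
  forall a : 'I_n -> R,
    (A%:E * 'N[P]_2%:E[EFin \o lincomb X a] <=
     'N[P]_p%:E[EFin \o lincomb X a])%E.

Definition upper_moment_bound (R : realType) (q : \bar R) (p B : R) : Prop :=
  forall (n : nat), (1 <= n)%N ->
  forall (d : measure_display) (T : measurableType d) (P : probability T R)
    (X : {RV P >-> n.-tuple R}),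
  uniformly_distributed X (lq_ball q n) ->
  forall a : 'I_n -> R,
    ('N[P]_p%:E[EFin \o lincomb X a] <=
     B%:E * 'N[P]_2%:E[EFin \o lincomb X a])%E.

(* Main.v *)
From HB Require Import structures.
Require Import Defs.
From mathcomp Require Import all_boot all_order all_algebra.
From mathcomp Require Import all_classical all_reals all_analysis.
From mathcomp Require Import measurable_realfun ring lra.
Import Order.TTheory GRing.Theory Num.Theory.
Import numFieldNormedType.Exports.
Local Open Scope classical_set_scope.
Local Open Scope ring_scope.
Set Implicit Arguments.
Unset Strict Implicit.
Unset Printing Implicit Defensive.

(** Let K be the unit ball of dimension n, V its volume, and M_p(a) the integral
    over K of |<a, x>|^p, so that the p-th moment of the linear combination is
    M_p(a) / V. Every inequality below holds for p >= 2 and is reversed for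
    p <= 2; both cases are handled together by writing it 0 <= s * (A - B), with
    s = 1 in the first case and s = -1 in the second.

    Reduction to product weights. For finite q, integrating |<a, y>|^p against
    exp(-(|y_1|^q + ... + |y_n|^q)) instead of over K multiplies M_p(a) by the
    Gamma factor C_p = Gamma((n + p) / q + 1) ([ball_gamma]); for q = +oo the ball
    is a product and C_p = 1. The product integral is computed one coordinate at a
    time: [blur] w c h is the function x |-> \int h(x + c y) w(y) dy, and
    C_p M_p(a) is the value at 0 of |.|^p blurred successively with the coefficients a_i
    ([chain]). The weights exp(-|y|^q), q >= 2, and the indicator of [-1, 1] are
    even, nonincreasing in |y|, and log-concave as functions of y^2 ([weight]);
    the last property is where q >= 2 is needed.

    The class of test functions. The even function |x|^p has second differences
    that are monotone on the half-line, nondecreasing for p >= 2 and nonincreasing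
    for p <= 2 ([nice], [abs_powR_nice]). Blurring preserves this class
    ([blur_nice]), and every member is convex (concave for s = -1) as a function
    of x^2 ([nice_convex_sqr]), an analogue for finite differences of the fact
    that h'(x) / x is monotone when h' is odd and convex on the half-line.

    Comparison with a single coordinate. When c^2 = a^2 + b^2, the plane reflection
    carrying (a, b) / c to (1, 0) compares blurring by a and b with blurring by c
    and 0; log-concavity of the weight and convexity of the function in the
    squares give opposite rearrangements, whence [blur_schur]. Hence M_p(a) is
    at least |a|^p M_p(e_1) for p >= 2. Slicing K orthogonally to e_1 turns
    M_p(e_1) into an integral of powers of the half-length of the slices, and
    Jensen's inequality there ([ball_axis_jensen]) yields the constant of the cube.

    Comparison with the Gaussian. Normalize a Gaussian weight G to have the mass
    and second moment of w. Since log w - log G is concave in x^2, the set where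
    G <= w is an interval of values of |x|; subtracting from h the function
    A + B x^2 that agrees with h at its ends gives a difference with the sign of
    G - w, so h integrates to more against G ([weight_comparison]). Replacing the
    weights one at a time, and merging Gaussians by rotation, bounds C_p M_p(a) by
    a Gaussian moment ([chain_upper]); Jensen's inequality for the Gamma factors,
    C_p / C_0 against (C_2 / C_0)^(p/2), removes them ([gint_jensen]).

    Sharpness. For n = 1 the ball is [-1, 1], whose moments give the constant of
    the cube. For the Gaussian constant the central limit theorem is avoided:
    integrate the assumed inequality over all coefficient vectors a against
    exp(-|a|^2). By Tonelli, the average of M_p(a) is a Gaussian moment times the
    integral of |x|^p over K ([gauss_average]), which is compared with the
    second moment by Jensen's inequality. The right-hand side involves the averages
    J_r of |a|^(2r), for which J_(r+1) = (n/2 + r) J_r, so J_(p/2) is known up to a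
    factor that disappears in the limit. The outcome is gamma_p^p <=
    B^p (1 + p/n)^(p/2) for p >= 2, and A^p <= gamma_p^p (1 + p/n) for p <= 2, and
    n tends to infinity. *)

(** * Substitution and Tonelli for Lebesgue measure on tuples *)

Section affine.
Context {R : realType}.
Local Notation mu := (@lebesgue_line R).

Let aff (c b : R) : measurableTypeR R -> measurableTypeR R := fun x => c * x + b.
Let maff c b : measurable_fun setT (aff c b).
Proof. by apply: measurable_funD => //; exact: measurable_funM. Qed.

(** Both sides are measures in A that agree on half-open intervals, so the
    uniqueness of Lebesgue measure applies. *)
Lemma lebesgue_line_affine (c b : R) (A : set R) : c != 0 -> measurable A ->
  mu A = (`|c|%:E * mu ((fun x => c * x + b)%R @^-1` A))%E.
Proof.
move=> c0 mA.
have nc : 0 <= `|c| by [].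
pose m := mscale (NngNum nc) (pushforward (@lebesgue_measure R) (aff c b)).
rewrite [LHS](_ : _ = m (maff c b) A) //.
apply: lebesgue_measure_unique => //= _ [[x y]] _ <-.
rewrite /m /mscale/= /pushforward.
have [cl|cg] := ltP c 0.
  rewrite (_ : _ @^-1` _ = `[(y - b) / c, (x - b) / c[%classic); last first.
    apply/seteqP; split=> z /=; rewrite /aff !in_itv/= ler_ndivrMr // ltr_ndivlMr //; lra.
  rewrite !lebesgue_measure_itv/= !lte_fin.
  rewrite ltr_ndivrMr// divfK// ltrD2r.
  case: ifP => //; rewrite ?mule0// => _; rewrite -EFinD -EFinM; congr EFin.
  by rewrite ltr0_norm//; field; rewrite lt_eqF.
have {}cg : 0 < c by rewrite lt_neqAle eq_sym c0.
rewrite (_ : _ @^-1` _ = `](x - b) / c, (y - b) / c]%classic); last first.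
  apply/seteqP; split=> z /=; rewrite /aff !in_itv/= ler_pdivlMr // ltr_pdivrMr //; lra.
rewrite !lebesgue_measure_itv/= !lte_fin.
rewrite ltr_pdivrMr// divfK// ltrD2r.
case: ifP => //; rewrite ?mule0// => _; rewrite -EFinD -EFinM; congr EFin.
by rewrite gtr0_norm//; field; rewrite gt_eqF.
Qed.

Lemma ge0_integral_affine (c b : R) (f : R -> \bar R) : c != 0 ->
  measurable_fun setT f -> (forall x, 0 <= f x)%E ->
  (\int[mu]_x f x = `|c|%:E * \int[mu]_x f (c * x + b)%R)%E.
Proof.
move=> c0 mf f0.
have maf : measurable_fun setT ((fun x => c * x + b) : R -> R).
  by apply: measurable_funD => //; exact: measurable_funM.
have nc : 0 <= `|c| by [].
pose m := mscale (NngNum nc) (pushforward mu (fun x => c * x + b)).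
rewrite (eq_measure_integral (m maf)); last first.
  by move=> A mA _; rewrite /m /mscale/= (@lebesgue_line_affine c b).
rewrite ge0_integral_mscale//; congr (_ * _)%E.
by rewrite ge0_integral_pushforward.
Qed.

End affine.

Section tuple.
Context {R : realType}.
Local Notation mu := (@lebesgue_line R).

Lemma ge0_integral_lebesgue_tupleS n (F : n.+1.-tuple R -> \bar R) :
  measurable_fun setT F -> (forall t, 0 <= F t)%E ->
  (\int[lebesgue_tuple R n.+1]_t F t =
   \int[mu]_x \int[lebesgue_tuple R n]_t F [tuple of x :: t])%E.
Proof.
move=> mF F0.
rewrite (eq_measure_integral (pushforward (mu \x lebesgue_tuple R n)%E
  (@cons_pair _ R n) : {measure set _ -> \bar R})) //; first exact: measurable_cons_pair.
move=> mc; rewrite ge0_integral_pushforward// preimage_setT.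
rewrite fubini_tonelli1//=.
by apply: measurableT_comp => //; exact: measurable_cons_pair.
Qed.

Lemma measurable_tuple_cons n (F : n.+1.-tuple R -> \bar R) x :
  measurable_fun setT F -> measurable_fun setT (fun t : n.-tuple R => F [tuple of x :: t]).
Proof. by move=> mF; apply: measurableT_comp => //; exact: measurable_cons. Qed.

Lemma measurable_tuple_integral n (F : n.+1.-tuple R -> \bar R) :
  measurable_fun setT F -> (forall t, 0 <= F t)%E ->
  measurable_fun setT (fun x => \int[lebesgue_tuple R n]_t F [tuple of x :: t])%E.
Proof.
move=> mF F0.
apply: (@measurable_fun_fubini_tonelli_F _ _ _ _ _ (lebesgue_tuple R n) (F \o @cons_pair _ R n)) => //=.
by apply: measurableT_comp => //; exact: measurable_cons_pair.
Qed.

Lemma ge0_integral_lebesgue_tuple0 (F : 0.-tuple R -> \bar R) :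
  measurable_fun setT F -> (\int[lebesgue_tuple R 0]_t F t = F [tuple])%E.
Proof. by move=> mF; rewrite integral_dirac// diracT mul1e. Qed.

Definition scalet n (c : R) (t : n.-tuple R) := [tuple c * tnth t i | i < n].

Lemma measurable_scalet n c : measurable_fun setT (@scalet n c).
Proof.
apply/measurable_fun_tnthP => i.
rewrite [X in measurable_fun _ X](_ : _ = (fun t => c * tnth t i)).
  by apply: measurable_funM => //; exact: measurable_tnth.
by apply/funext => t/=; rewrite tnth_mktuple.
Qed.

Lemma scalet_cons n c x (t : n.-tuple R) :
  scalet c [tuple of x :: t] = [tuple of c * x :: scalet c t].
Proof.
apply: eq_from_tnth => i; rewrite tnth_mktuple.
case: (unliftP ord0 i) => [j ->|->]; last by rewrite !tnth0.
by rewrite !tnthS tnth_mktuple.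
Qed.

(** Homogeneity of Lebesgue measure in dimension n, by one affine substitution
    per coordinate. *)
Lemma ge0_integral_scalet n (c : R) (F : n.-tuple R -> \bar R) : 0 < c ->
  measurable_fun setT F -> (forall t, 0 <= F t)%E ->
  (\int[lebesgue_tuple R n]_t F t =
   (c ^+ n)%:E * \int[lebesgue_tuple R n]_t F (scalet c t))%E.
Proof.
move=> c0; elim: n F => [|n IH] F mF F0.
  have mF' : measurable_fun setT (fun t => F (scalet c t)).
    by apply: measurableT_comp => //; exact: measurable_scalet.
  rewrite !ge0_integral_lebesgue_tuple0// expr0 mul1e; congr F.
  exact/val_inj/esym/size0nil/size_tuple.
have mFs : measurable_fun setT (fun t => F (scalet c t)).
  by apply: measurableT_comp => //; exact: measurable_scalet.
rewrite !ge0_integral_lebesgue_tupleS//.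
rewrite (@ge0_integral_affine _ c 0) ?gt_eqF//; last 2 first.
- exact: measurable_tuple_integral.
- by move=> x; apply: integral_ge0.
rewrite gtr0_norm// exprS EFinM -muleA; congr (_ * _)%E.
rewrite -ge0_integralZl//; last 3 first.
- exact: (measurable_tuple_integral mFs).
- by move=> x _; apply: integral_ge0.
- by rewrite lee_fin exprn_ge0// ltW.
apply: eq_integral => x _; rewrite addr0 IH//; last exact: measurable_tuple_cons.
by congr (_ * _)%E; apply: eq_integral => t _; rewrite scalet_cons.
Qed.

End tuple.

(** * Functions of polynomial growth *)

Section growth.
Context {R : realType}.
Implicit Types f g h : R -> R.

Definition growth f := exists K m, forall x, `|f x| <= K * (1 + `|x|) ^+ m.

(** Present in the context so that the side conditions of monotonicity lemmas
    for powers are closed automatically. *)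
Let ge1 (x : R) : 1 <= 1 + `|x|. Proof. by rewrite lerDl. Qed.

Lemma growth_bnd f : growth f ->
  exists K m, [/\ 0 <= K & forall x, `|f x| <= K * (1 + `|x|) ^+ m].
Proof.
move=> [K [m H]]; exists K, m; split => //.
by have := H 0; rewrite normr0 addr0 expr1n mulr1; apply: le_trans.
Qed.

Lemma growth_le f g : (forall x, `|f x| <= `|g x|) -> growth g -> growth f.
Proof. by move=> fg [K [m H]]; exists K, m => x; exact: le_trans (H x). Qed.

Lemma growth_cst c : growth (fun=> c).
Proof. by exists `|c|, 0 => x; rewrite expr0 mulr1. Qed.

Lemma growthD f g : growth f -> growth g -> growth (fun x => f x + g x).
Proof.
move=> /growth_bnd[K [m [K0 H]]] /growth_bnd[L [k [L0 G]]].
exists (K + L), (m + k)%N => x; rewrite mulrDl (le_trans (ler_normD _ _))// lerD//.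
- by rewrite (le_trans (H x))// ler_wpM2l// ler_weXn2l// leq_addr.
- by rewrite (le_trans (G x))// ler_wpM2l// ler_weXn2l// leq_addl.
Qed.

Lemma growthM f g : growth f -> growth g -> growth (fun x => f x * g x).
Proof.
move=> /growth_bnd[K [m [K0 H]]] /growth_bnd[L [k [L0 G]]].
exists (K * L), (m + k)%N => x; rewrite normrM exprD mulrACA ler_pM//.
Qed.

Lemma growthN f : growth f -> growth (fun x => - f x).
Proof. by apply: growth_le => x; rewrite normrN. Qed.

Lemma growthX n : growth (fun x => x ^+ n).
Proof.
exists 1, n => x; rewrite mul1r normrX; case: n => // n.
by rewrite ler_pXn2r ?nnegrE ?addr_ge0// lerDr.
Qed.

Lemma growth_affine f b c : growth f -> growth (fun x => f (b + c * x)).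
Proof.
move=> /growth_bnd[K [m [K0 H]]].
exists (K * ((1 + `|b|) * (1 + `|c|)) ^+ m), m => x.
rewrite -mulrA -exprMn (le_trans (H _))// ler_wpM2l//.
case: m {H} => // m; rewrite ler_pXn2r ?nnegrE ?mulr_ge0 ?addr_ge0//.
rewrite (le_trans (_ : _ <= 1 + (`|b| + `|c| * `|x|)))//.
  by rewrite lerD2l (le_trans (ler_normD _ _))// normrM.
have := normr_ge0 b; have := normr_ge0 c; have := normr_ge0 x.
move: `|b| `|c| `|x| => B C X X0 C0 B0.
have BC := mulr_ge0 B0 C0; have BX := mulr_ge0 B0 X0.
have BCX := mulr_ge0 BC X0; lra.
Qed.

(** A local Lipschitz condition with polynomial weights: it is stable under
    integration against a measure with finite moments, and entails continuity,
    measurability and integrability. *)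
Definition polylip h := exists K m, [/\ 0 <= K &
  forall x y, `|h x - h y| <= K * `|x - y| * (1 + `|x| + `|y|) ^+ m].

Lemma polylip_growth h : polylip h -> growth h.
Proof.
move=> [K [m [K0 H]]].
rewrite (_ : h = fun x => (h x - h 0) + h 0); last by apply/funext => x; rewrite subrK.
apply: growthD; last exact: growth_cst.
exists K, m.+1 => x; rewrite (le_trans (H x 0))//.
rewrite subr0 normr0 addr0 exprS -mulrA ler_wpM2l// ler_wpM2r ?exprn_ge0 ?addr_ge0//.
by rewrite lerDr.
Qed.

Lemma polylip_continuous h : polylip h -> continuous h.
Proof.
move=> [K [m [K0 H]]] x; apply/cvgrPdist_le => /= e e0.
pose C := K * (2 * (1 + `|x|)) ^+ m + 1.
have C0 : 0 < C.
  by rewrite ltr_wpDl// mulr_ge0// exprn_ge0// mulr_ge0// addr_ge0.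
near=> y.
have yx : `|x - y| <= 1.
  near: y; have /cvgrPdist_le := @cvg_id _ (nbhs x); apply => //.
have ye : `|x - y| <= e / C.
  near: y; have /cvgrPdist_le := @cvg_id _ (nbhs x); apply; exact: divr_gt0.
rewrite (le_trans (H x y))//.
have yb : `|y| <= 1 + `|x|.
  rewrite (_ : y = x - (x - y)); last by rewrite opprB addrC subrK.
  by rewrite (le_trans (ler_normB _ _))// addrC lerD2r.
rewrite ler_pdivlMr// in ye.
rewrite mulrAC (le_trans _ ye)// mulrC ler_wpM2l// /C ler_wpDr// ler_wpM2l//.
by rewrite lerXn2r ?nnegrE ?mulr_ge0 ?addr_ge0//; lra.
Unshelve. all: end_near. Qed.

Lemma polylip_measurable h : polylip h -> measurable_fun setT h.
Proof. by move/polylip_continuous; exact: continuous_measurable_fun. Qed.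

End growth.

(** * Weights and blurring *)

Section weights.
Context {R : realType}.
Local Notation mu := (@lebesgue_line R).
Implicit Types (f g h w : R -> R).

Lemma Rintegral_reflect b f : measurable_fun setT f ->
  \int[mu]_y f y = \int[mu]_y f (b - y).
Proof.
move=> mf; rewrite /Rintegral; congr fine.
have N10 : (-1 : R) != 0 by rewrite oppr_eq0 oner_eq0.
have mF : measurable_fun setT (EFin \o f) by exact/measurable_EFinP.
rewrite integralE [RHS]integralE; congr (_ - _)%E.
- rewrite (@ge0_integral_affine _ (-1) b)//; last exact: measurable_funepos.
  rewrite normrN1 mul1e; apply: eq_integral => y _.
  by rewrite !funeposE mulN1r [- y + b]addrC.
- rewrite (@ge0_integral_affine _ (-1) b)//; last exact: measurable_funeneg.
  rewrite normrN1 mul1e; apply: eq_integral => y _.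
  by rewrite !funenegE mulN1r [- y + b]addrC.
Qed.

(** The exponents t and 1 - t in weight_logconcave are attached to the squares
    of the arguments: the condition is log-concavity of w as a function of x^2,
    which is what singles out exp(-|x|^r) for r >= 2. *)
Record weight w : Prop := Weight {
  weight_ge0 : forall x, 0 <= w x;
  weight_even : forall x, w (- x) = w x;
  weight_measurable : measurable_fun setT w;
  weight_nonincr : forall x y, `|x| <= `|y| -> w y <= w x;
  weight_logconcave : forall t x y z, 0 <= t <= 1 ->
    z ^+ 2 = t * x ^+ 2 + (1 - t) * y ^+ 2 ->
    w x `^ t * w y `^ (1 - t) <= w z;
  weight_moment : forall m,
    mu.-integrable setT (fun x => ((1 + `|x|) ^+ m * w x)%:E);
  weight_mass_gt0 : 0 < \int[mu]_x w x }.

Definition mass w := \int[mu]_x w x.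

Section integrability.
Variables (w : R -> R) (ww : weight w).

Lemma integrable_weight f : measurable_fun setT f -> growth f ->
  mu.-integrable setT (fun x => (f x * w x)%:E).
Proof.
move=> mf /growth_bnd[K [m [K0 H]]].
have mw := weight_measurable ww.
apply: (@le_integrable _ _ _ mu setT _ _ (fun x => (K%:E * ((1 + `|x|) ^+ m * w x)%:E)%E)) => //.
- by apply/measurable_EFinP; exact: measurable_funM.
- move=> x _; rewrite -EFinM !abse_EFin lee_fin !normrM (ger0_norm (weight_ge0 ww x)).
  rewrite (ger0_norm K0) mulrA ler_wpM2r ?weight_ge0//.
  by rewrite [X in _ <= _ * X]ger0_norm// exprn_ge0// addr_ge0.
- by apply: integrableZl => //; exact: (weight_moment ww).
Qed.

Lemma integrable_weight_aff f b c : measurable_fun setT f -> growth f ->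
  mu.-integrable setT (fun x => (f (b + c * x) * w x)%:E).
Proof.
move=> mf gf; apply: integrable_weight; last exact: growth_affine.
by apply: measurableT_comp => //; apply: measurable_funD => //; exact: measurable_funM.
Qed.

Definition blur c h x := \int[mu]_y (h (x + c * y) * w y).

Lemma blurE c h x : measurable_fun setT h -> growth h -> (forall x, 0 <= h x) ->
  ((blur c h x)%:E = \int[mu]_y (h (x + c * y) * w y)%:E)%E.
Proof.
move=> mh gh h0; rewrite /blur /Rintegral fineK//.
by apply: integrable_fin_num => //; exact: integrable_weight_aff.
Qed.

Lemma blur_linear c f g a b x : measurable_fun setT f -> growth f ->
  measurable_fun setT g -> growth g ->
  blur c (fun y => a * f y + b * g y) x = a * blur c f x + b * blur c g x.
Proof.
move=> mf gf mg gg; rewrite /blur.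
under eq_Rintegral do rewrite mulrDl -!mulrA.
have If := integrable_weight_aff x c mf gf.
have Ig := integrable_weight_aff x c mg gg.
rewrite RintegralD//.
- by rewrite !RintegralZl.
- exact: (integrableZl _ _ If).
- exact: (integrableZl _ _ Ig).
Qed.

Lemma blur0 h x : blur 0 h x = h x * mass w.
Proof.
rewrite /blur /mass; under eq_Rintegral do rewrite mul0r addr0.
rewrite RintegralZl//.
by have := @integrable_weight (fun=> 1) (measurable_cst _) (growth_cst 1);
  under eq_fun do rewrite mul1r.
Qed.

End integrability.

End weights.

(** * Functions with monotone second differences *)

Section blur_nice.
Context {R : realType}.
Local Notation mu := (@lebesgue_line R).
Implicit Types (f g h w : R -> R).

Lemma integrable_reflect b f : mu.-integrable setT (EFin \o f) ->
  mu.-integrable setT (fun y => (f (b - y))%:E).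
Proof.
move=> /integrableP[mf fi]; apply/integrableP; split.
  apply: (measurableT_comp mf); exact: measurable_funB.
have N10 : (-1 : R) != 0 by rewrite oppr_eq0 oner_eq0.
move: fi; rewrite (ge0_integral_affine b N10)//; last exact: measurableT_comp.
by rewrite normrN1 mul1e; under eq_integral do rewrite mulN1r addrC.
Qed.

Definition diff2 u h x := h (x + u) + h (x - u) - 2 * h x.
(** The increment of the second difference between x - d and x + d. Its
    nonnegativity for nonnegative x and d replaces the convexity of h' on the
    half-line without asking for derivatives. *)
Definition diff3 u d h x := diff2 u h (x + d) - diff2 u h (x - d).

(** The sign s selects one of the two cases p >= 2 and p <= 2 of the function
    |x|^p. *)
Record nice (s : R) h : Prop := Nice {
  nice_even : forall x, h (- x) = h x;
  nice_ge0 : forall x, 0 <= h x;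
  nice_polylip : polylip h;
  nice_diff3 : forall u d x, 0 <= u -> 0 <= d -> 0 <= x ->
    0 <= s * diff3 u d h x }.

Variables (w : R -> R) (ww : weight w).

(** Reflecting y about -x/c exchanges the values v and -v of x + c y, and since
    x >= 0 the weight is larger at the point where the value is positive; the
    contributions of the two points add up to a nonnegative number. *)
Lemma blur_odd_ge0 c f x : measurable_fun setT f -> growth f ->
  (forall y, f (- y) = - f y) -> (forall y, 0 <= y -> 0 <= f y) -> 0 <= x ->
  0 <= blur w c f x.
Proof.
move=> mf gf of_ f0 x0.
have [->|c0] := eqVneq c 0.
  by rewrite blur0// mulr_ge0 ?f0// ltW// weight_mass_gt0.
(* x + c (b - y) = - (x + c y): the reflection changes the sign of the argument. *)
pose b := - (2 * x / c).
pose F y := f (x + c * y) * w y.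
have iF : mu.-integrable setT (EFin \o F) := integrable_weight_aff ww x c mf gf.
have mF : measurable_fun setT F by have /measurable_int/measurable_EFinP := iF.
suff : 0 <= 2 * blur w c f x by rewrite pmulr_rge0.
have -> : 2 * blur w c f x = \int[mu]_y (F y + F (b - y)).
  rewrite (RintegralD measurableT iF (integrable_reflect b iF)).
  by rewrite -Rintegral_reflect// mulr_natl mulr2n.
apply: Rintegral_ge0 => y _.
have -> : F (b - y) = - f (x + c * y) * w (y - b).
  rewrite /F -of_ -(weight_even ww (y - b)) opprB; congr (f _ * _).
  by rewrite /b; field.
rewrite /F mulNr -mulrBr.
have E : `|y| * `|c| = `|x + c * y - x| by rewrite addrC addKr normrM mulrC.
have E' : `|y - b| * `|c| = `|x + c * y + x|.
  by rewrite -normrM; congr `|_|; rewrite /b; field.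
have c0' : 0 < `|c| by rewrite normr_gt0.
have [v0|v0] := leP 0 (x + c * y).
- rewrite mulr_ge0// ?f0// subr_ge0; apply: (weight_nonincr ww).
  rewrite -(ler_pM2r c0') E E' ler_norml; move: v0 x0; set v := _ + _ => v0 x0.
  by rewrite !ger0_norm; lra.
- rewrite -mulrNN mulr_ge0//; first by rewrite -of_ f0// oppr_ge0 ltW.
  rewrite opprB subr_ge0; apply: (weight_nonincr ww).
  rewrite -(ler_pM2r c0') E E'; move: v0 x0; set v := _ + _ => v0 x0.
  rewrite (@ler0_norm _ (v - x)); last lra.
  by rewrite ler_norml; lra.
Qed.

Lemma blur_even c h x : (forall y, h (- y) = h y) -> measurable_fun setT h -> 
  blur w c h (- x) = blur w c h x.
Proof.
move=> eh mh; have mw := weight_measurable ww.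
rewrite /blur (Rintegral_reflect 0); last first.
  apply: measurable_funM => //; apply: measurableT_comp => //.
  by apply: measurable_funD => //; exact: measurable_funM.
apply: eq_Rintegral => y _; rewrite sub0r (weight_even ww); congr (_ * _).
by rewrite mulrN -opprD eh.
Qed.

Lemma blur_ge0 c h x : (forall y, 0 <= h y) -> 0 <= blur w c h x.
Proof. by move=> h0; apply: Rintegral_ge0 => y _; rewrite mulr_ge0 ?(weight_ge0 ww). Qed.

Lemma blur_polylip c h : polylip h -> polylip (blur w c h).
Proof.
move=> lh; have mh := polylip_measurable lh; have gh := polylip_growth lh.
have [K [m [K0 H]]] := lh.
pose C := \int[mu]_z ((1 + `|z|) ^+ m * w z).
have C0 : 0 <= C.
  by apply: Rintegral_ge0 => z _; rewrite mulr_ge0 ?exprn_ge0 ?addr_ge0 ?(weight_ge0 ww).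
(* 1 + |x + c z| + |y + c z| <= (1 + 2 |c|) (1 + |x| + |y|) (1 + |z|). *)
exists (K * (1 + 2 * `|c|) ^+ m * C), m; split.
  by rewrite !mulr_ge0// exprn_ge0// addr_ge0// mulr_ge0.
move=> x y; rewrite /blur -RintegralB//; last 2 first.
- exact: integrable_weight_aff.
- exact: integrable_weight_aff.
have iB : mu.-integrable setT (EFin \o (fun z => h (x + c * z) * w z - h (y + c * z) * w z)).
  by apply: (integrableB _ (integrable_weight_aff ww x c mh gh) (integrable_weight_aff ww y c mh gh)).
rewrite (le_trans (le_normr_Rintegral _ iB))//.
rewrite (_ : K * _ * _ * _ * _ = K * `|x - y| * (1 + `|x| + `|y|) ^+ m * (1 + 2 * `|c|) ^+ m * C); last by ring.
rewrite -RintegralZl//; last exact: (weight_moment ww).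
apply: le_Rintegral => //.
- by have := integrable_norm iB.
- exact: (integrableZl measurableT _ (weight_moment ww m)).
move=> z _; rewrite -mulrBl normrM (ger0_norm (weight_ge0 ww _)) mulrA ler_wpM2r ?(weight_ge0 ww)//.
rewrite (le_trans (H _ _))// opprD addrACA subrr addr0 -!mulrA -!exprMn.
rewrite ler_wpM2l// ler_wpM2l// lerXn2r ?nnegrE ?mulr_ge0 ?addr_ge0 ?mulr_ge0//.
have X : `|x + c * z| <= `|x| + `|c| * `|z| by rewrite -normrM ler_normD.
have Y : `|y + c * z| <= `|y| + `|c| * `|z| by rewrite -normrM ler_normD.
have h1 := mulr_ge0 (normr_ge0 c) (normr_ge0 z).
have h2 := mulr_ge0 (normr_ge0 c) (normr_ge0 x).
have h3 := mulr_ge0 (normr_ge0 c) (normr_ge0 y).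
have h4 := mulr_ge0 (normr_ge0 x) (normr_ge0 z).
have h5 := mulr_ge0 (normr_ge0 y) (normr_ge0 z).
have h6 := mulr_ge0 h1 (normr_ge0 x).
have h7 := mulr_ge0 h1 (normr_ge0 y).
have := normr_ge0 z; have := normr_ge0 c; have := normr_ge0 x; have := normr_ge0 y.
lra.
Qed.

Lemma blur_shifts c h x (l : seq (R * R)) : polylip h ->
  blur w c (fun z => \sum_(p <- l) p.1 * h (z + p.2)) x =
  \sum_(p <- l) p.1 * blur w c h (x + p.2).
Proof.
move=> lh; have mh := polylip_measurable lh; have gh := polylip_growth lh.
have mt a : measurable_fun setT (fun z : R => h (z + a)).
  by apply: measurableT_comp => //; exact: measurable_funD.
have gt a : growth (fun z : R => h (z + a)).
  have := growth_affine a 1 gh; congr growth; apply/funext => z; by rewrite mul1r addrC.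
have H k : growth (fun z => \sum_(p <- k) p.1 * h (z + p.2)) /\
    measurable_fun setT (fun z : R => \sum_(p <- k) p.1 * h (z + p.2)).
  elim: k => [|p k [IHg IHm]].
    by under eq_fun do rewrite big_nil; split; [exact: growth_cst|exact: measurable_cst].
  under eq_fun do rewrite big_cons; split.
    by apply: growthD => //; apply: growthM => //; exact: growth_cst.
  by apply: measurable_funD => //; exact: measurable_funM.
elim: l => [|p l IH].
  rewrite big_nil /blur.
  by under eq_Rintegral do rewrite big_nil mul0r; rewrite Rintegral_cst// mul0r.
rewrite big_cons -IH -[X in _ = _ + X]mul1r.
have [gs ms] := H l.
have -> : blur w c h (x + p.2) = blur w c (fun z => h (z + p.2)) x.
  by apply: eq_Rintegral => y _; rewrite addrAC.
rewrite -blur_linear//; apply: eq_Rintegral => y _.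
by rewrite big_cons mul1r.
Qed.

(** Blurring commutes with translations, hence with finite differences. *)
Lemma blur_diff3 u d c h x : polylip h ->
  diff3 u d (blur w c h) x = blur w c (diff3 u d h) x.
Proof.
move=> lh.
pose l : seq (R * R) := [:: (1, d + u); (1, d - u); (-2, d);
  (-1, - d + u); (-1, - d - u); (2, - d)].
have E f : diff3 u d f = fun z => \sum_(p <- l) p.1 * f (z + p.2).
  apply/funext => z; rewrite /l !big_cons big_nil /= /diff3 /diff2 !addrA; ring.
by rewrite !E blur_shifts.
Qed.

(** The function diff3 u d h is odd and nonnegative on the half-line, so its
    blur is nonnegative there. *)
Lemma blur_nice s c h : nice s h -> nice s (blur w c h).
Proof.
move=> nh; have lh := nice_polylip nh.
have mh := polylip_measurable lh; have gh := polylip_growth lh.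
split.
- by move=> x; apply: blur_even => //; exact: (nice_even nh).
- by move=> x; apply: blur_ge0; exact: (nice_ge0 nh).
- exact: blur_polylip.
move=> u d x u0 d0 x0; rewrite blur_diff3//.
have mt a : measurable_fun setT (fun z : R => h (z + a)).
  by apply: measurableT_comp => //; exact: measurable_funD.
have gt a : growth (fun z : R => h (z + a)).
  have := growth_affine a 1 gh; congr growth; apply/funext => z; by rewrite mul1r addrC.
have gD : growth (diff3 u d h).
  rewrite /diff3 /diff2.
  under eq_fun do rewrite -!addrA.
  by do ![exact: gt | exact: growth_cst | apply: growthD | apply: growthN | apply: growthM].
have mD : measurable_fun setT (diff3 u d h).
  rewrite /diff3 /diff2.
  under eq_fun do rewrite -!addrA.
  by do ![exact: mt | exact: measurable_cst | apply: measurable_funD | apply: measurable_funM | apply: measurableT_comp => //].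
have -> : s * blur w c (diff3 u d h) x = blur w c (fun z => s * diff3 u d h z) x.
  have := @blur_linear _ _ ww c _ _ s 0 x mD gD mD gD.
  rewrite mul0r addr0 => <-; apply: eq_Rintegral => y _.
  by rewrite mul0r addr0.
apply: blur_odd_ge0 => //.
- exact: measurable_funM.
- by apply: growthM => //; exact: growth_cst.
- move=> y; rewrite -mulrN; congr (_ * _); rewrite /diff3 /diff2.
  have e a b : a = - b -> h a = h b by move=> ->; exact: (nice_even nh).
  rewrite (e (- y + d + u) (y - d - u)); last by ring.
  rewrite (e (- y + d - u) (y - d + u)); last by ring.
  rewrite (e (- y + d) (y - d)); last by ring.
  rewrite (e (- y - d + u) (y + d - u)); last by ring.
  rewrite (e (- y - d - u) (y + d + u)); last by ring.
  rewrite (e (- y - d) (y + d)); last by ring.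
  ring.
- by move=> y y0; apply: (nice_diff3 nh).
Qed.

End blur_nice.

(** * Convexity in the square of the variable *)

Section convexity.
Context {R : realType}.

(** If k were above the chord function A + B x^2 somewhere between x and y, the
    difference phi would have a positive interior maximum m. Tilting phi by a
    small multiple of x^2, the minimum over [-m, m] of the result is at an
    interior point w. The second difference of phi is then nonpositive at m and
    positive at w, although |w| <= m: this contradicts the monotonicity of
    second differences. *)
Lemma convex_sqr_lt (k : R -> R) : continuous k -> (forall x, k (- x) = k x) ->
  (forall u d x, 0 <= u -> 0 <= d -> 0 <= x -> 0 <= diff3 u d k x) ->
  forall t x y z, 0 <= t <= 1 -> 0 <= x -> x < y -> 0 <= z ->
    z ^+ 2 = t * x ^+ 2 + (1 - t) * y ^+ 2 -> k z <= t * k x + (1 - t) * k y.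
Proof.
move=> ck ek dk t x y z /andP[t0 t1] x0 xy z0 zE; rewrite leNgt; apply/negP => kz.
have xy2 : 0 < y ^+ 2 - x ^+ 2 by nra.
pose B := (k y - k x) / (y ^+ 2 - x ^+ 2).
pose phi v := k v - k x - B * (v ^+ 2 - x ^+ 2).
have BE : B * (y ^+ 2 - x ^+ 2) = k y - k x by rewrite /B divfK// gt_eqF.
have csq e : continuous (fun v : R => e * v ^+ 2).
  by move=> v; apply: cvgMr; exact: exprn_continuous.
have cphi : continuous phi.
  move=> v; apply: cvgB; first by apply: cvgB; [exact: ck|exact: cvg_cst].
  apply: cvgMr; apply: cvgB; [exact: exprn_continuous|exact: cvg_cst].
have phix : phi x = 0 by rewrite /phi; ring.
have phiy : phi y = 0 by rewrite /phi BE; ring.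
have phiz : 0 < phi z.
  rewrite /phi zE (_ : B * _ = (1 - t) * (B * (y ^+ 2 - x ^+ 2))); last by ring.
  by rewrite BE; lra.
have zxy : z \in `[x, y] by rewrite in_itv/=; apply/andP; split; nra.
have [m mxy mmax] := @EVT_max R phi x y (ltW xy) (continuous_subspaceT cphi).
have phim : 0 < phi m by rewrite (lt_le_trans phiz)// mmax.
move: mxy; rewrite in_itv/= => /andP[]; rewrite le_eqVlt => /predU1P[xm|xm].
  by move: phim; rewrite -xm phix ltxx.
rewrite le_eqVlt => /predU1P[my|my]; first by move: phim; rewrite my phiy ltxx.
(* Small enough that the tilted function is still larger at m than at x. *)
pose e := phi m / (m ^+ 2 + 1).
have m21 : 0 < m ^+ 2 + 1 by rewrite ltr_wpDl// sqr_ge0.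
have e0 : 0 < e by exact: divr_gt0.
have eE : e * (m ^+ 2 + 1) = phi m by rewrite /e divfK// gt_eqF.
pose psi v := phi v - e * v ^+ 2.
have cpsi : continuous psi by move=> v; apply: cvgB; [exact: cphi|exact: csq].
have m0 : 0 < m by exact: le_lt_trans xm.
have mm : - m <= m by lra.
have [w wm wmin] := @EVT_min R psi (- m) m mm (continuous_subspaceT cpsi).
have ephi v : phi (- v) = phi v by rewrite /phi ek sqrrN.
have epsi v : psi (- v) = psi v by rewrite /psi ephi sqrrN.
have wx : psi w < psi m.
  apply: (@le_lt_trans _ _ (psi x)); first by apply: wmin; rewrite in_itv/=; lra.
  by rewrite /psi phix -eE; have := sqr_ge0 x; nra.
move: wm; rewrite in_itv/= => /andP[]; rewrite le_eqVlt => /predU1P[mw|mw].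
  by move: wx; rewrite -mw epsi ltxx.
rewrite le_eqVlt => /predU1P[wm|wm]; first by move: wx; rewrite wm ltxx.
(* A step that keeps m +- u in [x, y] and w +- u in [-m, m]. *)
have [u [u0 um uy uw wu]] : exists u, [/\ 0 < u, u <= m - x, u <= y - m,
    u <= m - w & u <= w + m].
  exists (Num.min (Num.min (m - x) (y - m)) (Num.min (m - w) (w + m))).
  split; last 4 first.
  - by rewrite !ge_min lexx.
  - by rewrite !ge_min lexx orbT.
  - by rewrite !ge_min lexx !orbT.
  - by rewrite !ge_min lexx !orbT.
  by rewrite !lt_min; apply/andP; split; apply/andP; split; lra.
have psi2 : 0 <= diff2 u psi w.
  have h1 : psi w <= psi (w + u) by apply: wmin; rewrite in_itv/=; lra.
  have h2 : psi w <= psi (w - u) by apply: wmin; rewrite in_itv/=; lra.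
  by rewrite /diff2; lra.
have phi2m : diff2 u phi m <= 0.
  have h1 : phi (m + u) <= phi m by apply: mmax; rewrite in_itv/=; lra.
  have h2 : phi (m - u) <= phi m by apply: mmax; rewrite in_itv/=; lra.
  by rewrite /diff2; lra.
have psiphi : diff2 u psi w = diff2 u phi w - 2 * e * u ^+ 2.
  by rewrite /diff2 /psi; ring.
have e2 v : diff2 u phi (- v) = diff2 u phi v.
  rewrite /diff2 ephi (_ : - v + u = - (v - u)); last by ring.
  by rewrite -opprD !ephi; ring.
have nw : diff2 u phi w = diff2 u phi `|w|.
  by case: (ger0P w) => // _; rewrite e2.
have d3 : diff3 u ((m - `|w|) / 2) phi ((m + `|w|) / 2) = diff2 u phi m - diff2 u phi `|w|.
  by rewrite /diff3; congr (diff2 _ _ _ - diff2 _ _ _); field.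
have d3k a b : diff3 u a phi b = diff3 u a k b.
  by rewrite /diff3 /diff2 /phi; ring.
have wm' : `|w| <= m by rewrite ler_norml !ltW.
have := dk u ((m - `|w|) / 2) ((m + `|w|) / 2) (ltW u0).
rewrite -d3k d3 => /(_ _ _)/wrap[||]; [lra|have := normr_ge0 w; lra|].
rewrite -nw; have := mulr_gt0 e0 (mulr_gt0 u0 u0); rewrite -expr2.
by rewrite psiphi in psi2; lra.
Qed.

Lemma nice_convex_sqr (s : R) h : nice s h -> forall t x y z, 0 <= t <= 1 ->
  z ^+ 2 = t * x ^+ 2 + (1 - t) * y ^+ 2 ->
  0 <= s * (t * h x + (1 - t) * h y - h z).
Proof.
move=> nh t x y z t01 zE.
have hn v : h v = h `|v| by case: (ger0P v) => // _; rewrite (nice_even nh).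
pose k v := s * h v.
have ck : continuous k.
  by move=> v; apply: cvgMr; exact: (polylip_continuous (nice_polylip nh)).
have ek v : k (- v) = k v by rewrite /k (nice_even nh).
have dk u d v : 0 <= u -> 0 <= d -> 0 <= v -> 0 <= diff3 u d k v.
  move=> u0 d0 v0; have := nice_diff3 nh u0 d0 v0.
  by congr (0 <= _); rewrite /diff3 /diff2 /k; ring.
have H := convex_sqr_lt ck ek dk.
rewrite hn (hn y) (hn z) (_ : s * _ = t * k `|x| + (1 - t) * k `|y| - k `|z|); last first.
  by rewrite /k; ring.
rewrite subr_ge0.
have sq v : `|v| ^+ 2 = v ^+ 2 :> R by rewrite -normrX ger0_norm ?sqr_ge0.
have [xy|yx|xy] := ltgtP `|x| `|y|.
- by apply: H => //; rewrite !sq.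
- rewrite addrC -[X in _ + X * _](subKr 1); apply: H => //; last by rewrite !sq zE; ring.
  by move: t01 => /andP[? ?]; apply/andP; split; lra.
- have -> : `|z| = `|x|.
    apply/eqP; rewrite -(@eqrXn2 _ 2)// !sq zE -(sq y) -xy sq; apply/eqP; ring.
  by rewrite -xy; lra.
Qed.

End convexity.

(** * Plane reflections and iterated blurring *)

Section merge.
Context {R : realType}.
Local Notation mu := (@lebesgue_line R).
Local Notation mu2 := (mu \x mu)%E.
Implicit Types (h w v : R -> R).

Definition reflection2 (a b : R) (p : R * R) := (a * p.1 + b * p.2, b * p.1 - a * p.2).

Lemma measurable_reflection2 a b : measurable_fun setT (reflection2 a b).
Proof.
apply: measurable_fun_pair.
  by apply: measurable_funD; apply: measurable_funM.
by apply: measurable_funB; apply: measurable_funM.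
Qed.

Lemma reflection2K a b : a ^+ 2 + b ^+ 2 = 1 -> involutive (reflection2 a b).
Proof.
move=> ab [x y]; rewrite /reflection2/=; congr pair.
  rewrite (_ : _ + _ = (a ^+ 2 + b ^+ 2) * x); last by ring.
  by rewrite ab mul1r.
rewrite (_ : _ - _ = (a ^+ 2 + b ^+ 2) * y); last by ring.
by rewrite ab mul1r.
Qed.

(** The reflection is a product of shears and dilations, so two one-dimensional
    substitutions and two exchanges of integrals suffice. *)
Lemma ge0_integral_reflection2 a b (F : R * R -> \bar R) : b != 0 -> a ^+ 2 + b ^+ 2 = 1 ->
  measurable_fun setT F -> (forall p, 0 <= F p)%E ->
  (\int[mu2]_p F (reflection2 a b p) = \int[mu2]_p F p)%E.
Proof.
move=> b0 ab mF F0.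
have mFr : measurable_fun setT (fun p => F (reflection2 a b p)).
  by apply: measurableT_comp => //; exact: measurable_reflection2.
rewrite !fubini_tonelli1//.
rewrite /fubini_F/=.
pose G (p : R * R) := F (p.2, (p.1 - a * p.2) / b).
have mG : measurable_fun setT G.
  apply: measurableT_comp => //; apply: measurable_fun_pair; first exact: measurable_snd.
  by apply: measurable_funM => //; apply: measurable_funB => //; apply: measurable_funM.
have G0 p : (0 <= G p)%E by exact: F0.
transitivity (\int[mu]_x (`|b|^-1%:E * \int[mu]_u G (x, u)))%E.
  apply: eq_integral => x _.
  rewrite (@ge0_integral_affine _ b (a * x) (fun u => G (x, u)))//; last first.
    exact: measurable_fun_pair2.
  rewrite muleA -EFinM mulVf ?normr_eq0// mul1e.
  apply: eq_integral => y _; rewrite /G/= /reflection2/=; congr (F (_, _)); first by rewrite addrC.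
  apply: (mulIf b0); rewrite divfK//.
  have E : x = (a ^+ 2 + b ^+ 2) * x by rewrite ab mul1r.
  by apply/esym; rewrite {1}E; ring.
transitivity (`|b|^-1%:E * \int[mu]_x \int[mu]_u G (x, u))%E.
  rewrite ge0_integralZl//; last 2 first.
  - exact: (measurable_fun_fubini_tonelli_F G).
  - by move=> x _; apply: integral_ge0 => u _; exact: F0.
rewrite fubini_tonelli//.
transitivity (\int[mu]_u (`|b|^-1%:E * \int[mu]_x G (x, u)))%E.
  rewrite ge0_integralZl//; last 2 first.
  - exact: (measurable_fun_fubini_tonelli_G G).
  - by move=> u _; exact: integral_ge0.
apply: eq_integral => u _.
rewrite (@ge0_integral_affine _ b^-1 (- a * u / b) (fun z => F (u, z)))//; last 2 first.
- by rewrite invr_eq0.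
- exact: measurable_fun_pair2.
rewrite normfV; congr (_ * _)%E; apply: eq_integral => x _; rewrite /G/=; congr (F (_, _)); by field.
Qed.

Section blur2.
Variables (w v : R -> R) (ww : weight w) (wv : weight v).

Lemma blurN c h x : measurable_fun setT h -> blur w (- c) h x = blur w c h x.
Proof.
move=> mh; have mw := weight_measurable ww.
rewrite /blur (Rintegral_reflect 0); last first.
  apply: measurable_funM => //; apply: measurableT_comp => //.
  by apply: measurable_funD => //; exact: measurable_funM.
by apply: eq_Rintegral => y _; rewrite sub0r mulrNN (weight_even ww).
Qed.

Lemma measurable_pair_weight : measurable_fun setT (fun p : R * R => w p.1 * v p.2).
Proof.
have mw := weight_measurable ww; have mv := weight_measurable wv.
apply: measurable_funM; apply: measurableT_comp => //.
Qed.

Lemma measurable_linear2 h x a b : measurable_fun setT h ->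
  measurable_fun setT (fun p : R * R => h (x + a * p.1 + b * p.2)).
Proof.
move=> mh; apply: measurableT_comp => //; apply: measurable_funD; last by apply: measurable_funM.
by apply: measurable_funD => //; apply: measurable_funM.
Qed.

Lemma blur2E a b h x : polylip h -> (forall y, 0 <= h y) ->
  ((blur w a (blur v b h) x)%:E =
   \int[mu2]_p (h (x + a * p.1 + b * p.2) * (w p.1 * v p.2))%:E)%E.
Proof.
move=> lh h0; have mh := polylip_measurable lh; have gh := polylip_growth lh.
have lb := blur_polylip wv b lh.
have w0 := weight_ge0 ww; have v0 := weight_ge0 wv.
have mv := weight_measurable wv.
rewrite blurE//; last 3 first.
- exact: polylip_measurable.
- exact: polylip_growth.
- by move=> y; exact: blur_ge0.
rewrite fubini_tonelli1//; last 2 first.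
- apply/measurable_EFinP; apply: measurable_funM; first exact: measurable_linear2.
  exact: measurable_pair_weight.
- by move=> p; rewrite lee_fin mulr_ge0// mulr_ge0.
apply: eq_integral => y _; rewrite /fubini_F/= mulrC EFinM blurE//.
rewrite -ge0_integralZl//; last 3 first.
- apply/measurable_EFinP; apply: measurable_funM => //; apply: measurableT_comp => //.
  by apply: measurable_funD => //; exact: measurable_funM.
- by move=> z _; rewrite lee_fin mulr_ge0.
- by rewrite lee_fin.
by apply: eq_integral => z _; rewrite -EFinM; congr EFin; ring.
Qed.

End blur2.

Lemma blurC w v (ww : weight w) (wv : weight v) a b h x : polylip h -> (forall y, 0 <= h y) ->
  blur w a (blur v b h) x = blur v b (blur w a h) x.
Proof.
move=> lh h0; have mh := polylip_measurable lh.
have w0 := weight_ge0 ww; have v0 := weight_ge0 wv.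
apply: EFin_inj; rewrite (blur2E ww wv _ _ _ lh h0) (blur2E wv ww _ _ _ lh h0).
have mF : measurable_fun setT (fun p : R * R => (h (x + a * p.1 + b * p.2) * (w p.1 * v p.2))%:E).
  apply/measurable_EFinP; apply: measurable_funM; first exact: measurable_linear2.
  exact: measurable_pair_weight.
have mG : measurable_fun setT (fun p : R * R => (h (x + b * p.1 + a * p.2) * (v p.1 * w p.2))%:E).
  apply/measurable_EFinP; apply: measurable_funM; first exact: measurable_linear2.
  exact: measurable_pair_weight.
have F0 (p : R * R) : (0 <= (h (x + a * p.1 + b * p.2) * (w p.1 * v p.2))%:E)%E.
  by rewrite lee_fin; exact: mulr_ge0 (h0 _) (mulr_ge0 (w0 _) (v0 _)).
have G0 (p : R * R) : (0 <= (h (x + b * p.1 + a * p.2) * (v p.1 * w p.2))%:E)%E.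
  by rewrite lee_fin; exact: mulr_ge0 (h0 _) (mulr_ge0 (v0 _) (w0 _)).
rewrite (fubini_tonelli1 _ mF F0) (fubini_tonelli1 _ mG G0) /fubini_F (fubini_tonelli _ mF F0).
apply: eq_integral => y _; apply: eq_integral => z _ /=.
by rewrite addrAC [w z * _]mulrC.
Qed.

End merge.

(** * Merging two blurs *)

Section schur.
Context {R : realType}.
Local Notation mu := (@lebesgue_line R).
Local Notation mu2 := (mu \x mu)%E.
Implicit Types (h w : R -> R).

Lemma blur_sqr_eq w a c h x : weight w -> measurable_fun setT h -> a ^+ 2 = c ^+ 2 ->
  blur w a h x = blur w c h x.
Proof.
move=> ww mh /eqP; rewrite eqf_sqr => /orP[/eqP -> //|/eqP ->].
exact: blurN.
Qed.

Lemma blur_blur0 w a h x : weight w -> polylip h ->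
  blur w a (blur w 0 h) x = mass w * blur w a h x.
Proof.
move=> ww lh; have mh := polylip_measurable lh; have gh := polylip_growth lh.
have := @blur_linear _ _ ww a h h (mass w) 0 x mh gh mh gh.
rewrite mul0r addr0 => <-; apply: eq_Rintegral => y _.
by rewrite blur0// mul0r addr0 [h _ * _]mulrC.
Qed.

Definition radial w := forall x y u v : R, x ^+ 2 + y ^+ 2 = u ^+ 2 + v ^+ 2 ->
  w x * w y = w u * w v.

Let m2 w (ww : weight w) (h : R * R -> R) : measurable_fun setT h ->
  measurable_fun setT (fun p : R * R => (h p * (w p.1 * w p.2))%:E).
Proof.
move=> mh; apply/measurable_EFinP; apply: measurable_funM => //.
exact: measurable_pair_weight.
Qed.

Let sqr_div (a b c : R) : 0 < c -> c ^+ 2 = a ^+ 2 + b ^+ 2 -> (a / c) ^+ 2 + (b / c) ^+ 2 = 1.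
Proof.
by move=> c0 cE; rewrite !expr_div_n -mulrDl -cE divff// expf_neq0// gt_eqF.
Qed.

(** The product weight is invariant under the reflection that maps (a, b) / c to
    (1, 0). *)
Lemma blur_merge_radial w a b c h x : weight w -> radial w -> polylip h ->
  (forall y, 0 <= h y) -> 0 <= c -> c ^+ 2 = a ^+ 2 + b ^+ 2 ->
  blur w a (blur w b h) x = mass w * blur w c h x.
Proof.
move=> ww rw lh h0 c0 cE; have mh := polylip_measurable lh.
have [b0|b0] := eqVneq b 0.
  rewrite b0 blur_blur0//; congr (_ * _); apply: blur_sqr_eq => //.
  by rewrite cE b0 expr0n addr0.
have {}c0 : 0 < c.
  rewrite lt_neqAle c0 andbT; apply/eqP => c00; move: cE.
  rewrite -c00 expr0n/= => /esym/eqP; rewrite paddr_eq0 ?sqr_ge0// => /andP[_].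
  by rewrite sqrf_eq0 (negbTE b0).
have w0 := weight_ge0 ww.
rewrite -(blur_blur0 c x ww lh); apply: EFin_inj; rewrite !(blur2E ww ww _ _ _ lh h0).
have mF : measurable_fun setT (fun p : R * R => (h (x + c * p.1 + 0 * p.2) * (w p.1 * w p.2))%:E).
  by apply: m2 => //; exact: measurable_linear2.
rewrite -(@ge0_integral_reflection2 R (a / c) (b / c) _ _ _ mF).
- apply: eq_integral => -[y z] _ /=; congr EFin; congr (h _ * _).
    by field; rewrite gt_eqF.
  apply: rw; rewrite [in LHS](_ : y ^+ 2 + z ^+ 2 = ((a / c) ^+ 2 + (b / c) ^+ 2) * (y ^+ 2 + z ^+ 2)); last by rewrite sqr_div// mul1r.
  by ring.
- by rewrite mulf_neq0// invr_eq0 gt_eqF.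
- exact: sqr_div.
- by move=> p; rewrite lee_fin mulr_ge0// mulr_ge0.
Qed.

(** The pair (x^2, y^2) is an average of (u^2, v^2) and of the swapped pair, so
    log-concavity in the squares applies to x and to y. *)
Lemma weight_spread w t x y u v : weight w -> 0 <= t <= 1 ->
  x ^+ 2 = t * u ^+ 2 + (1 - t) * v ^+ 2 -> y ^+ 2 = (1 - t) * u ^+ 2 + t * v ^+ 2 ->
  w u * w v <= w x * w y.
Proof.
move=> ww t01 xE yE; have w0 := weight_ge0 ww.
have h1 := weight_logconcave ww t01 xE.
have t01' : 0 <= 1 - t <= 1 by move: t01 => /andP[? ?]; apply/andP; split; lra.
have h2 := @weight_logconcave _ _ ww (1 - t) u v y t01'.
rewrite subKr in h2; have {}h2 := h2 yE.
apply: le_trans (ler_pM _ _ h1 h2); rewrite ?mulr_ge0 ?powR_ge0//.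
rewrite mulrACA -!powRD ?subrK// ?(addrC t) ?subrK ?oner_eq0//.
by rewrite !powRr1.
Qed.

(** The counterpart for nice functions, with the opposite direction when s = 1. *)
Lemma nice_spread s h t x y u v : nice s h -> 0 <= t <= 1 ->
  x ^+ 2 = t * u ^+ 2 + (1 - t) * v ^+ 2 -> y ^+ 2 = (1 - t) * u ^+ 2 + t * v ^+ 2 ->
  0 <= s * (h u + h v - (h x + h y)).
Proof.
move=> nh t01 xE yE.
have h1 := nice_convex_sqr nh t01 xE.
have t01' : 0 <= 1 - t <= 1 by move: t01 => /andP[? ?]; apply/andP; split; lra.
have h2 := @nice_convex_sqr _ _ _ nh (1 - t) u v y t01'.
rewrite subKr in h2; have {}h2 := h2 yE.
have := addr_ge0 h1 h2; congr (0 <= _); ring.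
Qed.

(** Two pairs of squares with the same sum are comparable for majorization. *)
Lemma spread_cases x y u v : x ^+ 2 + y ^+ 2 = u ^+ 2 + v ^+ 2 :> R ->
  (exists t, [/\ 0 <= t <= 1, x ^+ 2 = t * u ^+ 2 + (1 - t) * v ^+ 2 &
    y ^+ 2 = (1 - t) * u ^+ 2 + t * v ^+ 2]) \/
  (exists t, [/\ 0 <= t <= 1, u ^+ 2 = t * x ^+ 2 + (1 - t) * y ^+ 2 &
    v ^+ 2 = (1 - t) * x ^+ 2 + t * y ^+ 2]).
Proof.
move: (x ^+ 2) (y ^+ 2) (u ^+ 2) (v ^+ 2) => X Y U V E.
(* With equal sums, the pair of squares with the larger difference spreads the other. *)
have H (A B C D : R) : A + B = C + D -> C != D -> 0 <= (A - D) / (C - D) <= 1 ->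
  exists t, [/\ 0 <= t <= 1, A = t * C + (1 - t) * D & B = (1 - t) * C + t * D].
  move=> e CD t01; exists ((A - D) / (C - D)); split => //.
    by field; rewrite subr_eq0.
  have -> : B = C + D - A by rewrite -e; ring.
  by field; rewrite subr_eq0.
have [/andP[XY UV]|] := boolP ((X == Y) && (U == V)).
  left; exists 0; rewrite lexx ler01; split => //.
    by move/eqP: XY E => <-; move/eqP: UV => <-; lra.
  by move/eqP: XY E => <-; move/eqP: UV => <-; lra.
move=> nXY.
have [c|c] := leP ((X - Y) ^+ 2) ((U - V) ^+ 2).
  have UV : U != V.
    apply: contra nXY => /eqP UV; rewrite UV eqxx andbT.
    by move: c; rewrite UV subrr expr0n/= le_eqVlt ltNge sqr_ge0 orbF sqrf_eq0 subr_eq0.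
  left; apply: H => //.
  have [UV'|UV'|/eqP] := ltgtP U V; last by rewrite (negbTE UV).
  - by rewrite -mulrNN -invrN !opprB ler_pdivlMr ?ler_pdivrMr; nra.
  - by rewrite ler_pdivlMr ?ler_pdivrMr; nra.
have XY : X != Y.
  by apply/eqP => XY; move: c; rewrite XY subrr expr0n/= ltNge sqr_ge0.
right; apply: H => //.
have [XY'|XY'|/eqP] := ltgtP X Y; last by rewrite (negbTE XY).
- by rewrite -mulrNN -invrN !opprB ler_pdivlMr ?ler_pdivrMr; nra.
- by rewrite ler_pdivlMr ?ler_pdivrMr; nra.
Qed.

Lemma nice_dilate s h c : nice s h -> nice s (fun x => h (c * x)).
Proof.
move=> nh; split.
- by move=> x; rewrite mulrN (nice_even nh).
- by move=> x; exact: (nice_ge0 nh).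
- have [K [m [K0 H]]] := nice_polylip nh.
  exists (K * `|c| * (1 + `|c|) ^+ m), m; split; first by rewrite !mulr_ge0// exprn_ge0// addr_ge0.
  move=> x y; rewrite (le_trans (H _ _))// -mulrBr normrM -!mulrA ler_wpM2l// ler_wpM2l//.
  rewrite [X in _ <= X]mulrCA -exprMn ler_wpM2l// lerXn2r ?nnegrE ?mulr_ge0 ?addr_ge0//.
  rewrite !normrM; have := normr_ge0 x; have := normr_ge0 y; have := normr_ge0 c.
  by nra.
- move=> u d x u0 d0 x0.
  have -> : diff3 u d (fun z => h (c * z)) x = diff3 (`|c| * u) (`|c| * d) h (`|c| * x).
    wlog c0 : c / 0 <= c.
      have [c0|c0] := leP 0 c; first by apply.
      move=> /(_ (- c)); rewrite normrN => <-; last by rewrite oppr_ge0 ltW.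
      by rewrite /diff3 /diff2; do !congr (_ + _); rewrite ?(mulNr c) ?(nice_even nh).
    by rewrite ger0_norm// /diff3 /diff2 !mulrDr !mulrN.
  by apply: (nice_diff3 nh); rewrite mulr_ge0.
Qed.

End schur.

Section schur2.
Context {R : realType}.
Local Notation mu := (@lebesgue_line R).
Local Notation mu2 := (mu \x mu)%E.
Implicit Types (h w : R -> R).

Lemma integral_EFin_integrable d (T : measurableType d) (m : {measure set T -> \bar R})
    (f : T -> R) (r : R) : measurable_fun setT f -> (forall x, 0 <= f x) ->
  (\int[m]_x (f x)%:E = r%:E)%E -> m.-integrable setT (EFin \o f).
Proof.
move=> mf f0 fr; apply/integrableP; split; first exact/measurable_EFinP.
by under eq_integral do rewrite /= ger0_norm//; rewrite fr ltry.
Qed.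

(** Integrates a pointwise inequality between four nonnegative functions whose
    integrals are known to be finite; finiteness gives the integrability needed
    to subtract. *)
Lemma integral_comb4_ge0 d (T : measurableType d) (m : {measure set T -> \bar R})
    (f1 f2 f3 f4 : T -> R) (s r1 r2 r3 r4 : R) :
  [/\ measurable_fun setT f1, measurable_fun setT f2, measurable_fun setT f3 &
      measurable_fun setT f4] ->
  (forall x, [/\ 0 <= f1 x, 0 <= f2 x, 0 <= f3 x & 0 <= f4 x]) ->
  [/\ \int[m]_x (f1 x)%:E = r1%:E, \int[m]_x (f2 x)%:E = r2%:E,
      \int[m]_x (f3 x)%:E = r3%:E & \int[m]_x (f4 x)%:E = r4%:E]%E ->
  (forall x, 0 <= s * ((f1 x - f2 x) - (f3 x - f4 x))) ->
  0 <= s * ((r1 - r2) - (r3 - r4)).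
Proof.
move=> [m1 m2 m3 m4] f0 [I1 I2 I3 I4] H.
have i1 : m.-integrable setT (EFin \o f1) by apply: (integral_EFin_integrable _ _ I1) => // x; case: (f0 x).
have i2 : m.-integrable setT (EFin \o f2) by apply: (integral_EFin_integrable _ _ I2) => // x; case: (f0 x).
have i3 : m.-integrable setT (EFin \o f3) by apply: (integral_EFin_integrable _ _ I3) => // x; case: (f0 x).
have i4 : m.-integrable setT (EFin \o f4) by apply: (integral_EFin_integrable _ _ I4) => // x; case: (f0 x).
have i12 : m.-integrable setT (EFin \o (fun x => f1 x - f2 x)) := integrableB measurableT i1 i2.
have i34 : m.-integrable setT (EFin \o (fun x => f3 x - f4 x)) := integrableB measurableT i3 i4.
have i : m.-integrable setT (EFin \o (fun x => (f1 x - f2 x) - (f3 x - f4 x))) := integrableB measurableT i12 i34.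
have <- : \int[m]_x f1 x = r1 by rewrite /Rintegral I1.
have <- : \int[m]_x f2 x = r2 by rewrite /Rintegral I2.
have <- : \int[m]_x f3 x = r3 by rewrite /Rintegral I3.
have <- : \int[m]_x f4 x = r4 by rewrite /Rintegral I4.
rewrite -!RintegralB// -RintegralZl//.
by apply: Rintegral_ge0.
Qed.

(** Symmetrize the integrand of the double integral by swapping coordinates, up
    to a sign, so that it becomes M(p) = h(c p_1) + h(c p_2) evaluated at the
    reflected point rho p. The product weight Phi is larger at the point whose
    squared coordinates are more balanced, where s M is smaller. Hence s (M(rho
    p) - M(p)) (Phi(p) - Phi(rho p)) >= 0, and as rho preserves area this
    integrates to the claim. *)
Lemma blur_schur s w a b c h : weight w -> nice s h -> 0 <= c -> c ^+ 2 = a ^+ 2 + b ^+ 2 ->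
  0 <= s * (blur w a (blur w b h) 0 - mass w * blur w c h 0).
Proof.
move=> ww nh c0 cE; have lh := nice_polylip nh.
have mh := polylip_measurable lh; have gh := polylip_growth lh.
have h0 := nice_ge0 nh; have w0 := weight_ge0 ww.
have [b0|b0] := eqVneq b 0.
  rewrite b0 blur_blur0// (@blur_sqr_eq _ _ a c)// ?subrr ?mulr0//.
  by rewrite cE b0 expr0n addr0.
have {}c0 : 0 < c.
  rewrite lt_neqAle c0 andbT; apply/eqP => c00; move: cE.
  rewrite -c00 expr0n/= => /esym/eqP; rewrite paddr_eq0 ?sqr_ge0// => /andP[_].
  by rewrite sqrf_eq0 (negbTE b0).
have bc0 : b / c != 0 by rewrite mulf_neq0// invr_eq0 gt_eqF.
have bcE : (a / c) ^+ 2 + (b / c) ^+ 2 = 1.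
  by rewrite !expr_div_n -mulrDl -cE divff// expf_neq0// gt_eqF.
pose A := blur w a (blur w b h) 0; pose B := mass w * blur w c h 0.
pose rho := reflection2 (a / c) (b / c).
pose Phi (p : R * R) := w p.1 * w p.2.
pose M (p : R * R) := h (c * p.1) + h (c * p.2).
have mPhi : measurable_fun setT Phi by exact: measurable_pair_weight.
have mM : measurable_fun setT M.
  by apply: measurable_funD; apply: measurableT_comp => //; apply: measurable_funM.
have mrho : measurable_fun setT rho by exact: measurable_reflection2.
have mMr : measurable_fun setT (M \o rho) by exact: measurableT_comp.
have mPr : measurable_fun setT (Phi \o rho) by exact: measurableT_comp.
have M0 p : 0 <= M p by rewrite addr_ge0.
have P0 p : 0 <= Phi p by rewrite mulr_ge0.
have mlin u v : measurable_fun setT (fun p : R * R => (h (0 + u * p.1 + v * p.2) * Phi p)%:E).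
  by apply/measurable_EFinP; apply: measurable_funM => //; exact: measurable_linear2.
have l0 u v p : (0 <= (h (0 + u * p.1 + v * p.2) * Phi p)%:E)%E.
  by rewrite lee_fin mulr_ge0.
have MrE p : M (rho p) = h (0 + a * p.1 + b * p.2) + h (0 + b * p.1 + (- a) * p.2).
  by rewrite /M /rho /=; congr (h _ + h _); field; rewrite gt_eqF.
have split2 (F1 F2 : R * R -> \bar R) : measurable_fun setT F1 -> measurable_fun setT F2 ->
    (forall p, 0 <= F1 p)%E -> (forall p, 0 <= F2 p)%E ->
    (\int[mu2]_p (F1 p + F2 p) = \int[mu2]_p F1 p + \int[mu2]_p F2 p)%E.
  by move=> m1 m2 F10 F20; rewrite ge0_integralD.
have IA : (\int[mu2]_p (M (rho p) * Phi p)%:E = (A + A)%:E)%E.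
  under eq_integral do rewrite MrE mulrDl EFinD.
  rewrite (split2 _ _ (mlin _ _) (mlin _ _) (l0 _ _) (l0 _ _)).
  rewrite -!(blur2E ww ww _ _ _ lh h0) EFinD; congr (_ + _%:E)%E.
  rewrite (blurC ww ww _ _ _ lh h0) /A; apply: (blur_sqr_eq _ ww _ (sqrrN a)).
  exact: polylip_measurable (blur_polylip ww b lh).
have IB : (\int[mu2]_p (M p * Phi p)%:E = (B + B)%:E)%E.
  have ME p : M p = h (0 + c * p.1 + 0 * p.2) + h (0 + 0 * p.1 + c * p.2).
    by rewrite /M !mul0r !addr0 !add0r.
  under eq_integral do rewrite ME mulrDl EFinD.
  rewrite (split2 _ _ (mlin _ _) (mlin _ _) (l0 _ _) (l0 _ _)).
  rewrite -!(blur2E ww ww _ _ _ lh h0) EFinD /B -(blur_blur0 c 0 ww lh).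
  by rewrite (blurC ww ww 0 c 0 lh h0).
have IA' : (\int[mu2]_p (M p * Phi (rho p))%:E = (A + A)%:E)%E.
  rewrite -IA -(@ge0_integral_reflection2 R (a / c) (b / c))//.
  - by apply: eq_integral => p _; rewrite /rho reflection2K.
  - by apply/measurable_EFinP; exact: measurable_funM.
  - by move=> p; rewrite lee_fin mulr_ge0.
have IB' : (\int[mu2]_p (M (rho p) * Phi (rho p))%:E = (B + B)%:E)%E.
  rewrite -IB -(@ge0_integral_reflection2 R (a / c) (b / c) (fun p => (M p * Phi p)%:E))//.
  - by apply/measurable_EFinP; exact: measurable_funM.
  - by move=> p; rewrite lee_fin mulr_ge0.
suff : 0 <= s * ((A + A) - (B + B) - ((B + B) - (A + A))).
  rewrite (_ : s * _ = 4 * (s * (A - B))); last by ring.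
  by rewrite pmulr_rge0.
apply: (@integral_comb4_ge0 _ _ mu2 (fun p => M (rho p) * Phi p) (fun p => M p * Phi p)
  (fun p => M (rho p) * Phi (rho p)) (fun p => M p * Phi (rho p))) => //.
- by split; exact: measurable_funM.
- by move=> p; split; rewrite mulr_ge0.
move=> p.
rewrite (_ : s * _ = (s * (M (rho p) - M p)) * (Phi p - Phi (rho p))); last by ring.
have nd := nice_dilate c nh.
(* An isometry preserves the sum of squares, so the two pairs can be compared. *)
have E : p.1 ^+ 2 + p.2 ^+ 2 = (rho p).1 ^+ 2 + (rho p).2 ^+ 2.
  rewrite -[LHS]mul1r -bcE /rho /=; ring.
have [[t [t01 h1 h2]]|[t [t01 h1 h2]]] := spread_cases E.
- rewrite mulr_ge0//; first exact: (nice_spread nd t01 h1 h2).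
  by rewrite subr_ge0; exact: (weight_spread ww t01 h1 h2).
- rewrite -mulrNN mulr_ge0//.
    by rewrite -mulrN opprB; exact: (nice_spread nd t01 h1 h2).
  by rewrite opprB subr_ge0; exact: (weight_spread ww t01 h1 h2).
Qed.

End schur2.

(** * Comparison of two weights with equal mass and second moment *)

Section crossing.
Context {R : realType}.
Local Notation mu := (@lebesgue_line R).
Implicit Types (h w : R -> R).

Lemma lebesgue_line_set1 (a : R) : mu [set a] = 0%E.
Proof. exact: lebesgue_measure_set1. Qed.

Lemma negligible_sqr (a : R) : mu.-negligible [set x : R | x ^+ 2 = a].
Proof.
exists ([set Num.sqrt a] `|` [set - Num.sqrt a]); split.
- exact: measurableU.
- rewrite measureU0//; first exact: lebesgue_line_set1.
  exact: lebesgue_line_set1.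
- move=> x /= <-; rewrite sqrtr_sqr; case: (ger0P x) => _; first by left.
  by rewrite opprK; right.
Qed.

Section two_weights.
Variables (f G : R -> R) (wf : weight f) (wG : weight G).
Hypothesis mass_eq : mass f = mass G.
Hypothesis moment2_eq : \int[mu]_x (x ^+ 2 * f x) = \int[mu]_x (x ^+ 2 * G x).

Let msq (A B : R) : measurable_fun setT (fun x : R => A + B * x ^+ 2).
Proof.
apply: measurable_funD => //; apply: measurable_funM => //.
Qed.

Let gsq (A B : R) : growth (fun x : R => A + B * x ^+ 2).
Proof.
by apply: growthD; [exact: growth_cst|apply: growthM; [exact: growth_cst|exact: growthX]].
Qed.

Lemma RintegralB_weights (k : R -> R) : measurable_fun setT k -> growth k ->
  mu.-integrable setT (EFin \o (fun x => k x * (G x - f x))) /\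
  \int[mu]_x (k x * (G x - f x)) = \int[mu]_x (k x * G x) - \int[mu]_x (k x * f x).
Proof.
move=> mk gk.
have iG := integrable_weight wG mk gk.
have i_f := integrable_weight wf mk gk.
rewrite -RintegralB//; under eq_Rintegral do rewrite mulrBr.
split => //.
under eq_fun do rewrite mulrBr.
exact: (integrableB measurableT iG i_f).
Qed.

Lemma quadratic_balance A B :
  \int[mu]_x ((A + B * x ^+ 2) * (G x - f x)) = 0.
Proof.
have [_ ->] := RintegralB_weights (msq A B) (gsq A B).
have H w : weight w -> \int[mu]_x ((A + B * x ^+ 2) * w x) =
    A * mass w + B * \int[mu]_x (x ^+ 2 * w x).
  move=> ww.
  have mX2 : measurable_fun setT (fun x : R => x ^+ 2) by [].
  have i2 := integrable_weight ww mX2 (growthX 2).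
  have := integrable_weight ww (measurable_cst (1 : R)) (growth_cst 1).
  under eq_fun do rewrite mul1r.
  move=> i1; rewrite /mass -!RintegralZl// -RintegralD//.
  - by apply: eq_Rintegral => x _; ring.
  - exact: (integrableZl measurableT _ i1).
  - exact: (integrableZl measurableT _ i2).
by rewrite !H// mass_eq moment2_eq subrr.
Qed.

(** The subtracted quadratic integrates to zero against G - f. *)
Lemma crossing_quadratic s h A B : measurable_fun setT h -> growth h ->
  (forall x, 0 <= (s * h x - (A + B * x ^+ 2)) * (G x - f x)) ->
  0 <= s * (\int[mu]_x (h x * G x) - \int[mu]_x (h x * f x)).
Proof.
move=> mh gh H.
have mk : measurable_fun setT (fun x => s * h x) by exact: measurable_funM.
have gk : growth (fun x => s * h x) by apply: growthM => //; exact: growth_cst.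
have [i _] := RintegralB_weights mh gh.
have [i1 _] := RintegralB_weights mk gk.
have [i2 _] := RintegralB_weights (msq A B) (gsq A B).
have -> : s * (\int[mu]_x (h x * G x) - \int[mu]_x (h x * f x)) =
    \int[mu]_x ((s * h x - (A + B * x ^+ 2)) * (G x - f x)).
  under [RHS]eq_Rintegral do rewrite mulrBl.
  rewrite RintegralB// quadratic_balance subr0.
  have [_ <-] := RintegralB_weights mh gh.
  by rewrite -RintegralZl//; apply: eq_Rintegral => x _; rewrite mulrA.
by apply: Rintegral_ge0.
Qed.

(** If G - f has the sign of a quadratic with zero integral against it, then f =
    G almost everywhere. *)
Lemma crossing_degenerate A B a h :
  (forall x, x ^+ 2 != a -> 0 <= (A + B * x ^+ 2) * (G x - f x)) ->
  (forall x, x ^+ 2 != a -> A + B * x ^+ 2 != 0) ->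
  measurable_fun setT h ->
  \int[mu]_x (h x * G x) = \int[mu]_x (h x * f x).
Proof.
move=> H0 H1 mh.
have [i _] := RintegralB_weights (msq A B) (gsq A B).
have I0 := quadratic_balance A B.
set u := fun x => (A + B * x ^+ 2) * (G x - f x) in i I0 *.
have uE : ae_eq mu setT (fun x => `|(u x)%:E|%E) (fun x => (u x)%:E).
  apply: (negligibleS _ (negligible_sqr a)) => x /= /not_implyP[_].
  move=> nx; apply: contrapT => /eqP xa; apply: nx.
  by rewrite ger0_norm// /u H0.
have mu_ := measurable_int _ i.
have u0 : ae_eq mu setT (fun x => (u x)%:E) (cst 0%E).
  apply/ae_eq_integral_abs => //.
  rewrite (ae_eq_integral (fun x => (u x)%:E))//; last exact: measurableT_comp.
  have := integrable_fin_num measurableT i => /fineK <-.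
  by congr EFin.
have hfG : ae_eq mu setT (fun x => (h x * G x)%:E) (fun x => (h x * f x)%:E).
  have N : mu.-negligible ([set x : R | x ^+ 2 = a] `|` ~` [set x | setT x -> (u x)%:E = cst 0%E x]).
    by apply: negligibleU => //; exact: negligible_sqr.
  apply: (negligibleS _ N) => x /= /not_implyP[_ hx].
  apply: contrapT => /not_orP[/eqP xa]; rewrite notK => /(_ I)[] /eqP.
  rewrite mulf_eq0 (negbTE (H1 _ xa))/= subr_eq0 => /eqP GE.
  by apply: hx; rewrite GE.
rewrite /Rintegral; congr fine; apply: ae_eq_integral => //.
- by apply/measurable_EFinP; apply: measurable_funM => //; exact: (weight_measurable wG).
- by apply/measurable_EFinP; apply: measurable_funM => //; exact: (weight_measurable wf).
Qed.

End two_weights.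
End crossing.

Section comparison.
Context {R : realType}.
Local Notation mu := (@lebesgue_line R).
Implicit Types (h w : R -> R).

(** Convexity in the square, with denominators cleared. *)
Lemma nice_three_points s h x z y : nice s h -> 0 <= x -> x <= z -> z <= y ->
  (y ^+ 2 - x ^+ 2) * (s * h z) <=
  (y ^+ 2 - z ^+ 2) * (s * h x) + (z ^+ 2 - x ^+ 2) * (s * h y).
Proof.
move=> nh x0 xz zy.
have [xy|xy] := eqVneq x y.
  have -> : z = x by apply/eqP; rewrite eq_le {1}xy zy xz.
  by rewrite -xy; lra.
have xy2 : 0 < y ^+ 2 - x ^+ 2.
  have : x < y by rewrite lt_neqAle xy (le_trans xz).
  by nra.
have n0 : y ^+ 2 - x ^+ 2 != 0 by rewrite gt_eqF.
pose t := (y ^+ 2 - z ^+ 2) / (y ^+ 2 - x ^+ 2).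
have tE : t * (y ^+ 2 - x ^+ 2) = y ^+ 2 - z ^+ 2 by rewrite /t divfK.
have t01 : 0 <= t <= 1.
  by rewrite /t ler_pdivlMr// ler_pdivrMr//; apply/andP; split; nra.
have zE : z ^+ 2 = t * x ^+ 2 + (1 - t) * y ^+ 2.
  rewrite (_ : t * _ + _ = y ^+ 2 - t * (y ^+ 2 - x ^+ 2)); last by ring.
  by rewrite tE; ring.
have := nice_convex_sqr nh t01 zE => H.
have := mulr_ge0 (ltW xy2) H.
rewrite (_ : _ * (s * _) = t * (y ^+ 2 - x ^+ 2) * (s * h x) +
  ((y ^+ 2 - x ^+ 2) - t * (y ^+ 2 - x ^+ 2)) * (s * h y) - (y ^+ 2 - x ^+ 2) * (s * h z)); last by ring.
by rewrite tE; lra.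
Qed.

Variables (f G : R -> R) (wf : weight f) (wG : weight G).
Hypothesis G_gt0 : forall x, 0 < G x.
Hypothesis G_logconvex : forall t x y z, 0 <= t <= 1 ->
  z ^+ 2 = t * x ^+ 2 + (1 - t) * y ^+ 2 -> G z <= G x `^ t * G y `^ (1 - t).
Hypothesis mass_eq : mass f = mass G.
Hypothesis moment2_eq : \int[mu]_x (x ^+ 2 * f x) = \int[mu]_x (x ^+ 2 * G x).

(** The ratio f / G is log-concave in x^2, so the set where it is at least 1 is
    order-convex on the half-line. *)
Lemma dominated_order_convex x z y : 0 <= x -> x <= z -> z <= y ->
  G x <= f x -> G y <= f y -> G z <= f z.
Proof.
move=> x0 xz zy Gx Gy.
have [xy|xy] := eqVneq x y.
  by have -> : z = x by apply/eqP; rewrite eq_le {1}xy zy xz.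
have xy2 : 0 < y ^+ 2 - x ^+ 2.
  have : x < y by rewrite lt_neqAle xy (le_trans xz).
  by nra.
pose t := (y ^+ 2 - z ^+ 2) / (y ^+ 2 - x ^+ 2).
have tE : t * (y ^+ 2 - x ^+ 2) = y ^+ 2 - z ^+ 2 by rewrite /t divfK// gt_eqF.
have t01 : 0 <= t <= 1.
  by rewrite /t ler_pdivlMr// ler_pdivrMr//; apply/andP; split; nra.
have zE : z ^+ 2 = t * x ^+ 2 + (1 - t) * y ^+ 2.
  rewrite (_ : t * _ + _ = y ^+ 2 - t * (y ^+ 2 - x ^+ 2)); last by ring.
  by rewrite tE; ring.
apply: (le_trans (G_logconvex t01 zE)); apply: le_trans (weight_logconcave wf t01 zE).
move/andP : t01 => [t0 t1].
have g0 u : 0 <= G u by rewrite ltW.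
by apply: ler_pM; rewrite ?powR_ge0// ge0_ler_powR ?nnegrE ?(weight_ge0 wf)// subr_ge0.
Qed.

Let absE (k : R -> R) : (forall x, k (- x) = k x) -> forall x, k `|x| = k x.
Proof. by move=> ek x; case: (ger0P x). Qed.

(** Let J be the set of x >= 0 with G x <= f x. If J has at most one point, or
    is unbounded, then G - f changes sign at most once in x^2, and equality of
    mass and second moment forces f = G almost everywhere. Otherwise J is an
    interval with ends al < be up to its end points, and s h minus the quadratic
    that interpolates s h at al and be is nonpositive inside J and nonnegative
    outside. *)
Lemma weight_comparison s h : nice s h ->
  0 <= s * (\int[mu]_x (h x * G x) - \int[mu]_x (h x * f x)).
Proof.
move=> nh; have lh := nice_polylip nh.
have mh := polylip_measurable lh; have gh := polylip_growth lh.
have fE := absE (weight_even wf); have GE := absE (weight_even wG).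
have hE := absE (nice_even nh).
have sqE (x : R) : `|x| ^+ 2 = x ^+ 2 by rewrite -normrX ger0_norm ?sqr_ge0.
have deg A B a := @crossing_degenerate R f G wf wG mass_eq moment2_eq A B a h.
pose J := [set x : R | 0 <= x /\ G x <= f x].
have [[x1 [x2 [[x10 J1] [x20 J2] x12]]]|nJ] :=
  pselect (exists x1 x2, [/\ J x1, J x2 & x1 < x2]); last first.
  (* J has at most one point x0 *)
  have [x0 Jx0] : exists x0, forall x, J x -> x = x0.
    have [[x0 Jx0]|nJ0] := pselect (exists x0, J x0).
      exists x0 => x Jx; apply/eqP; rewrite eq_le; apply/andP; split;
        rewrite leNgt; apply/negP => xx0; apply: nJ.
      - by exists x0, x.
      - by exists x, x0.
    by exists 0 => x Jx; exfalso; apply: nJ0; exists x.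
  rewrite (deg 1 0 (x0 ^+ 2))// ?subrr ?mulr0// => x xx0; last first.
    by rewrite mul0r addr0 oner_neq0.
  rewrite mul0r addr0 mul1r subr_ge0 leNgt; apply/negP => Gf.
  have /Jx0 xx : J `|x| by split => //; rewrite fE GE ltW.
  by move: xx0; rewrite -sqE xx eqxx.
have J0 : J !=set0 by exists x1.
have hiJ : has_inf J by split => //; exists 0 => x [].
pose al := inf J.
have al0 : 0 <= al by apply: lb_le_inf => // x [].
have al_lb x : J x -> al <= x by move=> Jx; apply: ge_inf => //; case: hiJ.
have out_lo x : `|x| < al -> f x < G x.
  rewrite ltNge => xal; rewrite ltNge; apply: contra xal => Gf.
  by apply: al_lb; split => //; rewrite fE GE.
have gt_al x : al < x -> exists2 y, J y & y < x.
  by move=> alx; have [y Jy yx] := inf_lt J0 alx; exists y.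
have [[M JM]|nM] := pselect (exists M, forall x, J x -> x <= M); last first.
  (* f dominates G beyond al *)
  rewrite (deg (al ^+ 2) (-1) (al ^+ 2))// ?subrr ?mulr0// => x xal; last first.
    by rewrite mulN1r subr_eq0 eq_sym.
  rewrite mulN1r; have [xl|xg] := ltP `|x| al.
    rewrite mulr_ge0//; last by rewrite subr_ge0 ltW// out_lo.
    by rewrite subr_ge0 -sqE; have := normr_ge0 x; nra.
  have {}xg : al < `|x|.
    rewrite lt_neqAle xg andbT; apply: contra xal => /eqP ->.
    by rewrite sqE.
  rewrite -mulrNN mulr_ge0//.
    by rewrite opprB subr_ge0 -(sqE x); nra.
  rewrite opprB subr_ge0 -fE -GE.
  have [y [y0 Jy] yx] := gt_al _ xg.
  have [z [z0 Jz] xz] : exists2 z, J z & `|x| <= z.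
    apply: contrapT => nz; apply: nM; exists `|x| => z Jz; rewrite leNgt.
    by apply/negP => xz; apply: nz; exists z => //; exact: ltW.
  exact: (dominated_order_convex y0 (ltW yx) xz).
have hsJ : has_sup J by split => //; exists M => x /JM.
pose be := sup J.
have be_ub x : J x -> x <= be by move=> Jx; apply: ub_le_sup => //; case: hsJ.
have out_hi x : be < `|x| -> f x < G x.
  rewrite ltNge => xbe; rewrite ltNge; apply: contra xbe => Gf.
  by apply: be_ub; split => //; rewrite fE GE.
have lt_be x : x < be -> exists2 y, J y & x < y.
  by move=> xbe; have [y Jy yx] := sup_gt J0 xbe; exists y.
have al1 : al <= x1 by apply: al_lb.
have be2 : x2 <= be by apply: be_ub.
have alb : al < be by rewrite (le_lt_trans al1)// (lt_le_trans x12).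
have ab2 : 0 < be ^+ 2 - al ^+ 2 by nra.
pose B := (s * h be - s * h al) / (be ^+ 2 - al ^+ 2).
have BE : B * (be ^+ 2 - al ^+ 2) = s * h be - s * h al by rewrite /B divfK// gt_eqF.
apply: (@crossing_quadratic R f G wf wG mass_eq moment2_eq s h (s * h al - B * al ^+ 2) B) => // x.
rewrite -(pmulr_rge0 _ ab2) mulrA.
rewrite -hE -fE -GE -(sqE x); have := normr_ge0 x.
have : f `|x| < G `|x| \/ al <= `|x| <= be.
  have [xl|xg] := ltP `|x| al; first by left; rewrite fE GE out_lo.
  by have [xl|xg'] := ltP be `|x|; [left; rewrite fE GE out_hi|right].
have lo : `|x| < al -> f `|x| < G `|x| by move=> ?; rewrite fE GE out_lo.
have hi : be < `|x| -> f `|x| < G `|x| by move=> ?; rewrite fE GE out_hi.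
move: lo hi; move: `|x| => {}x lo hi _ x0.
have -> : (be ^+ 2 - al ^+ 2) * (s * h x - (s * h al - B * al ^+ 2 + B * x ^+ 2)) =
  (be ^+ 2 - al ^+ 2) * (s * h x) - (be ^+ 2 - x ^+ 2) * (s * h al)
   - (x ^+ 2 - al ^+ 2) * (s * h be).
  rewrite (_ : (be ^+ 2 - x ^+ 2) * (s * h al) = (be ^+ 2 - al ^+ 2) * (s * h al)
    - (x ^+ 2 - al ^+ 2) * (s * h al)); last by ring.
  have -> : (x ^+ 2 - al ^+ 2) * (s * h be) = (x ^+ 2 - al ^+ 2) * (s * h al) +
     (x ^+ 2 - al ^+ 2) * (B * (be ^+ 2 - al ^+ 2)) by rewrite BE; ring.
  by ring.
have [xl|xal] := ltP x al.
  apply: mulr_ge0; last by rewrite subr_ge0 ltW// lo.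
  by have := nice_three_points nh x0 (ltW xl) (ltW alb); lra.
have [xg|xbe] := ltP be x.
  apply: mulr_ge0; last by rewrite subr_ge0 ltW// hi.
  by have := nice_three_points nh al0 (ltW alb) (ltW xg); lra.
have [->|xal'] := eqVneq x al; first by rewrite [X in X * _](_ : _ = 0) ?mul0r//; ring.
have [->|xbe'] := eqVneq x be; first by rewrite [X in X * _](_ : _ = 0) ?mul0r//; ring.
have [y [y0 Jy] yx] := gt_al x ltac:(by rewrite lt_neqAle eq_sym xal').
have [z [z0 Jz] xz] := lt_be x ltac:(by rewrite lt_neqAle xbe').
rewrite -mulrNN mulr_ge0//; last first.
  by rewrite opprB subr_ge0; apply: (dominated_order_convex y0 (ltW yx) (ltW xz)).
by have := nice_three_points nh al0 xal xbe; lra.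
Qed.

End comparison.

(** * Exponential and box weights *)

Section weight_instances.
Context {R : realType}.
Local Notation mu := (@lebesgue_line R).
Implicit Types (h w : R -> R).

Lemma lebesgue_lineE (f : R -> \bar R) (D : set R) : measurable D ->
  measurable_fun D f -> (forall x, 0 <= f x)%E ->
  (\int[mu]_(x in D) f x = \int[lebesgue_measure]_(x in D) f x)%E.
Proof.
move=> mD mf f0.
have mid : measurable_fun [set: measurableTypeR R] (id : measurableTypeR R -> R) by exact: measurable_id.
rewrite (eq_measure_integral (pushforward (@lebesgue_measure R) (id : measurableTypeR R -> R) : {measure set R -> \bar R})) //.
by rewrite (ge0_integral_pushforward mid) // => y _; exact: f0.
Qed.

Lemma powR_convex (p x y t : R) : 1 <= p -> 0 <= x -> 0 <= y -> 0 <= t <= 1 ->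
  (t * x + (1 - t) * y) `^ p <= t * x `^ p + (1 - t) * y `^ p.
Proof.
move=> p1 x0 y0 /andP[t0 t1].
by have := convex_powR p1 (Itv01 t0 t1); apply; rewrite inE/= in_itv/= ?x0 ?y0.
Qed.

Lemma weight_mass_pos w : (forall x, 0 <= w x) -> measurable_fun setT w ->
  (forall x y, `|x| <= `|y| -> w y <= w x) -> 0 < w 1 ->
  mu.-integrable setT (EFin \o w) -> 0 < \int[mu]_x w x.
Proof.
move=> w0 mw wn w1 iw; rewrite /Rintegral -lte_fin fineK; last exact: integrable_fin_num.
apply: (@lt_le_trans _ _ (w 1)%:E); first by rewrite lte_fin.
apply: (@le_trans _ _ (\int[mu]_(x in `[0%R, 1%R]) (w x)%:E)%E); last first.
  by apply: ge0_subset_integral => //; [exact/measurable_EFinP|move=> x _; rewrite lee_fin].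
apply: (@le_trans _ _ (\int[mu]_(x in `[0%R, 1%R]) (w 1)%:E)%E).
  rewrite integral_cst//= /lebesgue_line.
  by rewrite lebesgue_measure_itv/= lte01 oppr0 adde0 mule1.
apply: ge0_le_integral => //.
- by move=> x _; rewrite lee_fin.
- by apply: measurable_funTS; exact/measurable_EFinP.
- move=> x /=; rewrite in_itv/= => /andP[x0 x1]; rewrite lee_fin; apply: wn.
  by rewrite normr1 ger0_norm.
Qed.

Lemma integrable_scale (c : R) (f : R -> R) : c != 0 -> measurable_fun setT f ->
  mu.-integrable setT (fun x => (f (c * x))%:E) -> mu.-integrable setT (EFin \o f).
Proof.
move=> c0 mf /integrableP[_ fi]; apply/integrableP; split; first exact/measurable_EFinP.
rewrite (ge0_integral_affine 0 c0)//; last by apply: measurableT_comp => //; exact/measurable_EFinP.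
under eq_integral do rewrite addr0.
by rewrite lte_mul_pinfty.
Qed.

Lemma Rintegral_scale (c : R) (f : R -> R) : 0 < c -> measurable_fun setT f ->
  (forall x, 0 <= f x) -> \int[mu]_x f x = c * \int[mu]_x f (c * x).
Proof.
move=> c0 mf f0; rewrite /Rintegral (ge0_integral_affine 0 (lt0r_neq0 c0)); last 2 first.
- exact/measurable_EFinP.
- by move=> x; rewrite lee_fin.
rewrite [in LHS](eq_integral (fun x => (f (c * x))%:E)); last by move=> x _; rewrite addr0.
rewrite gtr0_norm//; case: (integral _ _ _) => [r|/=|/=]; first by rewrite -EFinM.
- by rewrite gt0_muley ?lte_fin// mulr0.
- by rewrite gt0_muleNy ?lte_fin// mulr0.
Qed.

Lemma integrable_gauss_scaled (c : R) : c != 0 ->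
  mu.-integrable setT (EFin \o (fun x => gauss_fun (x / c))).
Proof.
move=> c0; have mg := @measurable_gauss_fun R.
apply: (integrable_scale c0); first by apply: measurableT_comp => //; exact: measurable_funM.
apply/integrableP; split.
  by apply/measurable_EFinP; apply: measurableT_comp => //; apply: measurable_funM => //; exact: measurable_funM.
rewrite (eq_integral (fun x => (gauss_fun x)%:E)); last first.
  by move=> x _; rewrite abse_EFin ger0_norm ?gauss_fun_ge0//; congr (EFin (gauss_fun _)); field.
rewrite lebesgue_lineE ?integralT_gauss ?ltry//.
- exact/measurable_EFinP.
- by move=> x; rewrite lee_fin gauss_fun_ge0.
Qed.

(** (1 + |x|)^m <= exp(m |x|), and m |x| <= m^2/3 + 3 x^2/4 by completing the
    square; this leaves the integrable factor exp(-x^2/4). *)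
Lemma gauss_bound_moment w (C : R) : (forall x, 0 <= w x) -> measurable_fun setT w ->
  0 <= C -> (forall x, w x <= C * gauss_fun x) ->
  forall m, mu.-integrable setT (fun x => ((1 + `|x|) ^+ m * w x)%:E).
Proof.
move=> w0 mw C0 wC m.
have i : mu.-integrable setT (fun x => ((C * expR (m%:R ^+ 2 / 3))%:E * (gauss_fun (x / 2))%:E)%E).
  by apply: integrableZl => //; apply: integrable_gauss_scaled; rewrite pnatr_eq0.
apply: le_integrable i => //.
  apply/measurable_EFinP; apply: measurable_funM => //.
  by apply: measurable_funX; apply: measurable_funD.
move=> x _; rewrite -EFinM !abse_EFin lee_fin.
rewrite [leLHS]ger0_norm; last by rewrite mulr_ge0// exprn_ge0// addr_ge0.
rewrite [leRHS]ger0_norm; last by rewrite !mulr_ge0// expR_ge0.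
apply: (@le_trans _ _ ((1 + `|x|) ^+ m * (C * gauss_fun x))).
  by rewrite ler_wpM2l// exprn_ge0// addr_ge0.
rewrite mulrCA -mulrA ler_wpM2l//.
apply: (@le_trans _ _ (expR (m%:R * `|x|) * gauss_fun x)).
  rewrite ler_wpM2r ?gauss_fun_ge0// expRM_natl lerXn2r ?nnegrE ?addr_ge0 ?expR_ge0//.
  exact: expR_ge1Dx.
rewrite -!expRD ler_expR expr_div_n.
have sq (v : R) : `|v| ^+ 2 = v ^+ 2 by rewrite -normrX ger0_norm ?sqr_ge0.
rewrite -(sq x).
have := sqr_ge0 (`|x| * 3 / 2 - m%:R).
by move: (`|x|) (m%:R : R) => X M; nra.
Qed.

Definition expw (r x : R) : R := expR (- `|x| `^ r).

Lemma measurable_expw r : measurable_fun setT (expw r).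
Proof.
apply: measurableT_comp => //; apply: measurable_funN.
by apply: (@measurableT_comp _ _ _ _ _ _ (@powR R ^~ r)).
Qed.

Lemma powR2 (x : R) : 0 <= x -> x `^ 2 = x ^+ 2.
Proof. by move=> x0; rewrite -powR_mulrn. Qed.

Lemma sqr_norm (x : R) : `|x| ^+ 2 = x ^+ 2.
Proof. by rewrite -normrX ger0_norm ?sqr_ge0. Qed.

Lemma expw2 : expw 2 = gauss_fun.
Proof. by apply/funext => x; rewrite /expw powR2// sqr_norm. Qed.

Lemma norm_powR_sqr r (x : R) : `|x| `^ r = (x ^+ 2) `^ (r / 2).
Proof. by rewrite -sqr_norm -powR2// -powRrM mulrC divfK. Qed.

(** Log-concavity in x^2 is convexity of the power r/2 >= 1. *)
Lemma expw_weight r : 2 <= r -> weight (expw r).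
Proof.
move=> r2.
have r0 : 0 <= r by exact: le_trans r2.
have w0 x : 0 <= expw r x by rewrite expR_ge0.
have wn x y : `|x| <= `|y| -> expw r y <= expw r x.
  by move=> xy; rewrite /expw ler_expR lerN2 ge0_ler_powR ?nnegrE.
have mw := measurable_expw r.
have mom : forall m, mu.-integrable setT (fun x => ((1 + `|x|) ^+ m * expw r x)%:E).
  apply: (@gauss_bound_moment _ (expR 1)); rewrite ?expR_ge0//.
  move=> x; rewrite /expw /gauss_fun -expRD ler_expR -(sqr_norm x).
  have [x1|x1] := leP 1 `|x|.
    by rewrite -powR2//; have := ler_powR x1 r2; lra.
  have := powR_ge0 `|x| r; have := normr_ge0 x; nra.
split => //.
- by move=> x; rewrite /expw normrN.
- move=> t x y z t01 zE; rewrite /expw -!expRM -expRD ler_expR.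
  rewrite !norm_powR_sqr zE.
  have := @powR_convex (r / 2) (x ^+ 2) (y ^+ 2) t _ (sqr_ge0 x) (sqr_ge0 y) t01.
  by move=> /(_ _)/wrap[|]; lra.
- have i : mu.-integrable setT (EFin \o expw r).
    by have := mom 0%N; under eq_fun do rewrite expr0 mul1r.
  by apply: weight_mass_pos => //; exact: expR_gt0.
Qed.

Definition boxw (x : R) : R := (`|x| <= 1)%R%:R.

Lemma measurable_boxw : measurable_fun setT boxw.
Proof.
have -> : boxw = \1_(`[-1, 1]%classic).
  by apply/funext => x; rewrite /boxw indicE mem_setE in_itv/= ler_norml.
by [].
Qed.

Lemma boxw_weight : weight boxw.
Proof.
have w0 x : 0 <= boxw x by rewrite ler0n.
have wn x y : `|x| <= `|y| -> boxw y <= boxw x.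
  by move=> xy; rewrite /boxw; case: (leP `|y| 1) => // y1; rewrite (le_trans xy y1).
have mw := measurable_boxw.
have mom : forall m, mu.-integrable setT (fun x => ((1 + `|x|) ^+ m * boxw x)%:E).
  apply: (@gauss_bound_moment _ (expR 1)); rewrite ?expR_ge0//.
  move=> x; rewrite /boxw /gauss_fun -expRD.
  have [x1|x1] := leP `|x| 1; last exact: expR_ge0.
  have : expR 0 <= expR (1 + - x ^+ 2); last by rewrite expR0.
  by rewrite ler_expR -(sqr_norm x); have := normr_ge0 x; nra.
split => //.
- by move=> x; rewrite /boxw normrN.
- move=> t x y z /andP[t0 t1] zE; rewrite /boxw.
  have sq1 (v : R) : (`|v| <= 1) = (v ^+ 2 <= 1).
    by rewrite -sqr_norm -[X in _ = (_ <= X)](expr1n _ 2) ler_sqr ?nnegrE.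
  have := sqr_ge0 x; have := sqr_ge0 y; rewrite !sq1 zE.
  move: (x ^+ 2) (y ^+ 2) => X Y Y0 X0.
  have [t00|t00] := eqVneq t 0.
    rewrite t00 powRr0 mul1r subr0 mul1r mul0r add0r powRr1//.
  have [t11|t11] := eqVneq t 1.
    by rewrite t11 subrr powRr0 mulr1 mul1r mul0r addr0 powRr1.
  have f0 : false%:R = 0 :> R by [].
  have f1 : true%:R = 1 :> R by [].
  have [X1|X1] := leP X 1; last by rewrite f0 powR0// mul0r ler0n.
  have [Y1|Y1] := leP Y 1; last by rewrite f0 [0 `^ (1 - t)]powR0 ?mulr0 ?ler0n// subr_eq0 eq_sym.
  have -> : (t * X + (1 - t) * Y <= 1)%R by nra.
  by rewrite f1 !powR1 mulr1.
- have i : mu.-integrable setT (EFin \o boxw).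
    by have := mom 0%N; under eq_fun do rewrite expr0 mul1r.
  by apply: weight_mass_pos => //; rewrite /boxw normr1 lexx.
Qed.

Lemma weight_dilate w (k c : R) : weight w -> 0 < k -> 0 < c -> weight (fun x : R => k * w (x / c)).
Proof.
move=> ww k0 c0; have mw := weight_measurable ww.
have kw0 x : 0 <= k * w (x / c) by rewrite mulr_ge0 ?(weight_ge0 ww) ?(ltW k0).
have mkw : measurable_fun setT (fun x : R => k * w (x / c)).
  by apply: measurable_funM => //; apply: measurableT_comp => //; exact: measurable_funM.
have wn x y : `|x| <= `|y| -> k * w (y / c) <= k * w (x / c).
  by move=> xy; rewrite ler_pM2l//; apply: (weight_nonincr ww); rewrite !normrM ler_wpM2r.
have mom : forall m, mu.-integrable setT (fun x => ((1 + `|x|) ^+ m * (k * w (x / c)))%:E).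
  move=> m; apply: (@integrable_scale c); first by rewrite gt_eqF.
    apply: measurable_funM => //.
    by apply: measurable_funX; apply: measurable_funD.
  pose q (y : R) := (1 + `|y|) ^+ m * k.
  have mq : measurable_fun setT q.
    by apply: measurable_funM => //; apply: measurable_funX; apply: measurable_funD.
  have gq : growth q.
    apply: growthM; last exact: growth_cst.
    by exists 1, m => x; rewrite mul1r ger0_norm// exprn_ge0// addr_ge0.
  have := integrable_weight_aff ww 0 c mq gq; congr (integrable _ _ _).
  apply/funext => x; rewrite add0r /q mulrA; congr (EFin (_ * w _)); field; by rewrite gt_eqF.
split => //.
- by move=> x; rewrite mulNr (weight_even ww).
- move=> t x y z t01 zE; have w0 := weight_ge0 ww.
  rewrite !powRM ?w0 ?(ltW k0)// mulrACA -powRD ?subrKC ?oner_eq0// powRr1 ?(ltW k0)// ler_pM2l//.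
  apply: (weight_logconcave ww) => //.
  by rewrite !expr_div_n zE; field; rewrite gt_eqF.
have i : mu.-integrable setT (EFin \o (fun x => k * w (x / c))).
  by have := mom 0%N; under eq_fun do rewrite expr0 mul1r.
rewrite (Rintegral_scale c0)//.
have -> : (fun x => k * w (c * x / c)) = (fun x => k * w x).
  by apply/funext => x; rewrite mulrAC divff ?gt_eqF// mul1r.
have iw : mu.-integrable setT (EFin \o w).
  by have := weight_moment ww 0; under eq_fun do rewrite expr0 mul1r.
rewrite RintegralZl//.
by rewrite !mulr_gt0// (weight_mass_gt0 ww).
Qed.

End weight_instances.

(** * Chains of blurs, and the Gaussian bounds *)

Section chains.
Context {R : realType}.
Local Notation mu := (@lebesgue_line R).
Local Notation g := (@gauss_fun R).
Implicit Types (h w : R -> R) (l : seq R).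

Definition variance w := \int[mu]_x (x ^+ 2 * w x) / mass w.

Lemma variance_gt0 w : weight w -> 0 < variance w.
Proof.
move=> ww; have w0 := weight_ge0 ww; have mw := weight_measurable ww.
have m0 : 0 < mass w := weight_mass_gt0 ww.
rewrite divr_gt0// lt_neqAle; apply/andP; split; last first.
  by apply: Rintegral_ge0 => x _; rewrite mulr_ge0 ?sqr_ge0.
apply/eqP => I0.
have mX2 : measurable_fun setT (fun x : R => x ^+ 2) by [].
have i := integrable_weight ww mX2 (growthX 2).
have u0 : ae_eq mu setT (fun x => (x ^+ 2 * w x)%:E) (cst 0%E).
  apply/ae_eq_integral_abs => //; first exact: measurable_int i.
  rewrite (eq_integral (fun x : R => (x ^+ 2 * w x)%:E)); last first.
    by move=> x _; rewrite abse_EFin ger0_norm// mulr_ge0// sqr_ge0.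
  by rewrite -(fineK (integrable_fin_num measurableT i)); congr EFin.
have w00 : ae_eq mu setT (EFin \o w) (cst 0%E).
  have N := negligibleU (negligible_sqr (0 : R)) u0.
  apply: (negligibleS _ N) => x /= /not_implyP[_ hx].
  apply: contrapT => /not_orP[/eqP xa]; rewrite notK => /(_ I)[] /eqP.
  rewrite mulf_eq0 (negbTE xa)/= => /eqP wx0.
  by apply: hx; rewrite wx0.
move: m0; rewrite /mass /Rintegral (ae_eq_integral (cst 0%E))//.
- by rewrite integral0 ltxx.
- exact/measurable_EFinP.
Qed.

Lemma gauss_weight : weight g.
Proof. by rewrite -expw2; exact: expw_weight. Qed.

Lemma gauss_radial : radial g.
Proof. by move=> x y u v E; rewrite /gauss_fun -!expRD -!opprD E. Qed.

Lemma gauss_mass : mass g = Num.sqrt pi.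
Proof.
rewrite /mass /Rintegral lebesgue_lineE ?integralT_gauss//.
- by apply/measurable_EFinP; exact: measurable_gauss_fun.
- by move=> x; rewrite lee_fin gauss_fun_ge0.
Qed.

(** The dilation factor that gives the weight exp(-x^2) the variance of w. *)
Definition gauss_ratio w := Num.sqrt (variance w / variance g).

(** Applies weight_comparison to the dilated Gaussian with the mass and second
    moment of w; it is log-affine in x^2. *)
Lemma gauss_comparison w a s h : weight w -> nice s h ->
  0 <= s * (mass w / mass g * blur g (gauss_ratio w * a) h 0 - blur w a h 0).
Proof.
move=> ww nh; have wg := gauss_weight.
set c := gauss_ratio w.
have c0 : 0 < c by rewrite sqrtr_gt0 divr_gt0// variance_gt0.
have cE : c ^+ 2 * variance g = variance w.
  rewrite sqr_sqrtr ?divfK ?gt_eqF ?variance_gt0//.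
  by rewrite ltW// divr_gt0// variance_gt0.
have Z0 : 0 < mass w := weight_mass_gt0 ww.
have P0 : 0 < mass g := weight_mass_gt0 wg.
(* The dilation by c multiplies the mass by c, hence the factor c here. *)
pose k := mass w / (c * mass g).
have k0 : 0 < k by rewrite divr_gt0// mulr_gt0.
pose G x := k * g (x / c).
have wG : weight G by exact: weight_dilate.
have GcE x : G (c * x) = k * g x by rewrite /G; congr (_ * g _); field; rewrite gt_eqF.
have G0 := weight_ge0 wG; have mG := weight_measurable wG.
have scaleG q : measurable_fun setT q -> growth q -> (forall x, 0 <= q x) ->
    \int[mu]_x (q x * G x) = c * k * \int[mu]_x (q (0 + c * x) * g x).
  move=> mq gq q0; rewrite (Rintegral_scale c0)//; last 2 first.
  - exact: measurable_funM.
  - by move=> x; rewrite mulr_ge0.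
  have -> : (fun x => q (c * x) * G (c * x)) = (fun x => k * (q (0 + c * x) * g x)).
    by apply/funext => x; rewrite GcE add0r mulrCA.
  rewrite RintegralZl ?mulrA//; exact: integrable_weight_aff.
have kE : c * k * mass g = mass w.
  by rewrite /k; field; rewrite !gt_eqF.
have nd := nice_dilate a nh.
have lh := nice_polylip nd.
have mX2 : measurable_fun setT (fun x : R => x ^+ 2) by [].
have := @weight_comparison R w G ww wG _ _ _ _ s _ nd.
move=> /(_ _ _ _ _)/wrap[].
- by move=> x; rewrite mulr_gt0// expR_gt0.
- move=> t x y z /andP[t0 t1] zE; rewrite /G 2?(@powRM _ k (g _)) ?(ltW k0) ?gauss_fun_ge0//.
  rewrite [leRHS]mulrACA -powRD ?subrKC ?oner_eq0// powRr1 ?(ltW k0)// ler_pM2l//.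
  rewrite /gauss_fun -!expRM -expRD ler_expR !expr_div_n zE.
  by rewrite le_eqVlt; apply/orP; left; apply/eqP; field; rewrite gt_eqF.
- have := scaleG (fun=> 1) (measurable_cst _) (growth_cst 1) (fun=> ler01).
  rewrite (_ : (fun x => 1 * G x) = G); last by apply/funext => x; rewrite mul1r.
  rewrite (_ : (fun x => 1 * g x) = g); last by apply/funext => x; rewrite mul1r.
  by rewrite -/(mass g) kE.
- rewrite (scaleG _ mX2 (growthX 2))//; last by move=> x; exact: sqr_ge0.
  have -> : (fun x => (0 + c * x) ^+ 2 * g x) = (fun x => c ^+ 2 * (x ^+ 2 * g x)).
    by apply/funext => x; rewrite add0r exprMn mulrA.
  rewrite RintegralZl//; last exact: integrable_weight (growthX 2).
  have -> : \int[mu]_x (x ^+ 2 * w x) = variance w * mass w by rewrite divfK// gt_eqF.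
  have -> : \int[mu]_x (x ^+ 2 * g x) = variance g * mass g by rewrite divfK// gt_eqF.
  by rewrite -cE -kE; ring.
rewrite scaleG; last 3 first.
- exact: polylip_measurable.
- exact: polylip_growth.
- exact: (nice_ge0 nd).
congr (0 <= s * (_ - _)).
- have -> : c * k = mass w / mass g by rewrite /k; field; rewrite !gt_eqF.
  by congr (_ * _); apply: eq_Rintegral => x _; rewrite !add0r mulrA (mulrC c).
- by apply: eq_Rintegral => x _; rewrite add0r.
Qed.

Definition chain w l h := foldr (blur w) h l.
Lemma chain_cons w a l h : chain w (a :: l) h = blur w a (chain w l h).
Proof. by []. Qed.

Definition sqsum l : R := \sum_(a <- l) a ^+ 2.

Lemma sqsum_ge0 l : 0 <= sqsum l.
Proof. by apply: sumr_ge0 => a _; exact: sqr_ge0. Qed.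

Lemma sqsum_cons a l : sqsum (a :: l) = a ^+ 2 + sqsum l.
Proof. by rewrite /sqsum big_cons. Qed.

Lemma chain_nice w l s h : weight w -> nice s h -> nice s (chain w l h).
Proof. by move=> ww nh; elim: l => //= a l IH; exact: blur_nice. Qed.

Lemma chain_polylip w l h : weight w -> polylip h -> polylip (chain w l h).
Proof. by move=> ww nh; elim: l => //= a l IH; exact: blur_polylip. Qed.

Lemma chain_ge0 w l h x : weight w -> (forall y, 0 <= h y) -> 0 <= chain w l h x.
Proof. by move=> ww h0; elim: l x => //= a l IH x; exact: blur_ge0. Qed.

Lemma blurZ w a k h x : weight w -> polylip h ->
  blur w a (fun y => k * h y) x = k * blur w a h x.
Proof.
move=> ww lh; have mh := polylip_measurable lh; have gh := polylip_growth lh.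
have := @blur_linear _ _ ww a h h k 0 x mh gh mh gh.
rewrite mul0r addr0 => <-; apply: eq_Rintegral => y _.
by rewrite mul0r addr0.
Qed.

Lemma chainZ w l k h x : weight w -> polylip h ->
  chain w l (fun y => k * h y) x = k * chain w l h x.
Proof.
move=> ww lh; elim: l x => //= a l IH x.
rewrite -blurZ//; last exact: chain_polylip.
by congr blur; apply/funext.
Qed.

Lemma chain_blurC w v l a h x : weight w -> weight v -> polylip h -> (forall y, 0 <= h y) ->
  chain w l (blur v a h) x = blur v a (chain w l h) x.
Proof.
move=> ww wv lh h0; elim: l x => //= b l IH x.
rewrite -blurC//; last 2 first.
- exact: chain_polylip.
- by move=> y; exact: chain_ge0.
by congr blur; apply/funext.
Qed.

(** Merges the first two coefficients by blur_schur, and repeats with one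
    coefficient less. *)
Lemma chain_lower w a l s h : weight w -> nice s h ->
  0 <= s * (chain w (a :: l) h 0 -
            mass w ^+ size l * blur w (Num.sqrt (sqsum (a :: l))) h 0).
Proof.
move=> ww nh; have Z0 : 0 < mass w := weight_mass_gt0 ww.
elim: l a => [|b l IH] a.
  rewrite /= expr0 mul1r sqsum_cons /sqsum big_nil addr0 sqrtr_sqr.
  rewrite (@blur_sqr_eq _ w a `|a|)// ?subrr ?mulr0// ?sqr_norm//.
  exact: (polylip_measurable (nice_polylip nh)).
(* The induction hypothesis is applied to the merged coefficient c in place of a. *)
have [c c0 cE] : exists2 c : R, 0 <= c & c ^+ 2 = a ^+ 2 + b ^+ 2.
  exists (Num.sqrt (a ^+ 2 + b ^+ 2)); first exact: sqrtr_ge0.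
  by rewrite sqr_sqrtr// addr_ge0 ?sqr_ge0.
have h2 := blur_schur ww (chain_nice l ww nh) c0 cE.
have := IH c; rewrite !sqsum_cons !chain_cons cE addrA [size (b :: l)]/= => h1.
have := addr_ge0 h2 (mulr_ge0 (ltW Z0) h1); congr (0 <= _).
by rewrite (exprS (mass w)); ring.
Qed.

(** Each step replaces one weight by a Gaussian and merges it with the Gaussian
    of width tau accumulated so far; blurs commute, so the new Gaussian can be
    moved next to the old one. *)
Lemma chain_upper_aux w l s h tau : weight w -> nice s h ->
  0 <= s * (mass w ^+ size l * blur g (Num.sqrt (tau ^+ 2 + gauss_ratio w ^+ 2 * sqsum l)) h 0
     - chain w l (blur g tau h) 0).
Proof.
move=> ww nh; have Z0 : 0 < mass w := weight_mass_gt0 ww.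
have wg := gauss_weight; have P0 : 0 < mass g := weight_mass_gt0 wg.
have lh := nice_polylip nh; have h0 := nice_ge0 nh.
elim: l tau => [|a l IH] tau.
  rewrite /= expr0 mul1r /sqsum big_nil mulr0 addr0 sqrtr_sqr.
  rewrite (@blur_sqr_eq _ g tau `|tau|)// ?subrr ?mulr0// ?sqr_norm//.
  exact: (polylip_measurable lh).
set c := gauss_ratio w.
(* The width of the Gaussian after merging the new one, of width c a. *)
pose d := Num.sqrt (tau ^+ 2 + c ^+ 2 * a ^+ 2).
have dE : d ^+ 2 = (c * a) ^+ 2 + tau ^+ 2.
  by rewrite sqr_sqrtr ?exprMn 1?addrC// addr_ge0 ?sqr_ge0// mulr_ge0 ?sqr_ge0.
have h1 := gauss_comparison a ww (chain_nice l ww (blur_nice wg tau nh)).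
rewrite -/c -chain_blurC// in h1; last 2 first.
- exact: blur_polylip.
- by move=> y; exact: blur_ge0.
have bE : blur g (c * a) (blur g tau h) = fun x => mass g * blur g d h x.
  apply/funext => x; apply: blur_merge_radial => //; first exact: gauss_radial.
  exact: sqrtr_ge0.
rewrite bE chainZ// in h1; last exact: blur_polylip.
have h2 := IH d; rewrite dE exprMn -/c in h2.
have := addr_ge0 h1 (mulr_ge0 (ltW Z0) h2); congr (0 <= _).
have -> : tau ^+ 2 + c ^+ 2 * sqsum (a :: l) = c ^+ 2 * a ^+ 2 + tau ^+ 2 + c ^+ 2 * sqsum l.
  by rewrite sqsum_cons; ring.
rewrite chain_cons [size (a :: l)]/= (exprS (mass w)).
field; by rewrite gt_eqF.
Qed.

Lemma chain_upper w l s h : weight w -> nice s h ->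
  0 <= s * (mass w ^+ size l / mass g * blur g (gauss_ratio w * Num.sqrt (sqsum l)) h 0
            - chain w l h 0).
Proof.
move=> ww nh; have wg := gauss_weight; have P0 : 0 < mass g := weight_mass_gt0 wg.
have lh := nice_polylip nh.
have := chain_upper_aux l 0 ww nh; rewrite expr0n/= add0r.
have -> : blur g 0 h = fun x => mass g * h x.
  by apply/funext => x; rewrite blur0// mulrC.
rewrite chainZ// sqrtrM ?sqr_ge0// sqrtr_sqr ger0_norm ?sqrtr_ge0// => H.
have PV : 0 <= (mass g)^-1 by rewrite invr_ge0 ltW.
have := mulr_ge0 PV H; congr (0 <= _).
field; by rewrite gt_eqF.
Qed.

(** For the Gaussian weight all merges are equalities. *)
Lemma chain_gauss l h x : polylip h -> (forall y, 0 <= h y) ->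
  mass g * chain g l h x = mass g ^+ size l * blur g (Num.sqrt (sqsum l)) h x.
Proof.
move=> lh h0; have wg := gauss_weight; have P0 : 0 < mass g := weight_mass_gt0 wg.
elim: l x => [|a l IH] x.
  by rewrite /= /sqsum big_nil sqrtr0 blur0// expr0 mul1r mulrC.
rewrite /= -blurZ//; last exact: chain_polylip.
rewrite (_ : (fun y => _) = fun y => mass g ^+ size l * blur g (Num.sqrt (sqsum l)) h y).
  rewrite blurZ//; last exact: blur_polylip.
  rewrite (@blur_merge_radial _ _ a _ (Num.sqrt (sqsum (a :: l))))//.
  - by rewrite mulrA exprSr.
  - exact: gauss_radial.
  - by rewrite !sqr_sqrtr ?sqsum_ge0// sqsum_cons.
by apply/funext => y; exact: IH.
Qed.

End chains.

(** * Powers of the absolute value *)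

Section power_nice.
Context {R : realType}.

(** Young's inequality with conjugate exponents p and p / (p - 1). *)
Lemma bernoulli_powR (p u : R) : 1 <= p -> 0 <= u -> 1 + p * (u - 1) <= u `^ p.
Proof.
move=> p1 u0; have p0 : 0 < p by exact: lt_le_trans p1.
have [->|pn1] := eqVneq p 1; first by rewrite powRr1//; lra.
have {}p1 : 1 < p by rewrite lt_neqAle eq_sym pn1.
have q0 : 0 < p / (p - 1) by rewrite divr_gt0// subr_gt0.
have pq : p^-1 + (p / (p - 1))^-1 = 1 by field; rewrite subr_eq0 !gt_eqF.
have := conjugate_powR u0 ler01 p0 q0 pq.
rewrite powR1 mulr1 mul1r => H.
have := ler_wpM2l (ltW p0) H.
have -> : p * (u `^ p / p + (p / (p - 1))^-1) = u `^ p + (p - 1).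
  by field; rewrite subr_eq0 !gt_eqF.
by lra.
Qed.

Lemma powR_diff_le (p a b : R) : 1 <= p -> 0 <= b -> b <= a ->
  a `^ p - b `^ p <= p * (a - b) * a `^ (p - 1).
Proof.
move=> p1 b0 ba; have a0 : 0 <= a by exact: le_trans ba.
have p0 : 0 < p by exact: lt_le_trans p1.
have [a00|an0] := eqVneq a 0.
  have -> : b = 0 by apply/eqP; rewrite eq_le b0 andbT -a00.
  by rewrite a00 !subrr mulr0 mul0r.
have {an0}a0 : 0 < a by rewrite lt_neqAle eq_sym an0.
have ba0 : 0 <= b / a by rewrite divr_ge0// ltW.
have := ler_wpM2l (powR_ge0 a p) (bernoulli_powR p1 ba0).
rewrite -powRM ?(ltW a0)// [a * _]mulrC divfK ?gt_eqF// => H.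
have -> : p * (a - b) * a `^ (p - 1) = p * (1 - b / a) * a `^ p.
  by rewrite -(mulr_powRB1 (ltW a0) p0); field; rewrite gt_eqF.
by nra.
Qed.

Lemma nat_above (x : R) : exists m : nat, x <= m%:R.
Proof.
exists (Num.truncn `|x|).+1.
by rewrite (le_trans (ler_norm _))// ltW// truncnS_gt.
Qed.

Lemma polylip_abs_powR (p : R) : 1 <= p -> polylip (fun x => `|x| `^ p).
Proof.
move=> p1; have p0 : 0 < p by exact: lt_le_trans p1.
have [m pm] := nat_above (p - 1).
exists p, m; split; first exact: ltW.
move=> x y.
have S0 : 0 <= 1 + `|x| + `|y| by rewrite !addr_ge0.
wlog yx : x y S0 / `|y| <= `|x|.
  move=> H; have [/H|/ltW yx] := leP `|y| `|x|; first exact.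
  have := H y x; rewrite [X in _ -> _ -> X <= _]distrC [`|y - x|]distrC [1 + `|y| + `|x|]addrAC.
  by apply.
have yx' : `|y| `^ p <= `|x| `^ p by rewrite ge0_ler_powR ?nnegrE// ltW.
rewrite ger0_norm ?subr_ge0// (le_trans (powR_diff_le _ _ yx))//.
apply: ler_pM.
- by rewrite mulr_ge0 ?subr_ge0// ltW.
- exact: powR_ge0.
- by rewrite ler_pM2l// lerB_dist.
apply: (@le_trans _ _ ((1 + `|x| + `|y|) `^ (p - 1))).
  by rewrite ge0_ler_powR ?nnegrE ?subr_ge0 ?addr_ge0// addrAC lerDr addr_ge0.
rewrite -powR_mulrn ?addr_ge0// ler_powR//.
by rewrite -addrA lerDl addr_ge0.
Qed.

Lemma is_derive_abs_powR (p x : R) : x != 0 ->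
  is_derive x 1 (fun z : R => `|z| `^ p) (p * (Num.sg x * `|x| `^ (p - 1))).
Proof.
move=> x0; have [xl|xg|/esym/eqP] := ltgtP x 0; last by rewrite eq_sym (negbTE x0).
- rewrite ltr0_sg// ltr0_norm// mulN1r.
  apply: (@near_eq_is_derive _ _ _ (fun z => (- z) `^ p)).
    by near=> z; rewrite ltr0_norm//; near: z; exact: lt_nbhsl.
  have Nx0 : 0 < - x by rewrite oppr_gt0.
  have d1 := is_derive1_powR p Nx0.
  have d2 := is_deriveN (is_derive_id x (1 : R)).
  have := is_derive1_comp d1 d2.
  by rewrite mulrN1 mulrN.
- rewrite gtr0_sg// gtr0_norm// mul1r.
  apply: (@near_eq_is_derive _ _ _ (fun z => z `^ p)).
    by near=> z; rewrite gtr0_norm//; near: z; exact: lt_nbhsr.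
  exact: is_derive1_powR.
Unshelve. all: end_near. Qed.

(** Write the power m as a times the power m - 1, which is monotone. *)
Lemma powR_superadd (m a b : R) : 1 <= m -> 0 <= a -> 0 <= b ->
  a `^ m + b `^ m <= (a + b) `^ m.
Proof.
move=> m1 a0 b0; have m0 : 0 < m by exact: lt_le_trans m1.
have m10 : 0 <= m - 1 by rewrite subr_ge0.
rewrite -(mulr_powRB1 a0)// -(mulr_powRB1 b0)// -(mulr_powRB1 (addr_ge0 a0 b0))//.
have ha : a `^ (m - 1) <= (a + b) `^ (m - 1).
  by apply: ge0_ler_powR => //; rewrite ?nnegrE ?addr_ge0 ?lerDl.
have hb : b `^ (m - 1) <= (a + b) `^ (m - 1).
  by apply: ge0_ler_powR => //; rewrite ?nnegrE ?addr_ge0 ?lerDr.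
by rewrite mulrDl lerD// ler_wpM2l.
Qed.

Lemma powR_subadd (m a b : R) : 0 <= m -> m <= 1 -> 0 <= a -> 0 <= b ->
  (a + b) `^ m <= a `^ m + b `^ m.
Proof.
move=> m0 m1 a0 b0.
have [->|mn0] := eqVneq m 0; first by rewrite !powRr0; lra.
have {mn0}m0 : 0 < m by rewrite lt_neqAle eq_sym mn0.
have M1 : 1 <= m^-1 by rewrite invf_ge1.
have := powR_superadd M1 (powR_ge0 a m) (powR_ge0 b m).
rewrite -!powRrM divff ?gt_eqF// !powRr1// => H.
have := ge0_ler_powR (ltW m0) _ _ H; rewrite !nnegrE addr_ge0// powR_ge0 => /(_ erefl erefl).
by rewrite -powRrM mulVf ?gt_eqF// powRr1// addr_ge0 ?powR_ge0.
Qed.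

Lemma powR_midconcave (m a b : R) : 0 <= m -> m <= 1 -> 0 <= a -> 0 <= b ->
  a `^ m + b `^ m <= 2 * ((a + b) / 2) `^ m.
Proof.
move=> m0 m1 a0 b0.
have [->|mn0] := eqVneq m 0; first by rewrite !powRr0; lra.
have {mn0}m0 : 0 < m by rewrite lt_neqAle eq_sym mn0.
have M1 : 1 <= m^-1 by rewrite invf_ge1.
have h01 : 0 <= (2^-1 : R) <= 1 by apply/andP; split; lra.
have := powR_convex M1 (powR_ge0 a m) (powR_ge0 b m) h01.
rewrite -!powRrM divff ?gt_eqF// !powRr1// => H.
have h2 : 1 - 2^-1 = 2^-1 :> R by field.
rewrite h2 -!mulrDr in H.
have q0 : 0 <= 2^-1 * (a `^ m + b `^ m) by rewrite mulr_ge0 ?addr_ge0 ?powR_ge0.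
have := ge0_ler_powR (ltW m0) _ _ H; rewrite !nnegrE mulr_ge0 ?addr_ge0// powR_ge0 => /(_ erefl erefl).
rewrite -powRrM mulVf ?gt_eqF// powRr1// [X in _ <= X `^ _]mulrC.
by move: (_ `^ m) => X; lra.
Qed.

Lemma powR_midconvex (m a b : R) : 1 <= m -> 0 <= a -> 0 <= b ->
  2 * ((a + b) / 2) `^ m <= a `^ m + b `^ m.
Proof.
move=> m1 a0 b0.
have h01 : 0 <= (2^-1 : R) <= 1 by apply/andP; split; lra.
have := powR_convex m1 a0 b0 h01.
have h2 : 1 - 2^-1 = 2^-1 :> R by field.
rewrite h2 -!mulrDr [2^-1 * (a + b)]mulrC.
by move: (_ `^ m) => X; lra.
Qed.

(** The second difference at z > 0 of the odd function sg(x) |x|^m, where m = p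
    - 1. For z > u it is a midpoint convexity or concavity statement. For z < u
    it reads (u + z)^m - (u - z)^m - 2 z^m, and u + z = (u - z) + 2 z, so
    superadditivity or subadditivity applies. *)
Lemma odd_powR_diff2 (m s u z : R) : 0 <= m ->
  (s = 1 /\ 1 <= m \/ s = -1 /\ m <= 1) -> 0 < u -> 0 < z -> z != u ->
  0 <= s * (Num.sg (z + u) * `|z + u| `^ m + Num.sg (z - u) * `|z - u| `^ m
            - 2 * z `^ m).
Proof.
move=> m0 sm u0 z0 zu.
have zu0 : 0 < z + u by rewrite addr_gt0.
rewrite gtr0_sg// gtr0_norm// mul1r.
have [zl|zg|/esym/eqP] := ltgtP z u; last by rewrite eq_sym (negbTE zu).
- have zul : z - u < 0 by rewrite subr_lt0.
  rewrite ltr0_sg// ltr0_norm// mulN1r opprB.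
  have uz0 : 0 <= u - z by rewrite subr_ge0 ltW.
  have z20 : 0 <= 2 * z by rewrite mulr_ge0// ltW.
  have zE : z + u = (u - z) + 2 * z by ring.
  case: sm => -[-> m1].
  + have h1 := powR_superadd m1 uz0 z20; rewrite -zE in h1.
    have h2 : 2 * z `^ m <= (2 * z) `^ m.
      by rewrite powRM ?(ltW z0)// ler_wpM2r ?powR_ge0// le1r_powR// ler1n.
    by rewrite mul1r; lra.
  + have h1 := powR_subadd m0 m1 uz0 z20; rewrite -zE in h1.
    have h2 : (2 * z) `^ m <= 2 * z `^ m.
      by rewrite powRM ?(ltW z0)// ler_wpM2r ?powR_ge0// ler1_powR// ler1n.
    by rewrite mulN1r; lra.
- have zul : 0 < z - u by rewrite subr_gt0.
  rewrite gtr0_sg// gtr0_norm// mul1r.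
  have zE : (z + u + (z - u)) / 2 = z by field.
  case: sm => -[-> m1].
  + by have := powR_midconvex m1 (ltW zu0) (ltW zul); rewrite zE; lra.
  + by have := powR_midconcave m0 m1 (ltW zu0) (ltW zul); rewrite zE; lra.
Qed.

Lemma nondecreasing_of_derive (f f' : R -> R) (a b : R) : continuous f ->
  (forall x, a < x < b -> is_derive x 1 f (f' x)) -> (forall x, a < x < b -> 0 <= f' x) ->
  forall x y, a <= x -> x <= y -> y <= b -> f x <= f y.
Proof.
move=> cf df f0 x y ax xy yb.
apply: (@ger0_derive1_le_cc _ f a b) => //.
- by move=> z; rewrite in_itv/= => /df; case.
- move=> z; rewrite in_itv/= => zab; have := df _ zab => -[_ dE].
  by rewrite derive1E dE f0.
- exact: continuous_subspaceT.
- by rewrite in_itv/= ax (le_trans xy).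
- by rewrite in_itv/= yb (le_trans ax).
Qed.

(** The derivative of x |-> diff2 u h x is p times the second difference of an
    odd power, except at 0 and u where h may fail to be differentiable;
    monotonicity is glued across u by continuity. *)
Lemma abs_powR_nice (p s : R) : 1 <= p -> (s = 1 /\ 2 <= p \/ s = -1 /\ p <= 2) ->
  nice s (fun x => `|x| `^ p).
Proof.
move=> p1 sp; have lip := polylip_abs_powR p1; split => //.
- by move=> x; rewrite normrN.
move=> u d x u0 d0 x0.
set h := fun x : R => `|x| `^ p.
have hN z : h (- z) = h z by rewrite /h normrN.
have ch : continuous h by exact: polylip_continuous.
have [->|un0] := eqVneq u 0.
  by rewrite /diff3 /diff2 !addr0 !subr0; nra.
have {un0}u0 : 0 < u by rewrite lt_neqAle eq_sym un0.
pose f z := s * diff2 u h z.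
have m0 : 0 <= p - 1 by rewrite subr_ge0.
have sm : s = 1 /\ 1 <= p - 1 \/ s = -1 /\ p - 1 <= 1.
  by case: sp => -[-> H]; [left|right]; split => //; lra.
pose f' z := s * (p * (Num.sg (z + u) * `|z + u| `^ (p - 1)) +
  p * (Num.sg (z - u) * `|z - u| `^ (p - 1)) - 2 * (p * (Num.sg z * `|z| `^ (p - 1)))).
have dsh (c z : R) : z + c != 0 ->
    is_derive z (1 : R) (fun y : R => h (y + c)) (p * (Num.sg (z + c) * `|z + c| `^ (p - 1))).
  move=> zc; have d1 := is_derive_abs_powR p zc.
  have d2 := is_deriveD (is_derive_id z (1 : R)) (is_derive_cst c z (1 : R)).
  have := @is_derive1_comp R h (id + cst c) z _ _ d1 d2.
  by rewrite addr0 mulr1.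
have df (z : R) : 0 < z -> z != u -> is_derive z (1 : R) f (f' z).
  move=> z0 zu.
  have d1 : is_derive z 1 _ _ := @dsh u z ltac:(by rewrite gt_eqF// addr_gt0).
  have d2 : is_derive z 1 _ _ := @dsh (- u) z ltac:(by rewrite subr_eq0).
  have d3 : is_derive z 1 _ _ := is_derive_abs_powR p (lt0r_neq0 z0).
  exact: (is_deriveZ s (is_deriveB (is_deriveD d1 d2) (is_deriveZ 2 d3))).
have f'0 z : 0 < z -> z != u -> 0 <= f' z.
  move=> z0 zu; have := odd_powR_diff2 m0 sm u0 z0 zu => H.
  have p0 : 0 <= p by exact: le_trans p1.
  have := mulr_ge0 p0 H; congr (0 <= _).
  by rewrite /f' (gtr0_sg z0) (gtr0_norm z0); ring.
have cf : continuous f.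
  move=> z; apply: cvgMr; apply: cvgB; first apply: cvgD.
  - by apply: (@continuous_comp _ _ _ (fun y => y + u) h);
      [apply: cvgD; [exact: cvg_id|exact: cvg_cst]|exact: ch].
  - by apply: (@continuous_comp _ _ _ (fun y => y - u) h);
      [apply: cvgB; [exact: cvg_id|exact: cvg_cst]|exact: ch].
  - by apply: cvgMr; exact: ch.
have mono y z : 0 <= y -> y <= z -> f y <= f z.
  move=> y0 yz.
  have lo a b : 0 <= a -> a <= b -> b <= u -> f a <= f b.
    move=> a0 ab bu; apply: (@nondecreasing_of_derive f f' 0 u) => //.
    + by move=> t /andP[t0 tu]; apply: df => //; rewrite lt_eqF.
    + by move=> t /andP[t0 tu]; apply: f'0 => //; rewrite lt_eqF.
  have hi a b : u <= a -> a <= b -> f a <= f b.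
    move=> ua ab; apply: (@nondecreasing_of_derive f f' u b) => //.
    + by move=> t /andP[t0 tu]; apply: df; rewrite ?gt_eqF// (lt_trans u0).
    + by move=> t /andP[t0 tu]; apply: f'0; rewrite ?gt_eqF// (lt_trans u0).
  have [zu|/ltW uz] := leP z u; first exact: lo.
  have [yu|/ltW uy] := leP y u; last exact: hi.
  by rewrite (le_trans (lo y u _ _ _))// hi.
have fN z : f (- z) = f z.
  rewrite /f /diff2 hN (_ : - z + u = - (z - u)); last by ring.
  by rewrite -opprD !hN; ring.
rewrite /diff3 mulrBr -/(f (x + d)) -/(f (x - d)) subr_ge0.
have [xd|xd] := leP 0 (x - d); first by apply: mono => //; lra.
by rewrite -(fN (x - d)); apply: mono; lra.
Qed.

End power_nice.

(** * Chains as integrals over tuples *)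

Section tuple_chain.
Context {R : realType}.
Local Notation mu := (@lebesgue_line R).
Implicit Types (h w : R -> R).

Definition lin n (a : 'I_n -> R) (t : n.-tuple R) := \sum_(i < n) a i * tnth t i.
Definition coefs n (a : 'I_n -> R) : seq R := [seq a i | i <- enum 'I_n].

Lemma coefsS n (a : 'I_n.+1 -> R) :
  coefs a = a ord0 :: coefs (fun i => a (lift ord0 i)).
Proof. by rewrite /coefs enum_ordSl /= -map_comp. Qed.

Lemma size_coefs n (a : 'I_n -> R) : size (coefs a) = n.
Proof. by rewrite size_map size_enum_ord. Qed.

Lemma sqsum_coefs n (a : 'I_n -> R) : sqsum (coefs a) = \sum_(i < n) a i ^+ 2.
Proof. by rewrite /sqsum big_map big_enum. Qed.

Lemma lin_cons n (a : 'I_n.+1 -> R) x (t : n.-tuple R) :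
  lin a [tuple of x :: t] = a ord0 * x + lin (fun i => a (lift ord0 i)) t.
Proof.
rewrite /lin big_ord_recl tnth0; congr (_ + _).
by apply: eq_bigr => i _; rewrite tnthS.
Qed.

Lemma prod_cons n w x (t : n.-tuple R) :
  \prod_(i < n.+1) w (tnth [tuple of x :: t] i) = w x * \prod_(i < n) w (tnth t i).
Proof.
rewrite big_ord_recl tnth0; congr (_ * _).
by apply: eq_bigr => i _; rewrite tnthS.
Qed.

Lemma measurable_lin n (a : 'I_n -> R) : measurable_fun setT (lin a).
Proof.
apply: measurable_sum => i; apply: measurable_funM => //; exact: measurable_tnth.
Qed.

Lemma measurable_prod_tuple n w : measurable_fun setT w ->
  measurable_fun setT (fun t : n.-tuple R => \prod_(i < n) w (tnth t i)).
Proof.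
move=> mw; apply: measurable_prod => i _.
by apply: measurableT_comp => //; exact: measurable_tnth.
Qed.

Lemma chain_tuple w n (a : 'I_n -> R) h x : weight w -> polylip h -> (forall y, 0 <= h y) ->
  (\int[lebesgue_tuple R n]_t (h (x + lin a t) * \prod_(i < n) w (tnth t i))%:E =
   (chain w (coefs a) h x)%:E)%E.
Proof.
move=> ww lh h0; have mh := polylip_measurable lh; have mw := weight_measurable ww.
have w0 := weight_ge0 ww.
elim: n a x => [|n IH] a x.
  rewrite ge0_integral_lebesgue_tuple0; last first.
    apply/measurable_EFinP; apply: measurable_funM; last exact: measurable_prod_tuple.
    by apply: measurableT_comp => //; apply: measurable_funD => //; exact: measurable_lin.
  by rewrite /lin !big_ord0 addr0 mulr1 /coefs (size0nil (size_enum_ord 0)).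
rewrite ge0_integral_lebesgue_tupleS; last 2 first.
- apply/measurable_EFinP; apply: measurable_funM; last exact: measurable_prod_tuple.
  by apply: measurableT_comp => //; apply: measurable_funD => //; exact: measurable_lin.
- by move=> t; rewrite lee_fin mulr_ge0// prodr_ge0.
rewrite coefsS chain_cons.
have lc := chain_polylip (coefs (fun i => a (lift ord0 i))) ww lh.
rewrite blurE//; last 3 first.
- exact: polylip_measurable.
- exact: polylip_growth.
- by move=> y; exact: chain_ge0.
apply: eq_integral => y _; rewrite mulrC EFinM -IH -ge0_integralZl//; last 3 first.
- apply/measurable_EFinP; apply: measurable_funM; last exact: measurable_prod_tuple.
  by apply: measurableT_comp => //; apply: measurable_funD => //; exact: measurable_lin.
- by move=> t _; rewrite lee_fin mulr_ge0// prodr_ge0.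
- by rewrite lee_fin.
by apply: eq_integral => t _; rewrite lin_cons prod_cons -EFinM addrA mulrCA.
Qed.

End tuple_chain.

(** * Jensen's inequality for moments *)

Section jensen.
Context {R : realType}.

Definition moment_sign (s p : R) := s = 1 /\ 2 <= p \/ s = -1 /\ p <= 2.

(** The tangent line at 1 of the power p / 2. *)
Lemma powR_tangent (s p u : R) : 1 <= p -> moment_sign s p -> 0 <= u ->
  0 <= s * (u `^ (p / 2) - 1 - (p / 2 * u - p / 2)).
Proof.
move=> p1 sp u0; case: sp => -[-> h].
  have p21 : 1 <= p / 2 by lra.
  by have := bernoulli_powR p21 u0; rewrite mul1r; lra.
have p20 : 0 < p / 2 by lra.
have p21 : 1 <= (p / 2)^-1 by rewrite invf_ge1//; lra.
have := bernoulli_powR p21 (powR_ge0 u (p / 2)).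
rewrite -powRrM divff ?gt_eqF// powRr1// => H.
have := ler_wpM2l (ltW p20) H.
rewrite mulrDr mulrA divff ?gt_eqF// mulr1 mul1r.
by move: (u `^ _) => U; lra.
Qed.

(** Integrates the tangent inequality at the mean M of f^2 with respect to the
    weight v, scaled by M; the linear terms cancel. *)
Lemma jensen_moment d (T : measurableType d) (m : {measure set T -> \bar R})
    (v f : T -> R) (s p r0 r2 rp : R) : 1 <= p -> moment_sign s p ->
  measurable_fun setT v -> measurable_fun setT f ->
  (forall x, 0 <= v x) -> (forall x, 0 <= f x) -> 0 < r0 -> 0 < r2 ->
  (\int[m]_x (v x)%:E = r0%:E)%E -> (\int[m]_x (f x ^+ 2 * v x)%:E = r2%:E)%E ->
  (\int[m]_x (f x `^ p * v x)%:E = rp%:E)%E ->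
  0 <= s * (rp / r0 - (r2 / r0) `^ (p / 2)).
Proof.
move=> p1 sp mv mf v0 f0 r00 r20 I0 I2 Ip.
pose M := r2 / r0; have M0 : 0 < M by exact: divr_gt0.
pose X := M `^ (p / 2).
have X0 : 0 < X by exact: powR_gt0.
have p0 : 0 <= p by exact: le_trans p1.
have p20 : 0 <= p / 2 by rewrite divr_ge0.
have mf2 : measurable_fun setT (fun x => f x ^+ 2) by exact: measurable_funX.
have mfp : measurable_fun setT (fun x => f x `^ p).
  exact: (@measurableT_comp _ _ _ _ _ _ (@powR R ^~ p)).
have IZ k (q : T -> R) r : 0 <= k -> measurable_fun setT q -> (forall x, 0 <= q x) ->
    (\int[m]_x (q x)%:E = r%:E -> \int[m]_x (k * q x)%:E = (k * r)%:E)%E.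
  move=> k0 mq q0 Iq; under eq_integral do rewrite EFinM.
  rewrite ge0_integralZl//; first by rewrite Iq EFinM.
  - exact/measurable_EFinP.
  - by move=> x _; rewrite lee_fin.
have H := @integral_comb4_ge0 _ _ _ m (fun x => f x `^ p * v x) (fun x => X * v x)
  (fun x => p / 2 * X / M * (f x ^+ 2 * v x)) (fun x => p / 2 * X * v x) s rp (X * r0)
  (p / 2 * X / M * r2) (p / 2 * X * r0).
have {}H : 0 <= s * (rp - X * r0 - (p / 2 * X / M * r2 - p / 2 * X * r0)).
  apply: H.
  - by split; do ?[apply: measurable_funM].
  - move=> x; split; rewrite !mulr_ge0 ?invr_ge0 ?powR_ge0 ?sqr_ge0 ?(ltW X0) ?(ltW M0)//.
  - split => //.
    + by apply: IZ => //; exact: ltW.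
    + apply: IZ => //; first by rewrite !mulr_ge0 ?invr_ge0 ?(ltW X0) ?(ltW M0).
      * exact: measurable_funM.
      * by move=> x; rewrite mulr_ge0 ?sqr_ge0.
    + by apply: IZ => //; rewrite !mulr_ge0 ?(ltW X0).
  - move=> x.
    have u0 : 0 <= f x ^+ 2 / M by rewrite divr_ge0 ?sqr_ge0 ?ltW.
    have := mulr_ge0 (mulr_ge0 (ltW X0) (v0 x)) (powR_tangent p1 sp u0).
    have -> : (f x ^+ 2 / M) `^ (p / 2) = f x `^ p / X.
      have MV : M^-1 `^ (p / 2) = X^-1.
        by rewrite -(powR_inv1 (ltW M0)) -powRrM mulN1r powRN.
      rewrite powRM ?sqr_ge0 ?invr_ge0 ?(ltW M0)// MV -(powR2 (f0 x)) -powRrM.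
      by congr (_ `^ _ / _); rewrite mulrC divfK.
    congr (0 <= _); rewrite -/X; field.
    by rewrite !gt_eqF.
have E : p / 2 * X / M * r2 = p / 2 * X * r0.
  by rewrite /M; field; rewrite !gt_eqF.
rewrite E subrr subr0 in H.
have ir : 0 <= r0^-1 by rewrite invr_ge0 ltW.
have := mulr_ge0 ir H; congr (0 <= _); rewrite -/M -/X.
by field; rewrite gt_eqF.
Qed.

End jensen.

(** * Gamma integrals *)

Section gamma_integral.
Context {R : realType}.
Local Notation mu := (@lebesgue_line R).

Lemma measurable_natr_bool d (T : measurableType d) (b : T -> bool) :
  measurable_fun setT b -> measurable_fun setT (fun x => (b x)%:R : R).
Proof.
move=> mb; rewrite (_ : (fun _ => _) = (fun x => if b x then 1 else 0 : R)).
  exact: measurable_fun_ifT.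
by apply/funext => x; case: (b x).
Qed.

(** The exponential density restricted to t >= a, where t > 0. Integrating it
    over t recovers exp(-a) for a >= 0, which writes exp(-N) as a superposition
    of indicators of sublevel sets of N. *)
Definition expt (a t : R) : R := ((0 < t) && (a <= t))%R%:R * expR (- t).

Lemma expt_ge0 a t : 0 <= expt a t.
Proof. by rewrite mulr_ge0 ?expR_ge0. Qed.

Lemma measurable_expt a : measurable_fun setT (expt a).
Proof.
apply: measurable_funM; last by apply: measurableT_comp => //; exact: measurable_funN.
apply: measurable_natr_bool; apply: measurable_and; first exact: measurable_fun_ltr.
exact: measurable_fun_ler.
Qed.

Lemma integral_expR_tail (a : R) :
  (\int[lebesgue_measure]_(t in `[a, +oo[) (expR (- t))%:E = (expR (- a))%:E)%E.
Proof.
have cN : continuous (fun t : R => expR (- t)).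
  move=> t; apply: (@continuous_comp _ _ _ (fun t : R => - t) expR).
    exact: (@cvgN _ _ _ _ _ id).
  exact: continuous_expR.
rewrite (@ge0_continuous_FTC2y R _ (fun t => - expR (- t)) a 0).
- by rewrite sub0e -EFinN opprK.
- by move=> t _; exact: expR_ge0.
- exact: continuous_subspaceT.
- rewrite -oppr0; apply: cvgN; exact: cvgr_expR.
- by move=> t _; apply: derivableN; exact: ex_derive.
- by apply: cvg_at_right_filter; apply: cvgN; exact: cN.
- move=> t _; rewrite derive1E deriveN//.
  rewrite -derive1E derive1_comp// !derive1E deriveN// derive_id.
  by rewrite derive_val mulrN1 opprK.
Qed.

Lemma integral_expt (a : R) : 0 <= a -> (\int[mu]_t (expt a t)%:E = (expR (- a))%:E)%E.
Proof.
move=> a0.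
rewrite lebesgue_lineE//; last 2 first.
- by apply/measurable_EFinP; exact: measurable_expt.
- by move=> t; rewrite lee_fin expt_ge0.
have me (D : set (measurableTypeR R)) : measurable_fun D (fun t : R => (expR (- t))%:E).
  apply: measurable_funTS; apply/measurable_EFinP.
  by apply: measurableT_comp => //; exact: measurable_funN.
have [->|an0] := eqVneq a 0.
  rewrite -integral_expR_tail -integral_itv_obnd_cbnd; last exact: me.
  rewrite [RHS]integral_mkcond; apply: eq_integral => t _; rewrite patchE mem_setE in_itv/= andbT /expt.
  case: ltP => t0 /=; last by rewrite mul0r.
  by rewrite ltW// mul1r.
have {an0}a0 : 0 < a by rewrite lt_neqAle eq_sym an0.
rewrite -integral_expR_tail [RHS]integral_mkcond; apply: eq_integral => t _.
rewrite patchE mem_setE in_itv/= andbT /expt.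
case: (leP a t) => ta; last by rewrite andbF mul0r.
by rewrite (lt_le_trans a0 ta) mul1r.
Qed.

Definition gfun (s t : R) : R := (0 < t)%R%:R * (t `^ s * expR (- t)).

Lemma gfun_ge0 s t : 0 <= gfun s t.
Proof. by rewrite !mulr_ge0 ?powR_ge0 ?expR_ge0. Qed.

Lemma measurable_gfun s : measurable_fun setT (gfun s).
Proof.
apply: measurable_funM; first by apply: measurable_natr_bool; exact: measurable_fun_ltr.
apply: measurable_funM; first exact: measurable_powR.
by apply: measurableT_comp => //; exact: measurable_funN.
Qed.

(** gint s is Gamma(s + 1), see GammaE. *)
Definition gint s := \int[mu]_t gfun s t.

Lemma integrable_gfun s : 0 <= s -> mu.-integrable setT (EFin \o gfun s).
Proof.
move=> s0; have [m sm] := nat_above s.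
(* Chosen so that (1 + t)^m <= M^m exp (m (1 + t) / M) and m / M <= 1/2. *)
pose M : R := m%:R * 2 + 1.
have M0 : 0 < M by rewrite ltr_wpDl// mulr_ge0.
pose K := M ^+ m * expR 1.
have ie : mu.-integrable setT (EFin \o (fun t => expt 0 (t / 2))).
  apply: (@integrable_scale _ 2) => //.
    by apply: measurableT_comp; [exact: measurable_expt|exact: measurable_funM].
  have ie0 : mu.-integrable setT (EFin \o expt 0).
    exact: (integral_EFin_integrable (measurable_expt 0) (expt_ge0 0) (integral_expt (lexx 0))).
  move: ie0; congr (integrable _ _ _); apply/funext => t /=; congr (EFin (expt _ _)).
  by field.
have i : mu.-integrable setT (fun t => (K%:E * (expt 0 (t / 2))%:E)%E) by exact: integrableZl.
apply: le_integrable i => //; first by apply/measurable_EFinP; exact: measurable_gfun.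
move=> t _; rewrite -EFinM !abse_EFin lee_fin.
have K0 : 0 <= K by rewrite mulr_ge0 ?exprn_ge0 ?expR_ge0 ?ltW.
rewrite (ger0_norm (gfun_ge0 s t)) (ger0_norm (mulr_ge0 K0 (expt_ge0 0 (t / 2)))).
rewrite /gfun /expt; case: ltP => t0; last by rewrite mul0r (mulr_ge0 K0)// mulr_ge0 ?expR_ge0.
have t20 : 0 < t / 2 by exact: divr_gt0.
rewrite t20 (ltW t20) /= !mul1r.
have h1 : t `^ s <= (1 + t) ^+ m.
  rewrite -powR_mulrn ?addr_ge0 ?(ltW t0)//.
  apply: (@le_trans _ _ ((1 + t) `^ s)).
    by rewrite ge0_ler_powR ?nnegrE ?addr_ge0 ?(ltW t0)// lerDr.
  by rewrite ler_powR// lerDl ltW.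
have h2 : (1 + t) ^+ m <= M ^+ m * expR (m%:R * ((1 + t) / M)).
  rewrite expRM_natl -exprMn lerXn2r ?nnegrE ?mulr_ge0 ?addr_ge0 ?expR_ge0 ?(ltW t0) ?(ltW M0)//.
  rewrite -ler_pdivrMl// mulrC; apply: le_trans (expR_ge1Dx _).
  by rewrite lerDr.
have h3 : expR (m%:R * ((1 + t) / M)) <= expR (1 + t / 2).
  rewrite ler_expR mulrA ler_pdivrMr// /M; have := ler0n R m; nra.
apply: (le_trans (ler_wpM2r (expR_ge0 (- t)) h1)).
apply: (le_trans (ler_wpM2r (expR_ge0 (- t)) h2)).
rewrite /K -!mulrA; apply: ler_wpM2l; first by rewrite exprn_ge0// ltW.
apply: (le_trans (ler_wpM2r (expR_ge0 (- t)) h3)).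
by rewrite -!expRD ler_expR; lra.
Qed.

Lemma gintE s : 0 <= s -> (\int[mu]_t (gfun s t)%:E = (gint s)%:E)%E.
Proof.
move=> s0; rewrite /gint /Rintegral fineK//; apply: integrable_fin_num => //.
exact: integrable_gfun.
Qed.

Lemma gint_gt0 s : 0 <= s -> 0 < gint s.
Proof.
move=> s0; rewrite -lte_fin -gintE//.
apply: (@lt_le_trans _ _ (expR (- 2))%:E); first by rewrite lte_fin expR_gt0.
apply: (@le_trans _ _ (\int[mu]_(x in `[1%R, 2%R]) (gfun s x)%:E)%E); last first.
  apply: ge0_subset_integral => //; first by apply/measurable_EFinP; exact: measurable_gfun.
  by move=> x _; rewrite lee_fin gfun_ge0.
apply: (@le_trans _ _ (\int[mu]_(x in `[1%R, 2%R]) (expR (- 2))%:E)%E).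
  rewrite integral_cst//= /lebesgue_line.
  rewrite lebesgue_measure_itv/= lte_fin ltr1n -EFinB.
  by rewrite (_ : 2 - 1 = 1 :> R) ?mule1//; ring.
apply: ge0_le_integral => //.
- by apply: measurable_funTS; apply/measurable_EFinP; exact: measurable_gfun.
- move=> x /=; rewrite in_itv/= => /andP[x1 x2]; rewrite lee_fin /gfun.
  rewrite (lt_le_trans ltr01 x1) mul1r.
  rewrite (@le_trans _ _ (1 * expR (- x)))//; first by rewrite mul1r ler_expR lerN2.
  rewrite ler_wpM2r ?expR_ge0//.
  by have := ler_powR x1 s0; rewrite powRr0.
Qed.

End gamma_integral.

(** * From the ball to a product weight, and a scaling identity *)

Section ball_gamma.
Context {R : realType}.
Local Notation mu := (@lebesgue_line R).

Definition powsum (r : R) n (t : n.-tuple R) : R := \sum_(i < n) `|tnth t i| `^ r.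

Lemma powsum_ge0 r n (t : n.-tuple R) : 0 <= powsum r t.
Proof. by apply: sumr_ge0 => i _; exact: powR_ge0. Qed.

Lemma measurable_powsum r n : measurable_fun setT (@powsum r n).
Proof.
apply: measurable_sum => i.
apply: (@measurableT_comp _ _ _ _ _ _ (@powR R ^~ r)) => //.
by apply: measurableT_comp => //; exact: measurable_tnth.
Qed.

Lemma powsum_scalet r n c (t : n.-tuple R) : 0 <= c ->
  powsum r (scalet c t) = c `^ r * powsum r t.
Proof.
move=> c0; rewrite /powsum mulr_sumr; apply: eq_bigr => i _.
by rewrite tnth_mktuple normrM powRM// ger0_norm.
Qed.

Lemma lin_scalet n (a : 'I_n -> R) c t : lin a (scalet c t) = c * lin a t.
Proof.
rewrite /lin mulr_sumr; apply: eq_bigr => i _.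
by rewrite tnth_mktuple mulrCA.
Qed.

Lemma measurable_powsum_le r n (c : R) :
  measurable_fun setT (fun t : n.-tuple R => (powsum r t <= c)%R%:R : R).
Proof.
apply: measurable_natr_bool; apply: measurable_fun_ler => //.
exact: measurable_powsum.
Qed.

(** Write exp(-powsum r t) as the integral over x of exp(-x) times the indicator
    of powsum r t <= x, exchange the integrals, and rescale each sublevel set to
    the unit ball. *)
Lemma ball_gamma (r e : R) n (F : n.-tuple R -> R) : 0 < r -> 0 <= e ->
  measurable_fun setT F -> (forall t, 0 <= F t) ->
  (forall c t, 0 < c -> F (scalet c t) = c `^ e * F t) ->
  (\int[lebesgue_tuple R n]_t (F t * expR (- powsum r t))%:E =
   (gint ((n%:R + e) / r))%:E *
     \int[lebesgue_tuple R n]_t (F t * (powsum r t <= 1)%R%:R)%:E)%E.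
Proof.
move=> r0 e0 mF F0 FZ.
have s0 : 0 <= (n%:R + e) / r by rewrite divr_ge0 ?addr_ge0 ?(ltW r0).
have mN := @measurable_powsum r n.
pose H (p : R * n.-tuple R) := F p.2 * expt (powsum r p.2) p.1.
have mH : measurable_fun setT (EFin \o H).
  apply/measurable_EFinP; apply: measurable_funM; first exact: measurableT_comp.
  apply: measurable_funM; last first.
    by apply: measurableT_comp => //; exact: measurable_funN.
  apply: measurable_natr_bool; apply: measurable_and; first exact: measurable_fun_ltr.
  by apply: measurable_fun_ler => //; exact: measurableT_comp.
have H0 p : (0 <= (EFin \o H) p)%E by rewrite lee_fin mulr_ge0 ?expt_ge0.
have mI1 : measurable_fun setT (fun t : n.-tuple R => (F t * (powsum r t <= 1)%R%:R)%:E).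
  by apply/measurable_EFinP; apply: measurable_funM => //; exact: measurable_powsum_le.
transitivity (\int[lebesgue_tuple R n]_t \int[mu]_x (H (x, t))%:E)%E.
  apply: eq_integral => t _.
  rewrite EFinM -(integral_expt (powsum_ge0 r t)) -ge0_integralZl//.
  - by apply/measurable_EFinP; exact: measurable_expt.
  - by move=> x _; rewrite lee_fin expt_ge0.
  - by rewrite lee_fin.
rewrite -(fubini_tonelli (EFin \o H))//=.
rewrite -(gintE s0) -ge0_integralZr//; last 3 first.
- by apply/measurable_EFinP; exact: measurable_gfun.
- by move=> t _; rewrite lee_fin gfun_ge0.
- by apply: integral_ge0 => t _; rewrite lee_fin mulr_ge0.
apply: eq_integral => x _.
have [x0|x0] := ltP 0 x; last first.
  rewrite /gfun ltNge x0 /= mul0r mul0e; apply: integral0_eq => t _ /=.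
  by rewrite /H /expt ltNge x0 /= mul0r mulr0.
rewrite /H /expt /gfun /= x0.
(* The dilation that carries the unit sublevel set of powsum r onto powsum r <= x. *)
pose c := x `^ r^-1.
have c0 : 0 < c by exact: powR_gt0.
have cr : c `^ r = x by rewrite /c -powRrM mulVf ?gt_eqF// powRr1// ltW.
have -> : x `^ ((n%:R + e) / r) = c ^+ n * c `^ e.
  by rewrite mulrC powRrM -/c powRD ?powR_mulrn ?(ltW c0)// (gt_eqF c0) implybT.
have mIx : measurable_fun setT (fun t : n.-tuple R => (F t * (powsum r t <= x)%R%:R)%:E).
  by apply/measurable_EFinP; apply: measurable_funM => //; exact: measurable_powsum_le.
have I1x0 (t : n.-tuple R) (y : R) : (0 <= (F t * (powsum r t <= y)%R%:R)%:E)%E.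
  by rewrite lee_fin mulr_ge0.
transitivity ((expR (- x))%:E * \int[lebesgue_tuple R n]_t (F t * (powsum r t <= x)%R%:R)%:E)%E.
  rewrite -ge0_integralZl ?lee_fin ?expR_ge0//.
  apply: eq_integral => t _; rewrite -EFinM /=; congr EFin; ring.
rewrite (ge0_integral_scalet c0)// mul1r muleA -EFinM mulrC.
have -> : (fun t : n.-tuple R => (F (scalet c t) * (powsum r (scalet c t) <= x)%R%:R)%:E) =
    (fun t => (c `^ e)%:E * (F t * (powsum r t <= 1)%R%:R)%:E)%E.
  apply/funext => t; rewrite FZ// (powsum_scalet _ _ (ltW c0)) cr -EFinM mulrA.
  by rewrite -[X in _ <= X]mulr1 ler_pM2l.
rewrite ge0_integralZl ?lee_fin ?powR_ge0//.
by rewrite muleA -EFinM mulrAC.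
Qed.

End ball_gamma.

Section scaling_identity.
Context {R : realType}.

(** The identity is the derivative at lam = 1 of the hypothesis. To avoid
    differentiating under the integral, note that exp is above its tangent, so
    the function u below is nonnegative and vanishes at 1, which is a minimum:
    its derivative vanishes there. *)
Lemma scaling_identity d (T : measurableType d) (m : {measure set T -> \bar R})
    (F N : T -> R) (s I : R) :
  measurable_fun setT F -> measurable_fun setT N ->
  (forall x, 0 <= F x) -> (forall x, 0 <= N x) ->
  (forall lam : R, 0 < lam ->
    (\int[m]_x (F x * expR (- (lam * N x)))%:E = (lam `^ (- s) * I)%:E)%E) ->
  (\int[m]_x (F x * N x * expR (- N x))%:E = (s * I)%:E)%E.
Proof.
move=> mF mN F0 N0 H.
have mexp (l : R) : measurable_fun setT (fun x => expR (- (l * N x))).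
  by apply: measurableT_comp => //; apply: measurable_funN; exact: measurable_funM.
have mexp1 : measurable_fun setT (fun x => expR (- N x)).
  by apply: measurableT_comp => //; exact: measurable_funN.
have H1 : (\int[m]_x (F x * expR (- N x))%:E = I%:E)%E.
  by have := H 1 ltr01; rewrite powR1 mul1r; under eq_integral do rewrite mul1r.
have mFN : measurable_fun setT (fun x => F x * N x * expR (- N x)).
  by apply: measurable_funM => //; exact: measurable_funM.
(* N exp (- N) <= 2 exp (- N / 2), and the hypothesis is finite at lam = 1/2. *)
have fin : (\int[m]_x (F x * N x * expR (- N x))%:E < +oo)%E.
  apply: (@le_lt_trans _ _ (\int[m]_x (2 * (F x * expR (- (2^-1 * N x))))%:E)%E).
    apply: ge0_le_integral => //.
    - by move=> x _; rewrite lee_fin !mulr_ge0 ?expR_ge0.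
    - exact/measurable_EFinP.
    - by apply/measurable_EFinP; apply: measurable_funM => //; exact: measurable_funM.
    - move=> x _; rewrite lee_fin mulrCA -mulrA ler_wpM2l//.
      have E : expR (- N x) = expR (- (2^-1 * N x)) * expR (- (2^-1 * N x)).
        by rewrite -expRD; congr expR; field.
      rewrite E mulrA ler_wpM2r ?expR_ge0// expRN ler_pdivrMr ?expR_gt0//.
      by have := expR_ge1Dx (2^-1 * N x); lra.
  under eq_integral do rewrite EFinM.
  rewrite ge0_integralZl//; last 2 first.
  - by apply/measurable_EFinP; exact: measurable_funM.
  - by move=> x _; rewrite lee_fin mulr_ge0 ?expR_ge0.
  by rewrite H// -EFinM ltry.
pose I' := fine (\int[m]_x (F x * N x * expR (- N x))%:E)%E.
have I'E : (\int[m]_x (F x * N x * expR (- N x))%:E = I'%:E)%E.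
  rewrite fineK// ge0_fin_numE//.
  by apply: integral_ge0 => x _; rewrite lee_fin !mulr_ge0 ?expR_ge0.
rewrite I'E; congr EFin.
pose u (lam : R) := lam `^ (- s) * I - I - (I' - lam * I').
have u0 lam : 0 < lam -> 0 <= u lam.
  move=> l0; rewrite -[u lam]mul1r.
  apply: (@integral_comb4_ge0 _ _ _ m (fun x => F x * expR (- (lam * N x)))
    (fun x => F x * expR (- N x)) (fun x => F x * N x * expR (- N x))
    (fun x => lam * (F x * N x * expR (- N x)))).
  - by split => //; [exact: measurable_funM|exact: measurable_funM|exact: measurable_funM].
  - by move=> x; split; rewrite !mulr_ge0 ?expR_ge0 ?(ltW l0).
  - split => //; first exact: H.
    under eq_integral do rewrite EFinM.
    rewrite ge0_integralZl//; last 3 first.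
    + exact/measurable_EFinP.
    + by move=> x _; rewrite lee_fin !mulr_ge0 ?expR_ge0.
    + by rewrite lee_fin ltW.
    by rewrite I'E EFinM.
  - move=> x.
    have -> : 1 * (F x * expR (- (lam * N x)) - F x * expR (- N x) -
      (F x * N x * expR (- N x) - lam * (F x * N x * expR (- N x)))) =
      F x * (expR (- (lam * N x)) - expR (- N x) * (1 + (N x - lam * N x))) by ring.
    rewrite mulr_ge0// subr_ge0.
    have -> : expR (- (lam * N x)) = expR (- N x) * expR (N x - lam * N x).
      by rewrite -expRD; congr expR; ring.
    by rewrite ler_wpM2l ?expR_ge0// expR_ge1Dx.
have u1 : u 1 = 0 by rewrite /u powR1; ring.
have du (lam : R) : 0 < lam ->
    is_derive lam (1 : R) u (- s * lam `^ (- s - 1) * I + I').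
  move=> l0.
  have d1 : is_derive lam 1 _ _ := is_derive1_powR (- s) l0.
  have d2 : is_derive lam (1 : R) (fun l : R => l) 1 := is_derive_id lam (1 : R).
  have := is_deriveB (is_deriveB (is_deriveZ I d1) (is_derive_cst I lam (1 : R)))
    (is_deriveB (is_derive_cst I' lam (1 : R)) (is_deriveZ I' d2)).
  rewrite subr0 sub0r opprK.
  have -> : I *: (- s * lam `^ (- s - 1)) + I' *: (1 : R) = - s * lam `^ (- s - 1) * I + I'.
    by rewrite /GRing.scale /= mulr1 mulrC.
  congr is_derive; apply/funext => l.
  by transitivity (I * l `^ (- s) - I - (I' - I' * l)) => //; rewrite /u; ring.
have min1 : forall t, t \in `](2^-1 : R), 2[ -> u 1 <= u t.
  by move=> t; rewrite in_itv/= => /andP[t0 _]; rewrite u1 u0//; lra.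
have d0 : is_derive (1 : R) 1 u 0.
  apply: (@derive1_at_min R u 2^-1 2 1) => //; first lra.
  - move=> t; rewrite in_itv/= => /andP[t0 _]; have tp : 0 < t by lra.
    by case: (du t tp).
  - by rewrite in_itv/=; lra.
have [_ e1] := d0.
have [_ e2] := du 1 ltr01.
by move: e2; rewrite e1 powR1; lra.
Qed.

End scaling_identity.

(** * Moments of intervals and of the Gaussian *)

Section power_moments.
Context {R : realType}.
Local Notation mu := (@lebesgue_line R).
Local Notation g := (@gauss_fun R).

Definition absmom (w : R -> R) (p : R) := \int[mu]_y (`|y| `^ p * w y).

(** The exponent 0 is included so that volumes and masses are moments; exponents
    strictly between 0 and 1 would require other regularity estimates. *)
Definition admissible (p : R) := p = 0 \/ 1 <= p.

Lemma admissible_ge0 p : admissible p -> 0 <= p.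
Proof. by case=> [->//|p1]; exact: le_trans p1. Qed.

Lemma polylip_abs p : admissible p -> polylip (fun x : R => `|x| `^ p).
Proof.
case=> [->|]; last exact: polylip_abs_powR.
by exists 0, 0; split => // x y; rewrite !powRr0 subrr normr0 !mul0r.
Qed.

Lemma blur_abs w c p : weight w -> admissible p ->
  blur w c (fun x => `|x| `^ p) 0 = `|c| `^ p * absmom w p.
Proof.
move=> ww ap; have lh := polylip_abs ap.
rewrite /blur /absmom -RintegralZl//.
  by apply: eq_Rintegral => y _; rewrite add0r normrM powRM// mulrA.
by apply: integrable_weight => //; [exact: polylip_measurable|exact: polylip_growth].
Qed.

Lemma absmom_ge0 w p : weight w -> 0 <= absmom w p.
Proof.
by move=> ww; apply: Rintegral_ge0 => y _; rewrite mulr_ge0 ?powR_ge0 ?(weight_ge0 ww).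
Qed.

Lemma absmom0 w : absmom w 0 = mass w.
Proof. by apply: eq_Rintegral => y _; rewrite powRr0 mul1r. Qed.

Lemma absmom2 w : weight w -> absmom w 2 = variance w * mass w.
Proof.
move=> ww; rewrite divfK; last by rewrite gt_eqF// (weight_mass_gt0 ww).
by apply: eq_Rintegral => y _; rewrite powR2// sqr_norm.
Qed.

Lemma integral_powR01 p : admissible p ->
  (\int[lebesgue_measure]_(x in `[0%R, 1%R]) (`|x| `^ p)%:E = (p + 1)^-1%:E)%E.
Proof.
move=> ap; have p0 := admissible_ge0 ap.
have p10 : p + 1 != 0 by rewrite gt_eqF// ltr_wpDl.
have p1 : 1 <= p + 1 by rewrite lerDr.
have cF : continuous (fun x : R => (p + 1)^-1 * `|x| `^ (p + 1)).
  by move=> x; apply: cvgMr; exact: (polylip_continuous (polylip_abs_powR p1)).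
have dF (x : R) : 0 < x -> is_derive x (1 : R) (fun x : R => (p + 1)^-1 * `|x| `^ (p + 1)) (`|x| `^ p).
  move=> x0; have d := is_derive_abs_powR (p + 1) (lt0r_neq0 x0).
  have := is_deriveZ (p + 1)^-1 d.
  rewrite gtr0_sg// mul1r addrK (_ : _ *: _ = `|x| `^ p)//.
  by rewrite /GRing.scale /= mulrA mulVf// mul1r.
rewrite (@continuous_FTC2 R _ (fun x => (p + 1)^-1 * `|x| `^ (p + 1)) 0 1)//.
- rewrite normr1 powR1 normr0 powR0// mulr0 mulr1 -EFinB subr0//.
- apply: continuous_subspaceT; exact: (polylip_continuous (polylip_abs ap)).
- split.
  + by move=> x; rewrite in_itv/= => /andP[x0 _]; case: (dF x x0).
  + by apply: cvg_at_right_filter; exact: cF.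
  + by apply: cvg_at_left_filter; exact: cF.
- move=> x; rewrite in_itv/= => /andP[x0 _]; rewrite derive1E.
  by case: (dF x x0).
Qed.

Let f p (l x : R) : R := `|x| `^ p * (`|x| <= l)%R%:R.

Let f0 p l x : 0 <= f p l x. Proof. by rewrite mulr_ge0 ?powR_ge0. Qed.

Let mf p l : measurable_fun setT (f p l).
Proof.
apply: measurable_funM.
  by apply: (@measurableT_comp _ _ _ _ _ _ (@powR R ^~ p)).
by apply: measurable_natr_bool; apply: measurable_fun_ler.
Qed.

Let integral_half p : admissible p ->
  (\int[mu]_x (f p 1 x * (0 < x)%R%:R)%:E = (p + 1)^-1%:E)%E.
Proof.
move=> ap; rewrite -integral_powR01//.
have mp (D : set (measurableTypeR R)) : measurable_fun D (fun x : R => (`|x| `^ p)%:E).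
  by apply: measurable_funTS; apply/measurable_EFinP; exact: (polylip_measurable (polylip_abs ap)).
rewrite lebesgue_lineE//; last 2 first.
- apply/measurable_EFinP; apply: measurable_funM; first exact: mf.
  by apply: measurable_natr_bool; exact: measurable_fun_ltr.
- by move=> x; rewrite lee_fin mulr_ge0.
rewrite -integral_itv_obnd_cbnd; last exact: mp.
rewrite [RHS]integral_mkcond; apply: eq_integral => x _.
rewrite patchE mem_setE in_itv/= /f.
have [x0|x0] := ltP 0 x; last by rewrite mulr0.
rewrite mulr1 (ger0_norm (ltW x0)).
by case: (x <= 1); rewrite ?mulr1 ?mulr0.
Qed.

Lemma integral_abs_powR1 p : admissible p ->
  (\int[mu]_x (`|x| `^ p * (`|x| <= 1)%R%:R)%:E = (2 / (p + 1))%:E)%E.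
Proof.
move=> ap.
have mh (b : R -> bool) : measurable_fun setT b ->
    measurable_fun setT (fun x => (f p 1 x * (b x)%:R)%:E).
  move=> mb; apply/measurable_EFinP; apply: measurable_funM; first exact: mf.
  exact: measurable_natr_bool.
have mh1 : measurable_fun setT (fun x => (f p 1 x * (0 < x)%R%:R)%:E).
  by apply: mh; exact: measurable_fun_ltr.
have mh2 : measurable_fun setT (fun x => (f p 1 x * (x < 0)%R%:R)%:E).
  by apply: mh; exact: measurable_fun_ltr.
rewrite (ae_eq_integral (fun x => (f p 1 x * (0 < x)%R%:R)%:E + (f p 1 x * (x < 0)%R%:R)%:E)%E)//.
- rewrite ge0_integralD//; last 2 first.
  + by move=> x _; rewrite lee_fin mulr_ge0.
  + by move=> x _; rewrite lee_fin mulr_ge0.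
  rewrite integral_half//.
  have N10 : (-1 : R) != 0 by rewrite oppr_eq0 oner_eq0.
  rewrite (ge0_integral_affine 0 N10)//; last by move=> x; rewrite lee_fin mulr_ge0.
  rewrite normrN1 mul1e (eq_integral (fun x => (f p 1 x * (0 < x)%R%:R)%:E)); last first.
    by move=> x _; rewrite addr0 mulN1r oppr_lt0 /f normrN.
  by rewrite integral_half// -EFinD; congr EFin; rewrite mulr_natl mulr2n.
- by apply/measurable_EFinP; exact: mf.
- exact: emeasurable_funD.
- exists [set 0]; split => //; first exact: lebesgue_line_set1.
  move=> x /= /not_implyP[_] H; apply: contrapT => /eqP x0; apply: H.
  rewrite -EFinD -mulrDr /f; congr EFin.
  by have [xl|xg|/esym/eqP] := ltgtP x 0; rewrite ?addr0 ?add0r ?mulr1// eq_sym (negbTE x0).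
Qed.

Lemma integral_abs_powR p l : admissible p -> 0 <= l ->
  (\int[mu]_x (`|x| `^ p * (`|x| <= l)%R%:R)%:E = (2 / (p + 1) * l `^ (p + 1))%:E)%E.
Proof.
move=> ap; have p0 := admissible_ge0 ap.
have p10 : p + 1 != 0 by rewrite gt_eqF// ltr_wpDl.
rewrite le_eqVlt => /predU1P[<-|l0].
  rewrite powR0// mulr0; transitivity (\int[mu]_x (cst 0%E x))%E; last by rewrite integral0.
  apply: ae_eq_integral => //.
    by apply/measurable_EFinP; exact: mf.
  exists [set 0]; split => //; first exact: lebesgue_line_set1.
  move=> x /= /not_implyP[_] H; apply: contrapT => /eqP x0; apply: H.
  by rewrite normr_le0 (negbTE x0) mulr0.
rewrite (ge0_integral_affine 0 (lt0r_neq0 l0)); last 2 first.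
- by apply/measurable_EFinP; exact: mf.
- by move=> x; rewrite lee_fin f0.
rewrite (gtr0_norm l0).
have -> : l `^ (p + 1) = l `^ p * l.
  by rewrite powRD ?powRr1 ?(ltW l0)// (gt_eqF l0) implybT.
rewrite (eq_integral (fun x : R => (l `^ p)%:E * (f p 1 x)%:E)%E); last first.
  move=> x _; rewrite addr0 -EFinM normrM (gtr0_norm l0) (powRM _ (ltW l0))// /f mulrA.
  by rewrite -[X in (_ <= X)%R]mulr1 ler_pM2l.
rewrite ge0_integralZl//; last 3 first.
- by apply/measurable_EFinP; exact: mf.
- by move=> x _; rewrite lee_fin f0.
- by rewrite lee_fin powR_ge0.
by rewrite integral_abs_powR1// -!EFinM; congr EFin; ring.
Qed.

End power_moments.

Section gauss_moments.
Context {R : realType}.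
Local Notation mu := (@lebesgue_line R).
Local Notation g := (@gauss_fun R).

Lemma absmomE w p : weight w -> admissible p ->
  (\int[mu]_y (`|y| `^ p * w y)%:E = (absmom w p)%:E)%E.
Proof.
move=> ww ap; rewrite /absmom /Rintegral fineK//.
apply: integrable_fin_num => //; have lh := polylip_abs ap.
by apply: integrable_weight => //; [exact: polylip_measurable|exact: polylip_growth].
Qed.

(** ball_gamma in dimension one with r = 2. *)
Lemma gauss_absmom_gint p : admissible p ->
  absmom g p = gint ((1 + p) / 2) * (2 / (p + 1)).
Proof.
move=> ap; have p0 := admissible_ge0 ap; apply: EFin_inj.
have mp : measurable_fun setT (fun x : R => `|x| `^ p) := polylip_measurable (polylip_abs ap).
rewrite -absmomE//; last exact: gauss_weight.
have m1 : measurable_fun setT (fun t : 1.-tuple R => `|tnth t ord0| `^ p).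
  by apply: (measurableT_comp mp); exact: measurable_tnth.
have F0 (t : 1.-tuple R) : 0 <= `|tnth t ord0| `^ p by exact: powR_ge0.
have FZ (c : R) (t : 1.-tuple R) : 0 < c ->
    `|tnth (scalet c t) ord0| `^ p = c `^ p * `|tnth t ord0| `^ p.
  by move=> c0; rewrite tnth_mktuple normrM powRM// gtr0_norm.
have := ball_gamma (ltr0n R 2) p0 m1 F0 FZ.
have psE (x : R) (t : 0.-tuple R) : powsum 2 [tuple of x :: t] = x ^+ 2.
  by rewrite /powsum big_ord_recl big_ord0 addr0 tnth0 powR2// sqr_norm.
have me1 : measurable_fun setT (fun t : 1.-tuple R => (`|tnth t ord0| `^ p * (powsum 2 t <= 1)%R%:R)%:E).
  by apply/measurable_EFinP; apply: measurable_funM => //; exact: measurable_powsum_le.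
have psm : measurable_fun setT (fun t : 1.-tuple R => expR (- powsum 2 t)).
  by apply: measurableT_comp => //; apply: measurable_funN; exact: measurable_powsum.
have me2 : measurable_fun setT (fun t : 1.-tuple R => (`|tnth t ord0| `^ p * expR (- powsum 2 t))%:E).
  by apply/measurable_EFinP; exact: measurable_funM.
rewrite ge0_integral_lebesgue_tupleS//.
rewrite ge0_integral_lebesgue_tupleS//.
rewrite EFinM -(integral_abs_powR1 ap) => H.
transitivity (\int[mu]_x \int[lebesgue_tuple R 0]_t
  (`|tnth [tuple of x :: t] ord0| `^ p * expR (- powsum 2 [tuple of x :: t]))%:E)%E.
  apply: eq_integral => x _; rewrite ge0_integral_lebesgue_tuple0 ?psE//.
  exact: (@measurable_tuple_cons _ 0 (fun t => (`|tnth t ord0| `^ p * expR (- powsum 2 t))%:E)).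
rewrite H; congr (_ * _)%E; apply: eq_integral => x _.
rewrite ge0_integral_lebesgue_tuple0; last first.
  exact: (@measurable_tuple_cons _ 0 (fun t => (`|tnth t ord0| `^ p * (powsum 2 t <= 1)%R%:R)%:E)).
rewrite psE tnth0 -(sqr_norm x).
by have -> : (`|x| ^+ 2 <= 1) = (`|x| <= 1) by rewrite expr_le1.
Qed.

(** The functional equation of Gamma, an instance of scaling_identity with N(t)
    = t. *)
Lemma gint_recurrence (s : R) : 0 <= s -> gint (s + 1) = (s + 1) * gint s.
Proof.
move=> s0.
have s10 : 0 <= s + 1 by rewrite addr_ge0.
apply: EFin_inj; rewrite -gintE//.
pose F (t : R) : R := (0 < t)%R%:R * t `^ s.
pose N (t : R) : R := (0 < t)%R%:R * t.
have mpos : measurable_fun setT (fun t : R => (0 < t)%R%:R : R).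
  by apply: measurable_natr_bool; exact: measurable_fun_ltr.
have mF : measurable_fun setT F by apply: measurable_funM => //; exact: measurable_powR.
have mN : measurable_fun setT N by exact: measurable_funM.
have F0 t : 0 <= F t by rewrite mulr_ge0 ?powR_ge0.
have N0 t : 0 <= N t by rewrite /N; case: ltP => t0; rewrite ?mul0r// mul1r ltW.
have E := @scaling_identity R _ _ mu F N (s + 1) (gint s) mF mN F0 N0.
transitivity (\int[mu]_x (F x * N x * expR (- N x))%:E)%E.
  apply: eq_integral => t _; congr EFin; rewrite /gfun /F /N.
  have [t0|t0] := ltP 0 t; last by rewrite !mul0r.
  by rewrite !mul1r powRD ?powRr1 ?(ltW t0) ?(gt_eqF t0) ?implybT.
apply: E => lam l0.
have gE := gintE s0.
rewrite (@ge0_integral_affine _ lam^-1 0); last 3 first.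
- by rewrite invr_eq0 gt_eqF.
- apply/measurable_EFinP; apply: measurable_funM => //; apply: measurableT_comp => //.
  by apply: measurable_funN; exact: measurable_funM.
- by move=> t; rewrite lee_fin mulr_ge0 ?expR_ge0.
have -> : (fun t => (F (lam^-1 * t + 0)%R * expR (- (lam * N (lam^-1 * t + 0)%R)))%:E) =
    (fun t => (lam `^ (- s))%:E * (gfun s t)%:E)%E.
  apply/funext => t; rewrite addr0 -EFinM; congr EFin; rewrite /F /N /gfun.
  rewrite pmulr_rgt0 ?invr_gt0//.
  have [t0|t0] := ltP 0 t; last by rewrite !mul0r mulr0.
  rewrite !mul1r mulrA divff ?gt_eqF// mul1r powRM ?invr_ge0 ?(ltW l0) ?(ltW t0)//.
  by rewrite -powR_inv1 ?(ltW l0)// -powRrM mulN1r mulrA.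
rewrite ge0_integralZl ?lee_fin ?powR_ge0//; last 2 first.
- by apply/measurable_EFinP; exact: measurable_gfun.
- by move=> t _; rewrite lee_fin gfun_ge0.
rewrite gE -!EFinM; congr EFin; rewrite mulrA; congr (_ * _).
rewrite ger0_norm ?invr_ge0 ?(ltW l0)// -powR_inv1 ?(ltW l0)// -powRD.
  by congr (_ `^ _); ring.
by rewrite (gt_eqF l0) implybT.
Qed.

Lemma GammaE (s : R) : 1 <= s -> Gamma s = gint (s - 1).
Proof.
move=> s1; rewrite /Gamma /gint /Rintegral; congr fine.
rewrite [RHS]lebesgue_lineE//; last 2 first.
- by apply/measurable_EFinP; exact: measurable_gfun.
- by move=> t; rewrite lee_fin gfun_ge0.
rewrite [LHS]integral_mkcond; apply: eq_integral => t _.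
rewrite patchE mem_setE in_itv/= andbT /gfun.
by case: (0 < t); rewrite ?mul1r ?mul0r.
Qed.

Lemma gauss_absmom p : 1 <= p -> absmom g p = Gamma ((p + 1) / 2).
Proof.
move=> p1; rewrite gauss_absmom_gint; last by right.
rewrite GammaE; last by lra.
have -> : (1 + p) / 2 = (p + 1) / 2 - 1 + 1 by ring.
rewrite gint_recurrence; last by lra.
by field; rewrite gt_eqF//; lra.
Qed.

Lemma gauss_variance : variance g = 2^-1.
Proof.
have h0 : 0 <= (2^-1 : R) by rewrite invr_ge0.
have E0 := @gauss_absmom_gint 0 (or_introl erefl).
have E2 := @gauss_absmom_gint 2 ltac:(by right; rewrite ler1n).
have e1 : (1 + 2) / 2 = 2^-1 + 1 :> R by field.
rewrite e1 gint_recurrence// in E2.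
rewrite addr0 add0r div1r divr1 absmom0 in E0.
have m0 : mass g != 0 by rewrite gt_eqF// (weight_mass_gt0 gauss_weight).
apply: (mulIf m0); rewrite -absmom2; last exact: gauss_weight.
by rewrite E2 E0; field.
Qed.

End gauss_moments.

(** * Geometry of the unit balls *)

Section unit_ball.
Context {R : realType}.
Local Notation mu := (@lebesgue_line R).
Local Notation ball q n := (@lq_ball R q n).

Lemma prod_expw (r : R) n (t : n.-tuple R) :
  \prod_(i < n) expw r (tnth t i) = expR (- powsum r t).
Proof.
rewrite /powsum -sumrN; elim/big_ind2: _ => //; first by rewrite expR0.
by move=> ? ? ? ? -> ->; rewrite expRD.
Qed.

Lemma lq_ball_indicator_fin (r : R) n (t : n.-tuple R) :
  \1_(ball r%:E n) t = (powsum r t <= 1)%R%:R :> R.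
Proof. by rewrite indicE; congr (nat_of_bool _)%:R; apply/idP/idP => [/set_mem|/mem_set]. Qed.

Lemma lq_ball_indicator_pinfty n (t : n.-tuple R) :
  \1_(ball +oo%E n) t = \prod_(i < n) boxw (tnth t i) :> R.
Proof.
have -> : \prod_(i < n) boxw (tnth t i) = [forall i, `|tnth t i| <= 1]%:R :> R.
  case: forallP => [H|/forallP].
    by rewrite big1// => i _; rewrite /boxw H.
  rewrite negb_forall => /existsP[i ti].
  by rewrite (bigD1 i)//= /boxw (negbTE ti) mul0r.
rewrite indicE; congr (nat_of_bool _)%:R.
by apply/idP/idP => [/set_mem/= H|/forallP H]; [exact/forallP|exact/mem_set].
Qed.

Lemma measurable_indic_lq_ball q n : (2%:E <= q)%E ->
  measurable_fun setT (\1_(ball q n) : n.-tuple R -> R).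
Proof.
case: q => [r _||]//; last move=> _.
- rewrite (_ : \1_(_) = fun t => (powsum r t <= 1)%R%:R); first exact: measurable_powsum_le.
  by apply/funext => t; exact: lq_ball_indicator_fin.
- rewrite (_ : \1_(_) = fun t => \prod_(i < n) boxw (tnth t i)).
    by apply: measurable_prod_tuple; exact: measurable_boxw.
  by apply/funext => t; exact: lq_ball_indicator_pinfty.
Qed.

Lemma measurable_lq_ball q n : (2%:E <= q)%E -> measurable (ball q n).
Proof.
move=> hq; have := @measurable_indic_lq_ball q n hq measurableT [set 1] (measurable_set1 _).
rewrite setTI; congr (measurable _); apply/seteqP; split => t /=; rewrite indicE.
- case: (boolP (t \in ball q n)) => [/set_mem//|_ /esym/eqP].
  by rewrite oner_eq0.
- by move=> /mem_set ->.
Qed.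

Lemma measurable_abs_lin_powR p n (a : 'I_n -> R) :
  measurable_fun setT (fun t => `|lin a t| `^ p).
Proof.
apply: (@measurableT_comp _ _ _ _ _ _ (@powR R ^~ p)) => //.
by apply: measurableT_comp => //; exact: measurable_lin.
Qed.

Lemma integrand_indic (F : R) d (T : measurableType d) (A : set T) t :
  0 <= F -> (0 <= (F * \1_A t)%:E)%E.
Proof. by move=> F0; rewrite lee_fin mulr_ge0// indicE. Qed.

Lemma powR_recip_pow (t r p k : R) : 0 < t -> (t `^ r^-1) `^ p * t `^ (k / r) = t `^ ((k + p) / r).
Proof.
move=> t0; rewrite -powRrM -powRD; last by rewrite (gt_eqF t0) implybT.
by congr (_ `^ _); rewrite mulrDl [r^-1 * p]mulrC addrC.
Qed.

(** The substitution function t^(1/r) has moments gint((k + p) / r) with respect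
    to gfun (k / r). *)
Lemma gint_jensen (s p r k : R) : 1 <= p -> moment_sign s p -> 0 < r -> 0 <= k ->
  0 <= s * (gint ((k + p) / r) / gint ((k + 0) / r) -
            (gint ((k + 2) / r) / gint ((k + 0) / r)) `^ (p / 2)).
Proof.
move=> p1 sp r0 k0; rewrite addr0.
have s0 (e : R) : 0 <= e -> 0 <= (k + e) / r by move=> e0; rewrite divr_ge0 ?addr_ge0 ?(ltW r0).
have k00 : 0 <= k / r by rewrite divr_ge0 ?(ltW r0).
have E (e t : R) : (t `^ r^-1) `^ e * gfun (k / r) t = gfun ((k + e) / r) t.
  rewrite /gfun; have [t0|t0] := ltP 0 t; last by rewrite !mul0r mulr0.
  by rewrite !mul1r mulrA powR_recip_pow.
apply: (@jensen_moment R _ _ mu (gfun (k / r)) (fun t => t `^ r^-1)) => //.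
- exact: measurable_gfun.
- exact: gfun_ge0.
- by move=> t; exact: powR_ge0.
- exact: gint_gt0.
- exact/gint_gt0/s0.
- exact: gintE.
- rewrite -gintE; last exact: s0.
  by apply: eq_integral => t _; rewrite -E powR2// powR_ge0.
- rewrite -gintE; last by apply: s0; exact: le_trans p1.
  by apply: eq_integral => t _; rewrite -E.
Qed.

(** Puts the cases q finite and q = +oo on the same footing; the comparison of
    chains applies to w, and the factors C n p satisfy Jensen's inequality. *)
Lemma ball_weight (q : \bar R) : (2%:E <= q)%E ->
  exists (w : R -> R) (C : nat -> R -> R), [/\ weight w,
    forall n p, admissible p -> 0 < C n p,
    forall n s p, 1 <= p -> moment_sign s p ->
      0 <= s * (C n p / C n 0 - (C n 2 / C n 0) `^ (p / 2)) &
    forall n p (a : 'I_n -> R), admissible p ->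
      ((C n p)%:E * \int[lebesgue_tuple R n]_t (`|lin a t| `^ p * \1_(ball q n) t)%:E =
       (chain w (coefs a) (fun x => `|x| `^ p) 0%R)%:E)%E ].
Proof.
case: q => [r|_|]//; last first.
  exists boxw, (fun _ _ => 1); split => //.
  - exact: boxw_weight.
  - by move=> n s p p1 sp; rewrite divr1 powR1 subrr mulr0.
  - move=> n p a ap; rewrite mul1e -chain_tuple//; last 2 first.
    + exact: boxw_weight.
    + exact: polylip_abs.
    by apply: eq_integral => t _; rewrite lq_ball_indicator_pinfty add0r.
rewrite lee_fin => r2; have r0 : 0 < r by exact: lt_le_trans r2.
exists (expw r), (fun n p => gint ((n%:R + p) / r)); split => //.
- exact: expw_weight.
- by move=> n p /admissible_ge0 p0; apply: gint_gt0; rewrite divr_ge0 ?addr_ge0 ?(ltW r0).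
- by move=> n s p p1 sp; exact: gint_jensen.
- move=> n p a ap; have ww := expw_weight r2.
  rewrite -(chain_tuple a 0 ww (polylip_abs ap) (fun y => powR_ge0 `|y| p)).
  transitivity (\int[lebesgue_tuple R n]_t (`|lin a t| `^ p * expR (- powsum r t))%:E)%E.
    rewrite (ball_gamma r0 (admissible_ge0 ap)).
    + congr (_ * _)%E; apply: eq_integral => t _; by rewrite lq_ball_indicator_fin.
    + exact: measurable_abs_lin_powR.
    + by move=> t; exact: powR_ge0.
    + by move=> c t c0; rewrite lin_scalet normrM powRM// gtr0_norm.
  by apply: eq_integral => t _; rewrite add0r prod_expw.
Qed.

Lemma ball_slice (q : \bar R) n : (2%:E <= q)%E ->
  exists ell : n.-tuple R -> R, [/\ measurable_fun setT ell, forall t, 0 <= ell t &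
    forall (x : R) (t : n.-tuple R),
      \1_(ball q n.+1) [tuple of x :: t] = \1_(ball q n) t * (`|x| <= ell t)%R%:R :> R].
Proof.
case: q => [r|_|]//; last first.
  exists (cst 1); split => // x t.
  by rewrite !lq_ball_indicator_pinfty prod_cons mulrC.
rewrite lee_fin => r2; have r0 : 0 < r by exact: lt_le_trans r2.
exists (fun t => (1 - powsum r t) `^ r^-1); split.
- apply: (@measurableT_comp _ _ _ _ _ _ (@powR R ^~ r^-1)) => //.
  by apply: measurable_funB => //; exact: measurable_powsum.
- by move=> t; exact: powR_ge0.
- move=> x t; rewrite !lq_ball_indicator_fin.
  have -> : powsum r [tuple of x :: t] = `|x| `^ r + powsum r t.
    rewrite /powsum big_ord_recl tnth0; congr (_ + _).
    by apply: eq_bigr => i _; rewrite tnthS.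
  have [t1|t1] := leP (powsum r t) 1; last first.
    by rewrite mul0r leNgt (lt_le_trans t1)// lerDr powR_ge0.
  rewrite mul1r -lerBrDr; congr (nat_of_bool _)%:R.
  have u0 : 0 <= 1 - powsum r t by rewrite subr_ge0.
  have E (z : R) : 0 <= z -> (z `^ r^-1) `^ r = z.
    by move=> z0; rewrite -powRrM mulVf ?gt_eqF// powRr1.
  apply/idP/idP => H.
    have := ge0_ler_powR (_ : 0 <= r^-1) _ _ H; rewrite -powRrM divff ?gt_eqF// powRr1//.
    by apply; rewrite ?invr_ge0 ?(ltW r0) ?nnegrE ?powR_ge0.
  have := ge0_ler_powR (ltW r0) _ _ H; rewrite E//.
  by apply; rewrite nnegrE ?powR_ge0.
Qed.

(** Integrates over the first coordinate, which ranges over [-ell t, ell t]. *)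
Lemma slice_moment (q : \bar R) n p (ell : n.-tuple R -> R) : (2%:E <= q)%E -> admissible p ->
  measurable_fun setT ell -> (forall t, 0 <= ell t) ->
  (forall (x : R) (t : n.-tuple R), \1_(ball q n.+1) [tuple of x :: t] =
    \1_(ball q n) t * (`|x| <= ell t)%R%:R :> R) ->
  (\int[lebesgue_tuple R n]_t (ell t `^ p * (2 * (\1_(ball q n) t * ell t)))%:E =
   (p + 1)%:E * \int[lebesgue_tuple R n.+1]_t (`|tnth t ord0| `^ p * \1_(ball q n.+1) t)%:E)%E.
Proof.
move=> hq ap ml l0 sl; have p0 := admissible_ge0 ap.
have p10 : 0 < p + 1 by rewrite ltr_wpDl.
have mB := @measurable_indic_lq_ball q n hq.
have mp : measurable_fun setT (fun x : R => `|x| `^ p) := polylip_measurable (polylip_abs ap).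
rewrite ge0_integral_lebesgue_tupleS; last 2 first.
- apply/measurable_EFinP; apply: measurable_funM; last exact: measurable_indic_lq_ball.
  by apply: (measurableT_comp mp); exact: measurable_tnth.
- by move=> t; apply: integrand_indic; exact: powR_ge0.
pose H (z : R * n.-tuple R) := `|z.1| `^ p * (`|z.1| <= ell z.2)%R%:R * \1_(ball q n) z.2.
have mH : measurable_fun setT (EFin \o H).
  apply/measurable_EFinP; apply: measurable_funM; last exact: (measurableT_comp mB).
  apply: measurable_funM; first exact: (measurableT_comp mp).
  apply: measurable_natr_bool; apply: measurable_fun_ler; last exact: measurableT_comp.
  by apply: measurableT_comp => //.
have H0 z : (0 <= (EFin \o H) z)%E by rewrite lee_fin !mulr_ge0 ?powR_ge0// indicE.
rewrite [X in (_ * X)%E](_ : _ = \int[mu]_x \int[lebesgue_tuple R n]_t (EFin \o H) (x, t))%E; last first.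
  apply: eq_integral => x _; apply: eq_integral => t _.
  by rewrite tnth0 sl /H /=; congr EFin; ring.
rewrite (fubini_tonelli (EFin \o H))//= -[RHS]ge0_integralZl//; last 3 first.
- exact: (measurable_fun_fubini_tonelli_G (m1 := mu) (EFin \o H) mH H0).
- by move=> t _; apply: integral_ge0 => x _; exact: H0.
- by rewrite lee_fin ltW.
apply: eq_integral => t _.
transitivity ((p + 1)%:E * ((\1_(ball q n) t)%:E * \int[mu]_x (`|x| `^ p * (`|x| <= ell t)%R%:R)%:E))%E; last first.
  congr (_ * _)%E; rewrite -[LHS]ge0_integralZl//.
  - by apply: eq_integral => x _; rewrite -EFinM /H mulrC.
  - apply/measurable_EFinP; apply: measurable_funM => //.
    by apply: measurable_natr_bool; apply: measurable_fun_ler.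
rewrite integral_abs_powR// -!EFinM; congr EFin.
have -> : ell t `^ (p + 1) = ell t `^ p * ell t.
  by rewrite powRD ?powRr1// (gt_eqF p10).
by field; rewrite gt_eqF.
Qed.

End unit_ball.

(** * Two-sided moment bounds over a ball *)

Section ball_moments.
Context {R : realType}.
Local Notation mu := (@lebesgue_line R).
Local Notation g := (@gauss_fun R).
Local Notation ball q n := (@lq_ball R q n).

Definition ball_moment (q : \bar R) n (p : R) (a : 'I_n -> R) : R :=
  fine (\int[lebesgue_tuple R n]_t (`|lin a t| `^ p * \1_(ball q n) t)%:E)%E.

Definition axis n (i : 'I_n) : 'I_n -> R := fun j => (j == i)%:R.

Lemma lin_axis n (i : 'I_n) (t : n.-tuple R) : lin (axis i) t = tnth t i.
Proof.
rewrite /lin (bigD1 i)//= /axis eqxx mul1r big1 ?addr0// => j /negbTE ->.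
by rewrite mul0r.
Qed.

Lemma chain_zeros (w : R -> R) n h x : weight w -> chain w (coefs (fun _ : 'I_n => 0)) h x = mass w ^+ n * h x.
Proof.
move=> ww; elim: n x => [|n IH] x.
  by rewrite /coefs (size0nil (size_enum_ord 0)) mul1r.
by rewrite coefsS chain_cons blur0// IH exprSr mulrAC.
Qed.

Lemma chain_cst1 (w : R -> R) l x : weight w -> chain w l (fun=> 1) x = mass w ^+ size l.
Proof.
move=> ww; elim: l x => [|b l IH] x //; rewrite chain_cons.
rewrite (_ : chain w l _ = fun=> mass w ^+ size l); last by apply/funext => y; exact: IH.
rewrite [RHS]exprSr; exact: (blur0 ww (fun=> mass w ^+ size l) x).
Qed.

Variable q : \bar R.
Hypothesis hq : (2%:E <= q)%E.

(** Finiteness comes from the weighted integral, because C n p is positive. *)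
Lemma ball_momentE n p (a : 'I_n -> R) : admissible p ->
  (\int[lebesgue_tuple R n]_t (`|lin a t| `^ p * \1_(ball q n) t)%:E = (ball_moment q p a)%:E)%E.
Proof.
move=> ap; have [w [C [ww C0 _ /(_ n p a ap) E]]] := ball_weight hq.
rewrite /ball_moment; move: E; have I0 : (0 <= \int[lebesgue_tuple R n]_t (`|lin a t| `^ p * \1_(ball q n) t)%:E)%E.
  by apply: integral_ge0 => t _; apply: integrand_indic; exact: powR_ge0.
move: I0; case: (integral _ _ _) => [r| |]//= _.
by rewrite gt0_muley// lte_fin C0.
Qed.

Lemma ball_moment0 n (a : 'I_n -> R) :
  lebesgue_tuple R n (ball q n) = (ball_moment q 0 a)%:E.
Proof.
rewrite -ball_momentE; last by left.
transitivity (\int[lebesgue_tuple R n]_t (\1_(ball q n) t)%:E)%E.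
  by rewrite integral_indic// ?setIT//; exact: measurable_lq_ball.
by apply: eq_integral => t _; rewrite powRr0 mul1r.
Qed.

Lemma ball_moment_ge0 n p (a : 'I_n -> R) : admissible p -> 0 <= ball_moment q p a.
Proof.
move=> ap; rewrite -lee_fin -ball_momentE//.
by apply: integral_ge0 => t _; apply: integrand_indic; exact: powR_ge0.
Qed.

Lemma moment_sign2 (s : R) : s = 1 \/ s = -1 -> moment_sign s 2.
Proof. by case=> ->; [left|right]. Qed.

Lemma moment_sign_nice (s p : R) : 1 <= p -> moment_sign s p -> nice s (fun x : R => `|x| `^ p).
Proof. by move=> p1 sp; exact: abs_powR_nice. Qed.

(** The chain bounds translated to ball moments. For p = 2 the lower bound holds
    with both signs, hence is an equality. *)
Lemma ball_chain_facts (w : R -> R) (C : nat -> R -> R) m (a : 'I_m.+1 -> R) : weight w ->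
  (forall n p, admissible p -> 0 < C n p) ->
  (forall n p (a : 'I_n -> R), admissible p ->
      ((C n p)%:E * \int[lebesgue_tuple R n]_t (`|lin a t| `^ p * \1_(ball q n) t)%:E =
       (chain w (coefs a) (fun x => `|x| `^ p) 0%R)%:E)%E) ->
  [/\ C m.+1 0 * ball_moment q 0 a = mass w ^+ m.+1,
    forall p, admissible p ->
      C m.+1 p * ball_moment q p (axis (@ord0 m)) = mass w ^+ m * absmom w p,
    C m.+1 2 * ball_moment q 2 a = mass w ^+ m * absmom w 2 * \sum_i a i ^+ 2,
    forall s p, 1 <= p -> moment_sign s p ->
      0 <= s * (C m.+1 p * ball_moment q p a -
        mass w ^+ m * absmom w p * (\sum_i a i ^+ 2) `^ (p / 2)) &
    forall s p, 1 <= p -> moment_sign s p ->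
      0 <= s * (mass w ^+ m.+1 / mass g * absmom g p *
        ((gauss_ratio w ^+ 2) `^ (p / 2) * (\sum_i a i ^+ 2) `^ (p / 2)) -
        C m.+1 p * ball_moment q p a)].
Proof.
move=> ww C0 CE.
have a2 : admissible (2 : R) by right; rewrite ler1n.
have CM p (b : 'I_m.+1 -> R) : admissible p ->
    C m.+1 p * ball_moment q p b = chain w (coefs b) (fun x => `|x| `^ p) 0.
  by move=> ap; apply: EFin_inj; rewrite -CE// ball_momentE// EFinM.
have wg := @gauss_weight R.
pose S := \sum_i a i ^+ 2.
have S0 : 0 <= S by apply: sumr_ge0 => i _; exact: sqr_ge0.
have SE : sqsum (coefs a) = S by exact: sqsum_coefs.
have sizeE : size (coefs (fun i => a (lift ord0 i))) = m by exact: size_coefs.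
have sqS p : Num.sqrt S `^ p = S `^ (p / 2).
  by rewrite -powR12_sqrt// -powRrM mulrC.
have low s p : 1 <= p -> moment_sign s p ->
    0 <= s * (C m.+1 p * ball_moment q p a - mass w ^+ m * absmom w p * S `^ (p / 2)).
  move=> p1 sp; have ap : admissible p by right.
  have := chain_lower (a ord0) (coefs (fun i => a (lift ord0 i))) ww (moment_sign_nice p1 sp).
  rewrite -coefsS SE sizeE blur_abs// -CM// (ger0_norm (sqrtr_ge0 S)) sqS.
  by rewrite [S `^ _ * _]mulrC mulrA.
split.
- rewrite CM; last by left.
  have -> : (fun x : R => `|x| `^ 0) = (fun x => 1).
    by apply/funext => x; rewrite powRr0.
  by rewrite chain_cst1// size_coefs.
- move=> p ap; rewrite CM// coefsS chain_cons {1}/axis eqxx.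
  have -> : (fun i : 'I_m => axis (@ord0 m) (lift ord0 i)) = (fun=> 0) by [].
  rewrite (_ : chain w _ _ = fun x => mass w ^+ m * `|x| `^ p); last first.
    by apply/funext => x; rewrite chain_zeros.
  by rewrite blurZ ?blur_abs// ?normr1 ?powR1 ?mul1r//; exact: polylip_abs.
- have h1 := low 1 2 (ler1n _ 2) (moment_sign2 (or_introl erefl)).
  have h2 := low (-1) 2 (ler1n _ 2) (moment_sign2 (or_intror erefl)).
  rewrite divff// powRr1// in h1 h2.
  rewrite mul1r subr_ge0 in h1; rewrite mulN1r oppr_ge0 subr_le0 in h2.
  by apply/eqP; rewrite eq_le h1 h2.
- exact: low.
- move=> s p p1 sp; have ap : admissible p by right.
  have := chain_upper (coefs a) ww (moment_sign_nice p1 sp).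
  rewrite SE size_coefs blur_abs// -CM// normrM (ger0_norm (sqrtr_ge0 S)) powRM// sqS.
  rewrite norm_powR_sqr.
  by congr (0 <= s * (_ - _)); rewrite -[RHS]mulrA; congr (_ * _); exact: mulrC.
Qed.

Lemma combine_slice_bounds (s p V S Mp Pp P2 : R) : 1 <= p -> 0 < V -> 0 < P2 -> 0 <= S ->
  0 <= s * (Mp - Pp * S `^ (p / 2)) ->
  0 <= s * ((p + 1) * Pp / V - (3 * P2 / V) `^ (p / 2)) ->
  0 <= s * (Mp / V - 3 `^ (p / 2) / (p + 1) * (S * P2 / V) `^ (p / 2)).
Proof.
move=> p1 V0 P20 S0 low low1.
have p10 : 0 < p + 1 by rewrite ltr_wpDl// (le_trans _ p1).
have PV0 : 0 <= P2 / V by rewrite divr_ge0 ?(ltW P20) ?(ltW V0).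
have -> : S * P2 / V = S * (P2 / V) by rewrite mulrA.
rewrite (powRM _ S0 PV0).
have -> : 3 `^ (p / 2) / (p + 1) * (S `^ (p / 2) * (P2 / V) `^ (p / 2)) =
    S `^ (p / 2) / (p + 1) * (3 * P2 / V) `^ (p / 2).
  by rewrite -[3 * _ / _]mulrA (powRM _ (ler0n R 3) PV0); ring.
have h1 : 0 <= V^-1 by rewrite invr_ge0 ltW.
have h2 : 0 <= S `^ (p / 2) / (p + 1) by rewrite divr_ge0 ?powR_ge0 ?(ltW p10).
have := addr_ge0 (mulr_ge0 h1 low) (mulr_ge0 h2 low1); congr (0 <= _).
by move: (S `^ _) ((3 * _ / _) `^ _) => ? ?; field; rewrite !gt_eqF.
Qed.

Lemma combine_gauss_bounds (s p V S Mp M2 Z G A v Cp C2 C0 : R) :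
  0 < V -> 0 <= S -> 0 <= M2 -> 0 <= v -> 0 < Cp -> 0 < C2 -> 0 < C0 -> 0 < G -> 0 <= A ->
  C0 * V = Z -> C2 * M2 = Z * v * S ->
  0 <= s * (Z / G * A * ((2 * v) `^ (p / 2) * S `^ (p / 2)) - Cp * Mp) ->
  0 <= s * (Cp / C0 - (C2 / C0) `^ (p / 2)) ->
  0 <= s * (2 `^ (p / 2) * (A / G) * (M2 / V) `^ (p / 2) - Mp / V).
Proof.
move=> V0 S0 M20 v0 Cp0 C20 C00 G0 A0 EV EM up CJ.
have Y0 : 0 <= M2 / V by rewrite divr_ge0 ?(ltW V0).
have YE : v * S = M2 / V * (C2 / C0).
  apply: (mulfI (lt0r_neq0 (mulr_gt0 C00 V0))).
  transitivity (C2 * M2); last by field; rewrite !gt_eqF.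
  by rewrite EV EM mulrA.
have E : Z / G * A * ((2 * v) `^ (p / 2) * S `^ (p / 2)) =
    C0 * V * (2 `^ (p / 2) * (A / G) * (M2 / V) `^ (p / 2) * (C2 / C0) `^ (p / 2)).
  rewrite EV (powRM _ (ler0n R 2) v0) -[_ * _ * S `^ _]mulrA -(powRM _ v0 S0) YE.
  rewrite (powRM _ Y0 (divr_ge0 (ltW C20) (ltW C00))).
  by move: (_ `^ _) (_ `^ _) (_ `^ _) => ? ? ?; field; rewrite gt_eqF.
move: up; rewrite {}E.
set X := 2 `^ (p / 2) * _ * _ => up.
have X0 : 0 <= X by rewrite !mulr_ge0 ?powR_ge0 ?invr_ge0 ?(ltW G0).
have h1 : 0 <= (Cp * V)^-1 by rewrite invr_ge0 mulr_ge0 ?(ltW V0) ?(ltW Cp0).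
have h2 : 0 <= X * (C0 / Cp) by rewrite mulr_ge0 ?divr_ge0 ?(ltW C00) ?(ltW Cp0).
have := addr_ge0 (mulr_ge0 h1 up) (mulr_ge0 h2 CJ); congr (0 <= _).
by move: ((C2 / C0) `^ _) X {X0 h2 up} => Q X; field; rewrite !gt_eqF.
Qed.

(** Jensen's inequality for the half-length ell of the slices with respect to
    the density 2 ell on the ball of dimension m. *)
Lemma ball_axis_jensen m s p (P := fun e => ball_moment q e (axis (@ord0 m))) :
  1 <= p -> moment_sign s p -> 0 < P 0 -> 0 < P 2 ->
  0 <= s * ((p + 1) * P p / P 0 - (3 * P 2 / P 0) `^ (p / 2)).
Proof.
move=> p1 sp P0 P2; have [ell [ml l0 sl]] := @ball_slice R q m hq.
have mB := @measurable_indic_lq_ball R q m hq.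
have slE e : admissible e ->
    (\int[lebesgue_tuple R m]_t (ell t `^ e * (2 * (\1_(ball q m) t * ell t)))%:E =
     ((e + 1) * P e)%:E)%E.
  move=> ae; rewrite (slice_moment hq ae ml l0 sl) EFinM -(ball_momentE (axis ord0) ae).
  congr (_ * _)%E.
  by apply: eq_integral => t _; rewrite lin_axis.
apply: (@jensen_moment R _ _ (lebesgue_tuple R m)
  (fun t => 2 * (\1_(ball q m) t * ell t)) ell s p _ _ _ p1 sp _ ml _ l0 P0).
- by apply: measurable_funM; [exact: measurable_cst|exact: (measurable_funM mB ml)].
- by move=> t; rewrite !mulr_ge0// indicE.
- by rewrite mulr_gt0.
- transitivity ((0 + 1) * P 0)%:E; last by rewrite add0r mul1r.
  rewrite -slE; last by left.
  by apply: eq_integral => t _; rewrite powRr0 mul1r.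
- transitivity ((2 + 1) * P 2)%:E; last by congr (_ * _)%:E; ring.
  rewrite -slE; last by right; rewrite ler1n.
  by apply: eq_integral => t _; rewrite powR2.
- by apply: slE; right.
Qed.

Lemma ball_moment_bounds m (a : 'I_m.+1 -> R) s p : 1 <= p -> moment_sign s p ->
  let V := ball_moment q 0 a in
  [/\ 0 < V,
    0 <= s * (ball_moment q p a / V -
      3 `^ (p / 2) / (p + 1) * (ball_moment q 2 a / V) `^ (p / 2)) &
    0 <= s * (2 `^ (p / 2) * (absmom g p / mass g) * (ball_moment q 2 a / V) `^ (p / 2) -
      ball_moment q p a / V)].
Proof.
move=> p1 sp V; have ap : admissible p by right.
have a2 : admissible (2 : R) by right; rewrite ler1n.
have a0 : admissible (0 : R) by left.
have [w [C [ww C0 CJ CE]]] := ball_weight hq.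
have [EV EP EM low up] := ball_chain_facts a ww C0 CE.
pose S := \sum_i a i ^+ 2; rewrite -/S in EM low up.
have S0 : 0 <= S by apply: sumr_ge0 => i _; exact: sqr_ge0.
have Z0 : 0 < mass w := weight_mass_gt0 ww.
have Zg : 0 < mass g := weight_mass_gt0 (@gauss_weight R).
have Cp := C0 m.+1 p ap; have C2 := C0 m.+1 2 a2; have C00 := C0 m.+1 0 a0.
have V0 : 0 < V by rewrite -(pmulr_rgt0 _ C00) EV exprn_gt0.
have v0 := variance_gt0 ww.
pose P e := ball_moment q e (axis (@ord0 m)).
have P2 : 0 < P 2.
  by rewrite -(pmulr_rgt0 _ C2) EP// absmom2//; apply: mulr_gt0; [exact: exprn_gt0|exact: mulr_gt0].
have MS : ball_moment q 2 a = S * P 2.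
  apply: (mulfI (lt0r_neq0 C2)); rewrite EM mulrCA EP// mulrC; ring.
have PV : P 0 = V.
  by apply: (mulfI (lt0r_neq0 C00)); rewrite [LHS](EP 0 a0) absmom0 EV exprSr.
have p0 : 0 < p by exact: lt_le_trans p1.
have V0' : 0 < ball_moment q 0 (axis (@ord0 m)) by rewrite -/(P 0) PV.
split; first exact: V0.
- have low1 := ball_axis_jensen p1 sp V0' P2.
  rewrite -/(P p) -/(P 2) -/(P 0) PV in low1.
  have low1' : 0 <= s * (ball_moment q p a - P p * S `^ (p / 2)).
    have := low s p p1 sp; rewrite -(EP p ap) -/(P p) -mulrA -mulrBr mulrCA.
    by rewrite (pmulr_rge0 _ Cp).
  by rewrite MS; exact: (combine_slice_bounds p1 V0 P2 S0 low1' low1).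
- have {}up := up s p p1 sp; have CJp := CJ m.+1 s p p1 sp.
  have rE : gauss_ratio w ^+ 2 = 2 * variance w.
    rewrite sqr_sqrtr gauss_variance ?invrK; first exact: mulrC.
    exact: mulr_ge0 (ltW v0) (ler0n R 2).
  rewrite rE in up.
  have EM' : C m.+1 2 * ball_moment q 2 a = mass w ^+ m.+1 * variance w * S.
    by rewrite EM (absmom2 ww) exprSr mulrA [_ * mass w]mulrAC.
  exact: (combine_gauss_bounds V0 S0 (ball_moment_ge0 _ a2) (ltW v0) Cp C2 C00 Zg
    (absmom_ge0 _ (@gauss_weight R)) EV EM' up CJp).
Qed.

End ball_moments.

(** * From ball moments to norms of random variables *)

Section uniform_moments.
Context {R : realType}.
Local Notation g := (@gauss_fun R).
Local Notation ball q n := (@lq_ball R q n).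
Variable q : \bar R.
Hypothesis hq : (2%:E <= q)%E.

Lemma uniform_integral d (T : measurableType d) (P : probability T R) n
    (X : {RV P >-> n.-tuple R}) (V : R) (F : n.-tuple R -> R) :
  uniformly_distributed X (ball q n) -> 0 < V -> lebesgue_tuple R n (ball q n) = V%:E ->
  measurable_fun setT F -> (forall t, 0 <= F t) ->
  (\int[P]_w (F (X w))%:E = V^-1%:E * \int[lebesgue_tuple R n]_t (F t * \1_(ball q n) t)%:E)%E.
Proof.
move=> uX V0 VE mF F0; have mK := @measurable_lq_ball R q n hq.
have mEF : measurable_fun setT (EFin \o F) by exact/measurable_EFinP.
transitivity (\int[distribution P X]_t (F t)%:E)%E.
  by have := ge0_integral_distribution X mEF; rewrite /comp => ->// t; rewrite lee_fin.
rewrite (@ge0_negligible_integral _ _ _ (distribution P X) setT (~` ball q n))//; last 3 first.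
- exact: measurableC.
- by move=> t _; rewrite lee_fin.
- by have := uX _ (measurableC mK); rewrite setICr measure0 mul0e.
rewrite setTD setCK.
have k0 : 0 <= V^-1 by rewrite invr_ge0 ltW.
rewrite (@eq_measure_integral _ _ _ _ (mscale (NngNum k0) (lebesgue_tuple R n))); last first.
  move=> A mA AK; rewrite /mscale /=; have := uX _ mA; rewrite (setIidr AK) => ->.
  by rewrite VE inver gt_eqF// muleC.
rewrite ge0_integral_mscale//=; last 2 first.
- exact: measurable_funTS.
- by move=> t _; rewrite lee_fin.
congr (_ * _)%E; rewrite integral_mkcond; apply: eq_integral => t _.
rewrite patchE indicE; case: (t \in ball q n); by rewrite ?mulr1 ?mulr0.
Qed.

Lemma uniform_Lnorm d (T : measurableType d) (P : probability T R) n
    (X : {RV P >-> n.-tuple R}) (a : 'I_n -> R) p :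
  uniformly_distributed X (ball q n) -> 1 <= p -> 0 < ball_moment q 0 a ->
  ('N[P]_p%:E[EFin \o lincomb X a] =
    ((ball_moment q p a / ball_moment q 0 a) `^ p^-1)%:E)%E.
Proof.
move=> uX p1 V0; rewrite unlock /=.
rewrite [X in poweR X _](_ : _ = (ball_moment q p a / ball_moment q 0 a)%:E)%E; last first.
  transitivity (\int[P]_w (`|lin a (X w)| `^ p)%:E)%E.
    by apply: eq_integral => w _; rewrite /= -poweR_EFin.
  rewrite (@uniform_integral _ _ _ _ X (ball_moment q 0 a) (fun t => `|lin a t| `^ p))//.
  - by rewrite ball_momentE// -?EFinM 1?mulrC//; right.
  - exact: ball_moment0.
  - exact: measurable_abs_lin_powR.
by rewrite poweR_EFin.
Qed.

End uniform_moments.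

Section norm_bounds.
Context {R : realType}.
Local Notation g := (@gauss_fun R).

Lemma root_moment (c k Y p : R) : 1 <= p -> 0 <= c -> 0 <= k -> 0 <= Y ->
  (c `^ (p / 2) * k * Y `^ (p / 2)) `^ p^-1 = Num.sqrt c * k `^ p^-1 * Y `^ 2^-1.
Proof.
move=> p1 c0 k0 Y0.
have E : p / 2 / p = 2^-1 by field; rewrite gt_eqF// (lt_le_trans ltr01).
rewrite !powRM ?mulr_ge0 ?powR_ge0//.
by rewrite -!powRrM E powR12_sqrt.
Qed.

Lemma cube_constE (Y p : R) : 1 <= p -> 0 <= Y ->
  (3 `^ (p / 2) / (p + 1) * Y `^ (p / 2)) `^ p^-1 = cube_const p * Y `^ 2^-1.
Proof.
move=> p1 Y0; have p10 : 0 <= p + 1 by rewrite addr_ge0// (le_trans _ p1).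
rewrite root_moment// ?invr_ge0//; congr (_ * _ * _).
by rewrite -(powR_inv1 p10) -powRrM mulN1r powRN.
Qed.

Lemma gamma_constE (Y p : R) : 1 <= p -> 0 <= Y ->
  (2 `^ (p / 2) * (absmom g p / mass g) * Y `^ (p / 2)) `^ p^-1 = gamma_const p * Y `^ 2^-1.
Proof.
move=> p1 Y0; have wg := @gauss_weight R.
rewrite root_moment ?divr_ge0 ?absmom_ge0 ?(ltW (weight_mass_gt0 wg))//.
by rewrite gauss_absmom// gauss_mass.
Qed.

Lemma ler_root (X Y p : R) : 1 <= p -> 0 <= X -> X <= Y -> X `^ p^-1 <= Y `^ p^-1.
Proof.
move=> p1 X0 XY; rewrite ge0_ler_powR ?nnegrE ?invr_ge0 ?(le_trans _ p1)//.
exact: le_trans XY.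
Qed.

Variable q : \bar R.
Hypothesis hq : (2%:E <= q)%E.

Lemma uniform_moment_bounds n d (T : measurableType d) (P : probability T R)
    (X : {RV P >-> n.-tuple R}) (a : 'I_n -> R) p : (1 <= n)%N ->
  uniformly_distributed X (lq_ball q n) -> 1 <= p ->
  ((A_const p)%:E * 'N[P]_2%:E[EFin \o lincomb X a] <= 'N[P]_p%:E[EFin \o lincomb X a])%E /\
  ('N[P]_p%:E[EFin \o lincomb X a] <= (B_const p)%:E * 'N[P]_2%:E[EFin \o lincomb X a])%E.
Proof.
case: n X a => [//|m] X a _ uX p1.
have [V0 _ _] := ball_moment_bounds hq a (lexx 1) (or_intror (conj erefl (ler1n R 2))).
rewrite (uniform_Lnorm hq uX p1 V0) (uniform_Lnorm hq uX (ler1n R 2) V0) -!EFinM !lee_fin.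
have ratio0 e : 1 <= e -> 0 <= ball_moment q e a / ball_moment q 0 a.
  by move=> e1; exact: divr_ge0 (ball_moment_ge0 hq a (or_intror e1)) (ltW V0).
have Y0 := ratio0 2 (ler1n R 2).
have X0 := ratio0 p p1.
have cube0 : 0 <= 3 `^ (p / 2) / (p + 1) * (ball_moment q 2 a / ball_moment q 0 a) `^ (p / 2).
  by rewrite !mulr_ge0 ?powR_ge0 ?invr_ge0 ?addr_ge0 ?(le_trans _ p1).
have gauss0 : 0 <= 2 `^ (p / 2) * (absmom g p / mass g) *
    (ball_moment q 2 a / ball_moment q 0 a) `^ (p / 2).
  rewrite !mulr_ge0 ?powR_ge0 ?invr_ge0 ?absmom_ge0 ?(ltW (weight_mass_gt0 (@gauss_weight R)))//.
  exact: gauss_weight.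
rewrite /A_const /B_const.
have [p2|p2] := ltP p 2.
- have [_ cube gauss] := ball_moment_bounds hq a p1 (or_intror (conj erefl (ltW p2))).
  rewrite mulN1r oppr_ge0 subr_le0 in cube; rewrite mulN1r oppr_ge0 subr_le0 in gauss.
  rewrite -(cube_constE p1 Y0) -(gamma_constE p1 Y0).
  by split; [exact: ler_root p1 gauss0 gauss|exact: ler_root p1 X0 cube].
- have [_ cube gauss] := ball_moment_bounds hq a p1 (or_introl (conj erefl p2)).
  rewrite mul1r subr_ge0 in cube; rewrite mul1r subr_ge0 in gauss.
  rewrite -(cube_constE p1 Y0) -(gamma_constE p1 Y0).
  by split; [exact: ler_root p1 cube0 cube|exact: ler_root p1 X0 gauss].
Qed.

End norm_bounds.

(** * Gaussian averages of powers of the Euclidean norm *)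

Section gauss_norm_moments.
Context {R : realType}.
Local Notation g := (@gauss_fun R).

Lemma powsum2 n (t : n.-tuple R) : powsum 2 t = \sum_(i < n) tnth t i ^+ 2.
Proof. by apply: eq_bigr => i _; rewrite powR2// sqr_norm. Qed.

Lemma measurable_powsum_powR (r : R) n :
  measurable_fun setT (fun t : n.-tuple R => powsum 2 t `^ r).
Proof.
apply: (@measurableT_comp _ _ _ _ _ _ (@powR R ^~ r)) => //.
exact: measurable_powsum.
Qed.

Lemma measurable_expR_powsum (lam : R) n :
  measurable_fun setT (fun t : n.-tuple R => expR (- (lam * powsum 2 t))).
Proof.
apply: measurableT_comp => //; apply: measurable_funN; apply: measurable_funM => //.
exact: measurable_powsum.
Qed.

Lemma measurable_gauss_norm (r : R) n :
  measurable_fun setT (fun t : n.-tuple R => (powsum 2 t `^ r * expR (- powsum 2 t))%:E).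
Proof.
apply/measurable_EFinP; apply: measurable_funM; first exact: measurable_powsum_powR.
by have := @measurable_expR_powsum 1 n; under eq_fun do rewrite mul1r.
Qed.

(** The average of |t|^(2r) for an unnormalized Gaussian, powsum 2 t being the
    squared Euclidean norm. *)
Definition gauss_norm_moment n (r : R) : R :=
  fine (\int[lebesgue_tuple R n]_t (powsum 2 t `^ r * expR (- powsum 2 t))%:E)%E.

(** ball_gamma with r = 2 reduces finiteness to the Euclidean unit ball, where
    powsum 2 t `^ r is at most 1. *)
Lemma gauss_norm_momentE n r : 0 <= r ->
  (\int[lebesgue_tuple R n]_t (powsum 2 t `^ r * expR (- powsum 2 t))%:E =
   (gauss_norm_moment n r)%:E)%E.
Proof.
move=> r0; rewrite /gauss_norm_moment fineK// ge0_fin_numE; last first.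
  by apply: integral_ge0 => t _; rewrite lee_fin mulr_ge0 ?powR_ge0 ?expR_ge0.
have r20 : 0 <= 2 * r by rewrite mulr_ge0.
rewrite (@ball_gamma R 2 (2 * r) n (fun t => powsum 2 t `^ r))//; last 3 first.
- exact: measurable_powsum_powR.
- by move=> t; exact: powR_ge0.
- by move=> c t c0; rewrite powsum_scalet ?(ltW c0)// powRM ?powR_ge0 ?powsum_ge0// -powRrM.
apply: lte_mul_pinfty => //; first by rewrite lee_fin ltW// gint_gt0// divr_ge0// addr_ge0.
have a0 : admissible (0 : R) by left.
have h2 : (2%:E <= 2%:E :> \bar R)%E by [].
have E := @ball_momentE R 2%:E h2 n 0 (fun=> 0) a0.
apply: (@le_lt_trans _ _ (ball_moment 2%:E 0 (fun _ : 'I_n => 0))%:E); last exact: ltry.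
rewrite -E; apply: ge0_le_integral => //.
- by move=> t _; rewrite lee_fin mulr_ge0 ?powR_ge0.
- apply/measurable_EFinP; apply: measurable_funM; last exact: measurable_powsum_le.
  exact: measurable_powsum_powR.
- apply/measurable_EFinP; apply: measurable_funM; last exact: measurable_indic_lq_ball.
  exact: measurable_abs_lin_powR.
- move=> t _; rewrite powRr0 mul1r lq_ball_indicator_fin lee_fin.
  have [t1|] := leP (powsum 2 t) 1; last by rewrite mulr0.
  have := ge0_ler_powR r0 _ _ t1; rewrite powR1 mulr1.
  by apply; rewrite nnegrE ?powsum_ge0.
Qed.

Lemma gauss_norm_moment0 n : gauss_norm_moment n 0 = mass g ^+ n.
Proof.
apply: EFin_inj; rewrite -gauss_norm_momentE//.
have lip1 : polylip (fun _ : R => 1).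
  by exists 0, 0; split => // x y; rewrite subrr normr0 !mul0r.
transitivity ((mass g ^+ size (coefs (fun _ : 'I_n => 0 : R)))%:E); last by rewrite size_coefs.
rewrite -(chain_cst1 _ 0 (@gauss_weight R)) -chain_tuple//; last exact: gauss_weight.
by apply: eq_integral => t _; rewrite powRr0 !mul1r -prod_expw expw2.
Qed.

Lemma gauss_norm_moment_rec n r : 0 <= r ->
  gauss_norm_moment n (r + 1) = (n%:R / 2 + r) * gauss_norm_moment n r.
Proof.
move=> r0; apply: EFin_inj; rewrite -gauss_norm_momentE ?addr_ge0//.
have r10 : r + 1 == 0 = false by rewrite gt_eqF// ltr_wpDl.
transitivity (\int[lebesgue_tuple R n]_t
    (powsum 2 t `^ r * powsum 2 t * expR (- powsum 2 t))%:E)%E.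
  by apply: eq_integral => t _; rewrite powRD ?r10// powRr1// powsum_ge0.
apply: scaling_identity.
- exact: measurable_powsum_powR.
- exact: measurable_powsum.
- by move=> t; exact: powR_ge0.
- by move=> t; exact: powsum_ge0.
(* powsum 2 is homogeneous of degree 2, so this dilation removes lam. *)
move=> lam l0; pose c := lam `^ (- 2^-1).
have c0 : 0 < c by exact: powR_gt0.
have c2 : c `^ 2 = lam^-1.
  by rewrite /c -powRrM mulNr mulVf// powR_inv1// ltW.
rewrite (ge0_integral_scalet c0); last 2 first.
- apply/measurable_EFinP; apply: measurable_funM; last exact: measurable_expR_powsum.
  exact: measurable_powsum_powR.
- by move=> t; rewrite lee_fin mulr_ge0 ?powR_ge0 ?expR_ge0.
rewrite (eq_integral (fun t : n.-tuple R =>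
    (lam `^ (- r))%:E * (powsum 2 t `^ r * expR (- powsum 2 t))%:E)%E); last first.
  move=> t _; rewrite powsum_scalet ?(ltW c0)// c2 -EFinM; congr EFin.
  rewrite powRM ?invr_ge0 ?(ltW l0) ?powsum_ge0// -powR_inv1 ?(ltW l0)// -powRrM mulN1r -mulrA.
  by rewrite powR_inv1 ?(ltW l0)// [lam * _]mulrA divff ?gt_eqF// mul1r.
rewrite ge0_integralZl ?lee_fin ?powR_ge0//; last 2 first.
- exact: measurable_gauss_norm.
- by move=> t _; rewrite lee_fin mulr_ge0 ?powR_ge0 ?expR_ge0.
rewrite gauss_norm_momentE// -!EFinM; congr EFin; rewrite mulrA; congr (_ * _).
rewrite -powR_mulrn ?(ltW c0)// /c -powRrM -powRD; last by rewrite (gt_eqF l0) implybT.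
by congr (_ `^ _); field.
Qed.

(** J_(r+1) / J_0 >= (J_1 / J_0)^(r+1) by Jensen's inequality, and the
    recurrence expresses J_(r+1) and J_1. *)
Lemma gauss_norm_moment_lower m r (n := m.+1) : 0 <= r ->
  (n%:R / 2) `^ (r + 1) / (n%:R / 2 + r) * gauss_norm_moment n 0 <= gauss_norm_moment n r.
Proof.
move=> r0; have r1p : 0 <= r + 1 by rewrite addr_ge0.
have p1 : 1 <= 2 * (r + 1) by lra.
have sp : moment_sign 1 (2 * (r + 1)) by left; split => //; lra.
have J0 : 0 < gauss_norm_moment n 0.
  by rewrite gauss_norm_moment0 exprn_gt0// (weight_mass_gt0 (@gauss_weight R)).
have n0 : 0 < n%:R / 2 :> R by rewrite divr_gt0// ltr0n.
have n20 : 0 < n%:R / 2 + r by rewrite ltr_wpDr.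
have J1 : gauss_norm_moment n 1 = n%:R / 2 * gauss_norm_moment n 0.
  by rewrite -[X in gauss_norm_moment n X = _]add0r gauss_norm_moment_rec// addr0.
have J2 := gauss_norm_moment_rec n r0.
have J10 : 0 < gauss_norm_moment n 1 by rewrite J1 mulr_gt0.
have H : 0 <= 1 * (gauss_norm_moment n (r + 1) / gauss_norm_moment n 0 -
    (gauss_norm_moment n 1 / gauss_norm_moment n 0) `^ (2 * (r + 1) / 2)).
  apply: (@jensen_moment R _ _ (lebesgue_tuple R n) (fun t => expR (- powsum 2 t))
    (fun t => powsum 2 t `^ 2^-1) _ _ _ _ _ p1 sp _ _ _ _ J0 J10).
  - by have := @measurable_expR_powsum 1 n; under eq_fun do rewrite mul1r.
  - exact: measurable_powsum_powR.
  - by move=> t; exact: expR_ge0.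
  - by move=> t; exact: powR_ge0.
  - by rewrite -(gauss_norm_momentE _ (lexx 0)); apply: eq_integral => t _; rewrite powRr0 mul1r.
  - rewrite -(gauss_norm_momentE _ ler01); apply: eq_integral => t _.
    by rewrite -powR_mulrn ?powR_ge0// -powRrM mulVf.
  - rewrite -(gauss_norm_momentE _ r1p); apply: eq_integral => t _.
    by rewrite -powRrM mulrA mulVf// mul1r.
have e : 2 * (r + 1) / 2 = r + 1 by field.
have e1 : n%:R / 2 * gauss_norm_moment n 0 / gauss_norm_moment n 0 = n%:R / 2.
  exact: (mulfK (lt0r_neq0 J0) _).
move: H; rewrite mul1r subr_ge0 J1 J2 e e1 (ler_pdivlMr _ _ J0) => H.
by rewrite mulrAC (ler_pdivrMr _ _ n20) [leRHS]mulrC.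
Qed.

(** J_r / J_0 <= (J_(r+1) / J_0)^(r/(r+1)) by Jensen's inequality, and J_(r+1) =
    (n/2 + r) J_r, so the inequality can be solved for J_r. *)
Lemma gauss_norm_moment_upper m r (n := m.+1) : 1 <= r ->
  gauss_norm_moment n r <= (n%:R / 2 + r) `^ r * gauss_norm_moment n 0.
Proof.
move=> r1; have r0 : 0 <= r by exact: le_trans r1.
have r10 : 0 < r + 1 by rewrite ltr_wpDl.
have r1p := ltW r10.
pose p := 2 * r / (r + 1).
have p1 : 1 <= p by rewrite /p ler_pdivlMr//; lra.
have sp : moment_sign (-1) p by right; split => //; rewrite /p ler_pdivrMr//; lra.
have J0 : 0 < gauss_norm_moment n 0.
  by rewrite gauss_norm_moment0 exprn_gt0// (weight_mass_gt0 (@gauss_weight R)).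
have n0 : 0 < n%:R / 2 :> R by rewrite divr_gt0// ltr0n.
have n20 : 0 < n%:R / 2 + r by rewrite ltr_wpDr.
have Jr : 0 < gauss_norm_moment n r.
  apply: lt_le_trans (gauss_norm_moment_lower m r0).
  by rewrite mulr_gt0// divr_gt0// powR_gt0.
have J2 := gauss_norm_moment_rec n r0.
have J20 : 0 < gauss_norm_moment n (r + 1) by rewrite J2 mulr_gt0.
have H : 0 <= -1 * (gauss_norm_moment n r / gauss_norm_moment n 0 -
    (gauss_norm_moment n (r + 1) / gauss_norm_moment n 0) `^ (p / 2)).
  apply: (@jensen_moment R _ _ (lebesgue_tuple R n) (fun t => expR (- powsum 2 t))
    (fun t => powsum 2 t `^ ((r + 1) / 2)) _ _ _ _ _ p1 sp _ _ _ _ J0 J20).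
  - by have := @measurable_expR_powsum 1 n; under eq_fun do rewrite mul1r.
  - exact: measurable_powsum_powR.
  - by move=> t; exact: expR_ge0.
  - by move=> t; exact: powR_ge0.
  - by rewrite -(gauss_norm_momentE _ (lexx 0)); apply: eq_integral => t _; rewrite powRr0 mul1r.
  - rewrite -(gauss_norm_momentE _ r1p); apply: eq_integral => t _.
    by rewrite -powR_mulrn ?powR_ge0// -powRrM divfK.
  - rewrite -(gauss_norm_momentE _ r0); apply: eq_integral => t _.
    rewrite -powRrM; congr (_ `^ _ * _)%:E; rewrite /p; field.
    by rewrite gt_eqF.
move: H; rewrite mulN1r oppr_ge0 subr_le0 J2 -mulrA.
set X := _ / gauss_norm_moment n 0; set c := n%:R / 2 + r => H.
have X0 : 0 < X := divr_gt0 Jr J0.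
rewrite -(ler_pdivrMr _ _ J0) -/X.
have := ge0_ler_powR (ltW r10) _ _ H; rewrite !nnegrE powR_ge0 (ltW X0) => /(_ isT isT).
rewrite -powRrM (_ : p / 2 * (r + 1) = r); last by rewrite /p; field; rewrite gt_eqF.
rewrite powRM ?(ltW n20) ?(ltW X0)// powRD ?powRr1 ?(ltW X0)//; last by rewrite (gt_eqF X0) implybT.
by rewrite [X `^ r * _]mulrC ler_pM2r// powR_gt0.
Qed.

End gauss_norm_moments.

(** * Sharpness: the segment *)

Section sharpness_tools.
Context {R : realType}.
Local Notation g := (@gauss_fun R).
Local Notation ball q n := (@lq_ball R q n).

(** A named copy of the identity that can carry the structure of a random
    variable. *)
Definition identity_tuple n (t : n.-tuple R) : n.-tuple R := t.

Lemma measurable_identity_tuple n : measurable_fun setT (@identity_tuple n).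
Proof. exact: measurable_id. Qed.

HB.instance Definition _ n := isMeasurableFun.Build _ _ _ _
  (@identity_tuple n) (@measurable_identity_tuple n).

Lemma uniform_exists n (K : set (n.-tuple R)) (V : R) : measurable K ->
  lebesgue_tuple R n K = V%:E -> 0 < V ->
  exists P : probability (n.-tuple R) R,
    uniformly_distributed (@identity_tuple n : {RV P >-> n.-tuple R}) K.
Proof.
move=> mK VE V0.
pose t0 : n.-tuple R := [tuple of nseq n 0].
pose M : {measure set (n.-tuple R) -> \bar R} := mrestr (lebesgue_tuple R n) mK.
have ME (A : set (n.-tuple R)) : M A = lebesgue_tuple R n (A `&` K) by [].
have TE : M setT = V%:E by rewrite ME setTI.
exists (mnormalize M (\d_t0 : probability _ R)) => A mA.
rewrite /distribution /pushforward; change (mnormalize M \d_t0 A = lebesgue_tuple R n (K `&` A) / lebesgue_tuple R n K)%E.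
by rewrite /mnormalize TE eqe gt_eqF//= ME VE inver gt_eqF// setIC.
Qed.

Variable q : \bar R.
Hypothesis hq : (2%:E <= q)%E.

Lemma ball_moment0_gt0 m (a : 'I_m.+1 -> R) : 0 < ball_moment q 0 a.
Proof.
by have [] := ball_moment_bounds hq a (lexx 1) (or_intror (conj erefl (ler1n R 2))).
Qed.

(** A bound valid for all random vectors applies to the coordinate map on the
    normalized ball. *)
Lemma lower_moment_boundE p A m (a : 'I_m.+1 -> R) : 1 <= p -> lower_moment_bound q p A ->
  A * (ball_moment q 2 a / ball_moment q 0 a) `^ 2^-1 <=
  (ball_moment q p a / ball_moment q 0 a) `^ p^-1.
Proof.
move=> p1 HA; have V0 := ball_moment0_gt0 a.
have [P uP] := uniform_exists (measurable_lq_ball hq) (ball_moment0 hq a) V0.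
have := HA m.+1 isT _ _ P _ uP a.
by rewrite (uniform_Lnorm hq uP p1 V0) (uniform_Lnorm hq uP (ler1n R 2) V0) -EFinM lee_fin.
Qed.

Lemma upper_moment_boundE p B m (a : 'I_m.+1 -> R) : 1 <= p -> upper_moment_bound q p B ->
  (ball_moment q p a / ball_moment q 0 a) `^ p^-1 <=
  B * (ball_moment q 2 a / ball_moment q 0 a) `^ 2^-1.
Proof.
move=> p1 HB; have V0 := ball_moment0_gt0 a.
have [P uP] := uniform_exists (measurable_lq_ball hq) (ball_moment0 hq a) V0.
have := HB m.+1 isT _ _ P _ uP a.
by rewrite (uniform_Lnorm hq uP p1 V0) (uniform_Lnorm hq uP (ler1n R 2) V0) -EFinM lee_fin.
Qed.

Lemma powR_le1 (r x : R) : 0 < r -> 0 <= x -> (x `^ r <= 1) = (x <= 1).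
Proof.
move=> r0 x0; apply/idP/idP => h.
  rewrite leNgt; apply/negP => x1.
  have := gt0_ltr_powR r0 _ _ x1; rewrite !nnegrE ler01 x0 powR1 => /(_ isT isT).
  by rewrite ltNge h.
by have := ge0_ler_powR (ltW r0) _ _ h; rewrite !nnegrE ler01 x0 powR1; apply.
Qed.

Lemma lq_ball_coord n (t : n.-tuple R) i : ball q n t -> `|tnth t i| <= 1.
Proof.
move: hq; case: q => [r|_|]//.
rewrite lee_fin => r2 /= H; have r0 : 0 < r by exact: lt_le_trans r2.
rewrite -(powR_le1 r0)//; apply: le_trans H.
by rewrite (bigD1 i)//= lerDl sumr_ge0// => j _; exact: powR_ge0.
Qed.

(** In dimension one all the balls are [-1, 1]. *)
Lemma segment_moment p : admissible p ->
  ball_moment q p (axis (@ord0 0)) = 2 / (p + 1).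
Proof.
move=> ap; apply: EFin_inj; rewrite -ball_momentE// -integral_abs_powR1//.
have mI : measurable_fun setT (fun t : 1.-tuple R => (`|lin (axis ord0) t| `^ p * \1_(ball q 1) t)%:E).
  apply/measurable_EFinP; apply: measurable_funM; last exact: measurable_indic_lq_ball.
  exact: measurable_abs_lin_powR.
rewrite ge0_integral_lebesgue_tupleS//.
apply: eq_integral => x _; rewrite ge0_integral_lebesgue_tuple0; last first.
  exact: (@measurable_tuple_cons _ 0 (fun t => (`|lin (axis ord0) t| `^ p * \1_(ball q 1) t)%:E)).
rewrite lin_axis tnth0; congr (_ * _)%:E; move: hq; case: q => [r|_|]//.
- rewrite lee_fin => r2; have r0 : 0 < r by exact: lt_le_trans r2.
  by rewrite lq_ball_indicator_fin /powsum big_ord_recl big_ord0 tnth0 addr0 powR_le1.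
- by rewrite lq_ball_indicator_pinfty prod_cons big_ord0 mulr1.
Qed.

(** On the segment the moment inequality with the constant of the cube is an
    equality. *)
Lemma segment_ratio p : 1 <= p ->
  (ball_moment q p (axis (@ord0 0)) / ball_moment q 0 (axis (@ord0 0))) `^ p^-1 =
  cube_const p * (ball_moment q 2 (axis (@ord0 0)) / ball_moment q 0 (axis (@ord0 0))) `^ 2^-1.
Proof.
move=> p1; have a0 : admissible (0 : R) by left.
have a2 : admissible (2 : R) by right; rewrite ler1n.
have ap : admissible p by right.
rewrite (segment_moment ap) (segment_moment a2) (segment_moment a0).
have -> : 2 / (2 + 1) / (2 / (0 + 1)) = 3^-1 :> R by field.
rewrite -cube_constE ?invr_ge0//; congr (_ `^ _).
rewrite [RHS]mulrAC -powRM ?invr_ge0// divff// powR1.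
by field; rewrite gt_eqF// ltr_wpDl// (le_trans _ p1).
Qed.

Lemma segment_norm2_gt0 :
  0 < (ball_moment q 2 (axis (@ord0 0)) / ball_moment q 0 (axis (@ord0 0))) `^ 2^-1.
Proof.
have a0 : admissible (0 : R) by left.
have a2 : admissible (2 : R) by right; rewrite ler1n.
rewrite powR_gt0// (segment_moment a2) (segment_moment a0).
by rewrite divr_gt0// divr_gt0// ?addr_gt0// add0r.
Qed.

Lemma lower_bound_le_cube p A : 1 <= p -> lower_moment_bound q p A -> A <= cube_const p.
Proof.
move=> p1 HA; have := lower_moment_boundE (axis (@ord0 0)) p1 HA.
by rewrite (segment_ratio p1) (ler_pM2r segment_norm2_gt0).
Qed.

Lemma upper_bound_ge_cube p B : 1 <= p -> upper_moment_bound q p B -> cube_const p <= B.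
Proof.
move=> p1 HB; have := upper_moment_boundE (axis (@ord0 0)) p1 HB.
by rewrite (segment_ratio p1) (ler_pM2r segment_norm2_gt0).
Qed.

End sharpness_tools.

(** * Sharpness: averaging over Gaussian coefficients *)

Section gauss_average.
Context {R : realType}.
Local Notation g := (@gauss_fun R).
Local Notation ball q n := (@lq_ball R q n).
Variable q : \bar R.
Hypothesis hq : (2%:E <= q)%E.

(** The second moment is a multiple of |a|^2, as the covariance of the ball is a
    multiple of the identity. *)
Lemma ball_moment2_axis m (a : 'I_m.+1 -> R) :
  ball_moment q 2 a = (\sum_i a i ^+ 2) * ball_moment q 2 (axis (@ord0 m)).
Proof.
have a2 : admissible (2 : R) by right; rewrite ler1n.
have [w [C [ww C0 _ CE]]] := ball_weight hq.
have [_ EP EM _ _] := ball_chain_facts hq a ww C0 CE.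
apply: (mulfI (lt0r_neq0 (C0 m.+1 2 a2))).
by rewrite EM mulrCA (EP 2 a2) mulrC.
Qed.

Lemma ball_moment2_axis_eq m (i : 'I_m.+1) :
  ball_moment q 2 (axis i) = ball_moment q 2 (axis (@ord0 m)).
Proof.
have S1 : \sum_j axis i j ^+ 2 = 1 :> R.
  rewrite (bigD1 i)//= /axis eqxx big1 ?addr0 ?expr1n// => j /negbTE ->.
  by rewrite expr0n.
have E := ball_moment2_axis (axis i).
by move: E; rewrite S1 mul1r.
Qed.

Lemma ball_moment2_axis_gt0 m : 0 < ball_moment q 2 (axis (@ord0 m)).
Proof.
have a2 : admissible (2 : R) by right; rewrite ler1n.
have [w [C [ww C0 _ CE]]] := ball_weight hq.
have [_ EP _ _ _] := ball_chain_facts hq (axis (@ord0 m)) ww C0 CE.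
rewrite -(pmulr_rgt0 _ (C0 m.+1 2 a2)) (EP 2 a2) absmom2//.
have Z0 := weight_mass_gt0 ww.
by apply: mulr_gt0; [exact: exprn_gt0|apply: mulr_gt0 => //; exact: variance_gt0].
Qed.

Definition norm_moment n (r : R) : R :=
  fine (\int[lebesgue_tuple R n]_t (powsum 2 t `^ r * \1_(ball q n) t)%:E)%E.

Lemma norm_momentE n r : 0 <= r ->
  (\int[lebesgue_tuple R n]_t (powsum 2 t `^ r * \1_(ball q n) t)%:E = (norm_moment n r)%:E)%E.
Proof.
move=> r0; rewrite /norm_moment fineK// ge0_fin_numE; last first.
  by apply: integral_ge0 => t _; apply: integrand_indic; exact: powR_ge0.
have a0 : admissible (0 : R) by left.
pose z (_ : 'I_n) : R := 0.
apply: (@le_lt_trans _ _ ((n%:R `^ r)%:E * (ball_moment q 0 z)%:E)%E); last by rewrite -EFinM ltry.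
rewrite -ball_momentE// -[leRHS]ge0_integralZl ?lee_fin ?powR_ge0//; last first.
  apply/measurable_EFinP; apply: measurable_funM; last exact: measurable_indic_lq_ball.
  exact: measurable_abs_lin_powR.
apply: ge0_le_integral => //.
- by move=> t _; apply: integrand_indic; exact: powR_ge0.
- apply/measurable_EFinP; apply: measurable_funM; last exact: measurable_indic_lq_ball.
  exact: measurable_powsum_powR.
- apply/measurable_EFinP; apply: measurable_funM => //; apply: measurable_funM; last exact: measurable_indic_lq_ball.
  exact: measurable_abs_lin_powR.
- move=> t _; rewrite -EFinM lee_fin powRr0 mul1r indicE.
  case: (boolP (t \in ball q n)) => [/set_mem tK|_]; last by rewrite !mulr0.
  rewrite !mulr1 ge0_ler_powR ?nnegrE ?powsum_ge0//.
  apply: (@le_trans _ _ (\sum_(i < n) 1)); last by rewrite sumr_const card_ord.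
  by apply: ler_sum => i _; rewrite powR2// expr_le1// (lq_ball_coord hq).
Qed.

Lemma norm_moment0 n (a : 'I_n -> R) : norm_moment n 0 = ball_moment q 0 a.
Proof. by congr fine; apply: eq_integral => t _; rewrite !powRr0. Qed.

Lemma norm_moment1 m (n := m.+1) :
  norm_moment n 1 = n%:R * ball_moment q 2 (axis (@ord0 m)).
Proof.
have a2 : admissible (2 : R) by right; rewrite ler1n.
apply: EFin_inj; rewrite -norm_momentE//.
transitivity (\int[lebesgue_tuple R n]_t
    (\sum_(i < n) (`|lin (axis i) t| `^ 2 * \1_(ball q n) t)%:E))%E.
  apply: eq_integral => t _; rewrite sumEFin -mulr_suml powRr1 ?powsum_ge0//.
  by congr (_ * _)%:E; apply: eq_bigr => i _; rewrite lin_axis.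
rewrite ge0_integral_sum//; last first.
- move=> i; apply/measurable_EFinP; apply: measurable_funM; last exact: measurable_indic_lq_ball.
  exact: measurable_abs_lin_powR.
transitivity (\sum_(i < n) (ball_moment q 2 (axis (@ord0 m)))%:E)%E; last first.
  by rewrite sumEFin sumr_const card_ord mulr_natl.
apply: eq_bigr => i _.
transitivity (ball_moment q 2 (axis i))%:E.
  exact: (ball_momentE hq (axis i) a2).
exact: (congr1 EFin (ball_moment2_axis_eq i)).
Qed.

Let H p n (z : n.-tuple R * n.-tuple R) : R :=
  `|lin (tnth z.1) z.2| `^ p * \1_(ball q n) z.2 * expR (- powsum 2 z.1).

Let mH p n : measurable_fun setT (EFin \o @H p n).
Proof.
apply/measurable_EFinP; apply: measurable_funM; last first.
  have m1 : measurable_fun setT (fun t : n.-tuple R => expR (- powsum 2 t)).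
    by have := @measurable_expR_powsum R 1 n; under eq_fun do rewrite mul1r.
  exact: (measurableT_comp m1).
apply: measurable_funM; last exact: (measurableT_comp (measurable_indic_lq_ball hq)).
apply: (@measurableT_comp _ _ _ _ _ _ (@powR R ^~ p)) => //.
apply: measurableT_comp => //; apply: measurable_sum => i; apply: measurable_funM.
- by apply: (measurableT_comp (measurable_tnth i)).
- by apply: (measurableT_comp (measurable_tnth i)).
Qed.

Let H0 p n z : (0 <= (EFin \o @H p n) z)%E.
Proof. by rewrite lee_fin !mulr_ge0 ?powR_ge0 ?expR_ge0// indicE. Qed.

Let ball_moment_fubini p n (a : n.-tuple R) : admissible p ->
  ((ball_moment q p (tnth a) * expR (- powsum 2 a))%:E =
   \int[lebesgue_tuple R n]_x (EFin \o @H p n) (a, x))%E.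
Proof.
move=> ap; rewrite EFinM -ball_momentE// -ge0_integralZr//.
- apply/measurable_EFinP; apply: measurable_funM; last exact: measurable_indic_lq_ball.
  exact: measurable_abs_lin_powR.
Qed.

Lemma measurable_ball_moment_gauss p n : admissible p ->
  measurable_fun setT (fun a : n.-tuple R =>
    (ball_moment q p (tnth a) * expR (- powsum 2 a))%:E).
Proof.
move=> ap; under eq_fun do rewrite ball_moment_fubini//.
exact: (measurable_fun_fubini_tonelli_F (m2 := lebesgue_tuple R n) _ (@mH p n) (@H0 p n)).
Qed.

(** Tonelli: for fixed x the integral over a of |<a, x>|^p exp(-|a|^2) is a
    Gaussian chain with coefficients x, hence proportional to |x|^p. *)
Lemma gauss_average p n : 1 <= p ->
  (\int[lebesgue_tuple R n]_a (ball_moment q p (tnth a) * expR (- powsum 2 a))%:E =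
   (mass g ^+ n * (absmom g p / mass g) * norm_moment n (p / 2))%:E)%E.
Proof.
move=> p1; have ap : admissible p by right.
have Zg : 0 < mass g := weight_mass_gt0 (@gauss_weight R).
under eq_integral do rewrite ball_moment_fubini//.
rewrite (fubini_tonelli (EFin \o @H p n) (@mH p n) (@H0 p n)).
have c0 : 0 <= mass g ^+ n * (absmom g p / mass g).
  rewrite mulr_ge0 ?exprn_ge0 ?divr_ge0 ?(ltW Zg)// absmom_ge0//; exact: gauss_weight.
rewrite [RHS]EFinM -norm_momentE ?divr_ge0 ?(le_trans _ p1)// -[RHS]ge0_integralZl//; last 2 first.
- apply/measurable_EFinP; apply: measurable_funM; last exact: measurable_indic_lq_ball.
  exact: measurable_powsum_powR.
- by move=> t _; apply: integrand_indic; exact: powR_ge0.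
apply: eq_integral => x _.
have lip := polylip_abs ap.
have chE : chain g (coefs (tnth x)) (fun y => `|y| `^ p) 0 =
    mass g ^+ n * (absmom g p / mass g) * powsum 2 x `^ (p / 2).
  apply: (mulfI (lt0r_neq0 Zg)); rewrite chain_gauss//.
  rewrite blur_abs//; last exact: gauss_weight.
  rewrite size_coefs sqsum_coefs -powsum2 (ger0_norm (sqrtr_ge0 _)).
  rewrite -powR12_sqrt ?powsum_ge0// -powRrM [_^-1 * p]mulrC; field.
  by rewrite gt_eqF.
transitivity ((\1_(ball q n) x)%:E * (chain g (coefs (tnth x)) (fun y => `|y| `^ p) 0)%:E)%E; last first.
  by rewrite chE -!EFinM; congr EFin; ring.
rewrite -chain_tuple//; last exact: gauss_weight.
rewrite -[RHS]ge0_integralZl//.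
- apply: eq_integral => a _; rewrite -EFinM /H /= -expw2 prod_expw add0r; congr EFin.
  have -> : lin (tnth a) x = lin (tnth x) a by apply: eq_bigr => i _; rewrite mulrC.
  by ring.
- apply/measurable_EFinP; apply: measurable_funM.
    under eq_fun do rewrite add0r.
    exact: measurable_abs_lin_powR.
  by apply: measurable_prod_tuple; exact: measurable_gauss_fun.
- move=> t _; rewrite lee_fin mulr_ge0 ?powR_ge0// prodr_ge0// => i _.
  exact: gauss_fun_ge0.
Qed.

Lemma norm_moment_jensen m (n := m.+1) s p (V := ball_moment q 0 (axis (@ord0 m))) :
  1 <= p -> moment_sign s p ->
  0 <= s * (norm_moment n (p / 2) / V -
    (n%:R * ball_moment q 2 (axis (@ord0 m)) / V) `^ (p / 2)).
Proof.
move=> p1 sp; have V0 : 0 < V := ball_moment0_gt0 hq _.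
have p20 : 0 <= p / 2 by rewrite divr_ge0// (le_trans _ p1).
have n0 : 0 < n%:R :> R by rewrite ltr0n.
have Q0 : 0 < norm_moment n 1 by rewrite norm_moment1; exact: mulr_gt0 n0 (ball_moment2_axis_gt0 m).
rewrite -norm_moment1.
have mK := @measurable_indic_lq_ball R q n hq.
apply: (@jensen_moment R _ _ (lebesgue_tuple R n) (\1_(ball q n)) (fun t => powsum 2 t `^ 2^-1)
  s p _ _ _ p1 sp mK _ _ _ V0 Q0).
- exact: measurable_powsum_powR.
- by move=> t; rewrite indicE.
- by move=> t; exact: powR_ge0.
- transitivity (norm_moment n 0)%:E; last by rewrite (norm_moment0 (axis ord0)).
  rewrite -(norm_momentE _ (lexx 0)).
  by apply: eq_integral => t _; rewrite powRr0 mul1r.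
- rewrite -(norm_momentE _ ler01); apply: eq_integral => t _.
  by rewrite -powR_mulrn ?powR_ge0// -powRrM mulVf.
- rewrite -(norm_momentE _ p20); apply: eq_integral => t _.
  by rewrite -powRrM [_^-1 * p]mulrC.
Qed.

End gauss_average.

(** * Sharpness: the Gaussian constant *)

Section gamma_sharpness.
Context {R : realType}.
Local Notation g := (@gauss_fun R).

Lemma le_of_vanishing_excess (x y c : R) : 0 <= y -> 0 <= c ->
  (forall m : nat, x <= y * (1 + c / m.+1%:R)) -> x <= y.
Proof.
move=> y0 c0 H; rewrite leNgt; apply/negP => xy.
have d0 : 0 < x - y by rewrite subr_gt0.
have [m hm] := nat_above (y * c / (x - y)).
have := H m; rewrite leNgt => /negP; apply.
have m0 : 0 < m.+1%:R :> R by rewrite ltr0n.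
rewrite mulrDr mulr1 -ltrBrDl mulrA ltr_pdivrMr// [ltRHS]mulrC -ltr_pdivrMr//.
by rewrite (le_lt_trans hm)// ltr_nat.
Qed.

(** The last three hypotheses are the moment bound averaged over Gaussian
    coefficients, Jensen's inequality on the ball, and the bound on the average
    J of |a|^(2r); Q stands for the integral of |x|^(2r) over the ball and P2 /
    V for the variance of a coordinate. *)
Lemma combine_upper_sharp (n r V P2 Q J M k B : R) : 0 < n -> 0 < V -> 0 < P2 -> 0 < M ->
  0 <= r -> 0 <= k -> 0 <= B -> M * k * Q <= V * B * (P2 / V) `^ r * J ->
  (n * P2 / V) `^ r <= Q / V -> J <= (n / 2 + r) `^ r * M ->
  2 `^ r * k <= B * (1 + 2 * r / n) `^ r.
Proof.
move=> n0 V0 P20 M0 r0 k0 B0 avg jensen moment.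
have PV : 0 < P2 / V by exact: divr_gt0.
have D0 : 0 < (P2 / V) `^ r by exact: powR_gt0.
have nr0 : 0 < n / 2 + r by rewrite ltr_wpDr// divr_gt0.
have e1 : (1 + 2 * r / n) `^ r = 2 `^ r * (n / 2 + r) `^ r / n `^ r.
  rewrite -powRM ?(ltW nr0)//.
  rewrite -[X in _ = X / _](divfK (lt0r_neq0 (powR_gt0 r n0))) mulfK ?gt_eqF ?powR_gt0//.
  have -> : 2 * (n / 2 + r) = (1 + 2 * r / n) * n by field; rewrite gt_eqF.
  have h : 0 <= 1 + 2 * r / n by rewrite addr_ge0// !mulr_ge0 ?invr_ge0 ?(ltW n0).
  by rewrite powRM ?(ltW n0)// mulfK// gt_eqF// powR_gt0.
rewrite e1 !mulrA ler_pdivlMr ?powR_gt0// [B * _]mulrC -!mulrA ler_pM2l ?powR_gt0//.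
rewrite -[n * _ / _]mulrA (powRM _ (ltW n0) (ltW PV)) (ler_pdivlMr _ _ V0) in jensen.
move: D0 jensen avg moment; move: ((P2 / V) `^ r) (n `^ r) ((n / 2 + r) `^ r) => D N W D0 jensen avg moment.
have h1 : M * k * (N * D * V) <= M * k * Q by rewrite ler_wpM2l// mulr_ge0// ltW.
have h2 : V * B * D * J <= V * B * D * (W * M).
  by rewrite ler_wpM2l// !mulr_ge0// ltW.
have h3 := le_trans h1 (le_trans avg h2).
have z0 : 0 < M * D * V by rewrite !mulr_gt0.
rewrite -(ler_pM2l z0).
have -> : M * D * V * (k * N) = M * k * (N * D * V) by ring.
by have -> : M * D * V * (B * W) = V * B * D * (W * M) by ring.
Qed.

Lemma combine_lower_sharp (n r V P2 Q J M k A : R) : 0 < n -> 0 < V -> 0 < P2 -> 0 < M ->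
  0 <= r -> 0 <= k -> 0 <= A -> V * A * (P2 / V) `^ r * J <= M * k * Q ->
  Q / V <= (n * P2 / V) `^ r -> (n / 2) `^ (r + 1) / (n / 2 + r) * M <= J ->
  A <= 2 `^ r * k * (1 + 2 * r / n).
Proof.
move=> n0 V0 P20 M0 r0 k0 A0 avg jensen moment.
have PV : 0 < P2 / V by exact: divr_gt0.
have D0 : 0 < (P2 / V) `^ r by exact: powR_gt0.
have n20 : 0 < n / 2 by exact: divr_gt0.
have nr0 : 0 < n / 2 + r by rewrite ltr_wpDr.
have e3 : n / 2 / (n / 2 + r) * (1 + 2 * r / n) = 1.
  have -> : 1 + 2 * r / n = (n / 2 + r) / (n / 2) by field; rewrite gt_eqF.
  by rewrite mulrA divfK ?gt_eqF// divff// gt_eqF.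
rewrite -[n * _ / _]mulrA (powRM _ (ltW n0) (ltW PV)) (ler_pdivrMr _ _ V0) in jensen.
have e1 : n `^ r = 2 `^ r * (n / 2) `^ r.
  by rewrite -powRM ?(ltW n20)// mulrC divfK.
have e2 : (n / 2) `^ (r + 1) = (n / 2) `^ r * (n / 2).
  by rewrite powRD ?powRr1 ?(ltW n20)// (gt_eqF n20) implybT.
rewrite e1 in jensen; rewrite e2 in moment.
have N0 : 0 < (n / 2) `^ r by exact: powR_gt0.
move: D0 N0 jensen avg moment {e1 e2}.
move: ((P2 / V) `^ r) ((n / 2) `^ r) (2 `^ r) => D N T D0 N0 jensen avg moment.
have h1 : V * A * D * (N * (n / 2) / (n / 2 + r) * M) <= V * A * D * J.
  by rewrite ler_wpM2l// !mulr_ge0// ltW.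
have h2 : M * k * Q <= M * k * (T * N * D * V).
  by rewrite ler_wpM2l// mulr_ge0// ltW.
have h3 := le_trans h1 (le_trans avg h2).
have z0 : 0 < M * D * V * N * (n / 2 / (n / 2 + r)) by rewrite !mulr_gt0// invr_gt0.
rewrite -(ler_pM2l z0).
have -> : M * D * V * N * (n / 2 / (n / 2 + r)) * A =
    V * A * D * (N * (n / 2) / (n / 2 + r) * M) by ring.
have -> : M * D * V * N * (n / 2 / (n / 2 + r)) * (T * k * (1 + 2 * r / n)) =
    M * k * (T * N * D * V).
  transitivity (M * k * (T * N * D * V) * (n / 2 / (n / 2 + r) * (1 + 2 * r / n))).
    by ring.
  by rewrite e3 mulr1.
exact: h3.
Qed.

Variable q : \bar R.
Hypothesis hq : (2%:E <= q)%E.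

Let V m := ball_moment q 0 (axis (@ord0 m)).
Let P2 m := ball_moment q 2 (axis (@ord0 m)).

Lemma ball_moment0_axis m (a : 'I_m.+1 -> R) : ball_moment q 0 a = V m.
Proof. exact: EFin_inj (etrans (esym (ball_moment0 hq _)) (ball_moment0 hq _)). Qed.

Lemma powsum_ratio m (a : m.+1.-tuple R) (r : R) : 0 <= r ->
  (ball_moment q 2 (tnth a) / ball_moment q 0 (tnth a)) `^ r =
  (P2 m / V m) `^ r * powsum 2 a `^ r.
Proof.
move=> r0.
have VE : ball_moment q 0 (tnth a) = V m := ball_moment0_axis (tnth a).
have V0 : 0 < V m := ball_moment0_gt0 hq _.
have P0 : 0 < P2 m := ball_moment2_axis_gt0 hq m.
have PV : 0 <= P2 m / V m by exact: divr_ge0 (ltW P0) (ltW V0).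
rewrite VE (ball_moment2_axis hq (tnth a)) -powsum2 -/(P2 m) -mulrA mulrC.
exact: (powRM _ PV (powsum_ge0 _ _)).
Qed.

Lemma gauss_average_le p c m : 1 <= p -> 0 <= c ->
  (forall a : m.+1.-tuple R, ball_moment q p (tnth a) <= c * powsum 2 a `^ (p / 2)) ->
  mass g ^+ m.+1 * (absmom g p / mass g) * norm_moment q m.+1 (p / 2) <=
  c * gauss_norm_moment m.+1 (p / 2).
Proof.
move=> p1 c0 H; have p20 : 0 <= p / 2 by rewrite divr_ge0// (le_trans _ p1).
rewrite -lee_fin -gauss_average// EFinM -gauss_norm_momentE//.
rewrite -[leRHS]ge0_integralZl//; last 2 first.
- exact: measurable_gauss_norm.
- by move=> t _; rewrite lee_fin mulr_ge0 ?powR_ge0 ?expR_ge0.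
apply: ge0_le_integral => //.
- move=> t _; rewrite lee_fin mulr_ge0 ?expR_ge0// ball_moment_ge0//; by right.
- by apply: measurable_ball_moment_gauss => //; right.
- by apply/measurable_EFinP; apply: measurable_funM => //; have /measurable_EFinP := @measurable_gauss_norm R (p / 2) m.+1; exact.
- by move=> t _; rewrite -EFinM lee_fin mulrA ler_wpM2r ?expR_ge0.
Qed.

Lemma gauss_average_ge p c m : 1 <= p -> 0 <= c ->
  (forall a : m.+1.-tuple R, c * powsum 2 a `^ (p / 2) <= ball_moment q p (tnth a)) ->
  c * gauss_norm_moment m.+1 (p / 2) <=
  mass g ^+ m.+1 * (absmom g p / mass g) * norm_moment q m.+1 (p / 2).
Proof.
move=> p1 c0 H; have p20 : 0 <= p / 2 by rewrite divr_ge0// (le_trans _ p1).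
rewrite -lee_fin -gauss_average// EFinM -gauss_norm_momentE//.
rewrite -[leLHS]ge0_integralZl//; last 2 first.
- exact: measurable_gauss_norm.
- by move=> t _; rewrite lee_fin mulr_ge0 ?powR_ge0 ?expR_ge0.
apply: ge0_le_integral => //.
- by move=> t _; rewrite -EFinM lee_fin !mulr_ge0 ?powR_ge0 ?expR_ge0.
- by apply/measurable_EFinP; apply: measurable_funM => //; have /measurable_EFinP := @measurable_gauss_norm R (p / 2) m.+1; exact.
- by apply: measurable_ball_moment_gauss => //; right.
- by move=> t _; rewrite -EFinM lee_fin mulrA ler_wpM2r ?expR_ge0.
Qed.

Lemma powR_rootK (X p : R) : 1 <= p -> 0 <= X -> (X `^ p^-1) `^ p = X.
Proof.
by move=> p1 X0; rewrite -powRrM mulVf ?powRr1// gt_eqF// (lt_le_trans ltr01).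
Qed.

Lemma powR_rootV (X p : R) : 1 <= p -> 0 <= X -> (X `^ p) `^ p^-1 = X.
Proof.
by move=> p1 X0; rewrite -powRrM mulfV ?powRr1// gt_eqF// (lt_le_trans ltr01).
Qed.

Lemma ler_powR_base (X Y p : R) : 0 <= p -> 0 <= X -> X <= Y -> X `^ p <= Y `^ p.
Proof.
by move=> p0 X0 XY; rewrite ge0_ler_powR ?nnegrE// (le_trans X0).
Qed.

Lemma root_le_power (X Y B p : R) : 1 <= p -> 0 <= X -> 0 <= B -> 0 <= Y ->
  X `^ p^-1 <= B * Y `^ 2^-1 -> X <= B `^ p * Y `^ (p / 2).
Proof.
move=> p1 X0 B0 Y0 h; have p0 : 0 <= p by exact: le_trans p1.
have := ler_powR_base p0 (powR_ge0 _ _) h.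
by rewrite powR_rootK// powRM ?powR_ge0// -powRrM [_^-1 * p]mulrC.
Qed.

Lemma power_le_root (X Y A p : R) : 1 <= p -> 0 <= X -> 0 <= A -> 0 <= Y ->
  A * Y `^ 2^-1 <= X `^ p^-1 -> A `^ p * Y `^ (p / 2) <= X.
Proof.
move=> p1 X0 A0 Y0 h; have p0 : 0 <= p by exact: le_trans p1.
have := ler_powR_base p0 (mulr_ge0 A0 (powR_ge0 _ _)) h.
by rewrite powR_rootK// powRM ?powR_ge0// -powRrM [_^-1 * p]mulrC.
Qed.

Lemma clear_ratio_upper (v M M0 Y D N B : R) : 0 < v -> M0 = v -> Y = D * N ->
  M / M0 <= B * Y -> M <= v * B * D * N.
Proof. by move=> v0 -> ->; rewrite ler_pdivrMr// [_ * v]mulrC !mulrA. Qed.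

Lemma clear_ratio_lower (v M M0 Y D N A : R) : 0 < v -> M0 = v -> Y = D * N ->
  A * Y <= M / M0 -> v * A * D * N <= M.
Proof. by move=> v0 -> ->; rewrite ler_pdivlMr// [_ * v]mulrC !mulrA. Qed.

Lemma ball_ratio_ge0 m (a : 'I_m.+1 -> R) p : 1 <= p ->
  0 <= ball_moment q p a / ball_moment q 0 a.
Proof.
move=> p1; rewrite divr_ge0 ?(ltW (ball_moment0_gt0 hq a))//.
by apply: ball_moment_ge0 => //; right.
Qed.

Lemma upper_pointwise p B m (a : m.+1.-tuple R) : 1 <= p -> 0 <= B ->
  upper_moment_bound q p B ->
  ball_moment q p (tnth a) <= V m * B `^ p * (P2 m / V m) `^ (p / 2) * powsum 2 a `^ (p / 2).
Proof.
move=> p1 B0 HB; have V0 : 0 < V m := ball_moment0_gt0 hq _.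
have r0 : 0 <= p / 2 by rewrite divr_ge0// (le_trans _ p1).
apply: (clear_ratio_upper V0 (ball_moment0_axis (tnth a)) (powsum_ratio a r0)).
exact: (root_le_power p1 (ball_ratio_ge0 (tnth a) p1) B0
  (ball_ratio_ge0 (tnth a) (ler1n R 2)) (upper_moment_boundE hq (tnth a) p1 HB)).
Qed.

Lemma lower_pointwise p A m (a : m.+1.-tuple R) : 1 <= p -> 0 <= A ->
  lower_moment_bound q p A ->
  V m * A `^ p * (P2 m / V m) `^ (p / 2) * powsum 2 a `^ (p / 2) <= ball_moment q p (tnth a).
Proof.
move=> p1 A0 HA; have V0 : 0 < V m := ball_moment0_gt0 hq _.
have r0 : 0 <= p / 2 by rewrite divr_ge0// (le_trans _ p1).
apply: (clear_ratio_lower V0 (ball_moment0_axis (tnth a)) (powsum_ratio a r0)).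
exact: (power_le_root p1 (ball_ratio_ge0 (tnth a) p1) A0
  (ball_ratio_ge0 (tnth a) (ler1n R 2)) (lower_moment_boundE hq (tnth a) p1 HA)).
Qed.

Lemma gamma_const_root (p : R) : 1 <= p ->
  gamma_const p = (2 `^ (p / 2) * (absmom g p / mass g)) `^ p^-1.
Proof.
move=> p1; have := @gamma_constE R 1 p p1 ler01.
by rewrite !powR1 !mulr1.
Qed.

Lemma upper_bound_ge_gamma p B : 2 <= p -> upper_moment_bound q p B -> gamma_const p <= B.
Proof.
move=> p2 HB; have p1 : 1 <= p by apply: le_trans p2; rewrite ler1n.
have ap : admissible p by right.
have p0 : 0 <= p by exact: le_trans p1.
have r1 : 1 <= p / 2 by rewrite ler_pdivlMr// mul1r.
have r0 : 0 <= p / 2 by exact: le_trans r1.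
have Zg : 0 < mass g := weight_mass_gt0 (@gauss_weight R).
have k0 : 0 <= absmom g p / mass g.
  by rewrite divr_ge0 ?(ltW Zg)// absmom_ge0//; exact: gauss_weight.
(* The bound at n = 1 forces B to be nonnegative, so that powers of B are monotone. *)
have B0 : 0 <= B.
  rewrite -(pmulr_lge0 _ (segment_norm2_gt0 hq)).
  apply: le_trans (upper_moment_boundE hq (axis (@ord0 0)) p1 HB); exact: powR_ge0.
have Bp0 : 0 <= B `^ p by exact: powR_ge0.
have main m : 2 `^ (p / 2) * (absmom g p / mass g) <= B `^ p * (1 + 2 * (p / 2) / m.+1%:R) `^ (p / 2).
  have V0 : 0 < V m := ball_moment0_gt0 hq _.
  have P0 : 0 < P2 m := ball_moment2_axis_gt0 hq m.
  have c0 : 0 <= V m * B `^ p * (P2 m / V m) `^ (p / 2).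
    by rewrite !mulr_ge0 ?powR_ge0 ?(ltW V0).
  have avg : mass g ^+ m.+1 * (absmom g p / mass g) * norm_moment q m.+1 (p / 2) <=
      V m * B `^ p * (P2 m / V m) `^ (p / 2) * gauss_norm_moment m.+1 (p / 2).
    exact: (gauss_average_le p1 c0 (fun a => upper_pointwise a p1 B0 HB)).
  have jen := norm_moment_jensen hq m p1 (or_introl (conj erefl p2)).
  rewrite mul1r subr_ge0 -/(V m) -/(P2 m) in jen.
  have up := gauss_norm_moment_upper m r1.
  rewrite gauss_norm_moment0 in up.
  have n0 : 0 < m.+1%:R :> R by rewrite ltr0n.
  exact: (combine_upper_sharp n0 V0 P0 (exprn_gt0 _ Zg) r0 k0 Bp0 avg jen up).
have root0 : 0 <= (p / 2)^-1 by rewrite invr_ge0.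
set X := 2 `^ (p / 2) * _ in main.
have X0 : 0 <= X by rewrite mulr_ge0 ?powR_ge0.
have lim : X `^ (p / 2)^-1 <= (B `^ p) `^ (p / 2)^-1.
  apply: (@le_of_vanishing_excess _ _ p) => // [|m]; first exact: powR_ge0.
  have h := ler_powR_base root0 X0 (main m).
  have q0 : 0 <= 1 + p / m.+1%:R by rewrite addr_ge0// divr_ge0.
  rewrite (_ : 2 * (p / 2) = p) in h; last by field.
  by rewrite powRM ?powR_ge0// powR_rootV in h.
have {lim} lim := ler_powR_base r0 (powR_ge0 _ _) lim.
rewrite !powR_rootK// in lim.
rewrite gamma_const_root// -/X -(powR_rootV p1 B0).
by apply: ler_powR_base => //; rewrite invr_ge0.
Qed.

Lemma lower_bound_le_gamma p A : 1 <= p -> p < 2 -> lower_moment_bound q p A ->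
  A <= gamma_const p.
Proof.
move=> p1 p2 HA; have ap : admissible p by right.
have p0 : 0 <= p by exact: le_trans p1.
have r0 : 0 <= p / 2 by rewrite divr_ge0.
have Zg : 0 < mass g := weight_mass_gt0 (@gauss_weight R).
have k0 : 0 <= absmom g p / mass g.
  by rewrite divr_ge0 ?(ltW Zg)// absmom_ge0//; exact: gauss_weight.
have [A0|/ltW A0] := leP A 0.
  by apply: (le_trans A0); rewrite gamma_const_root// powR_ge0.
have Ap0 : 0 <= A `^ p by exact: powR_ge0.
set X := 2 `^ (p / 2) * (absmom g p / mass g).
have X0 : 0 <= X by rewrite mulr_ge0 ?powR_ge0.
have main m : A `^ p <= X * (1 + 2 * (p / 2) / m.+1%:R).
  have V0 : 0 < V m := ball_moment0_gt0 hq _.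
  have P0 : 0 < P2 m := ball_moment2_axis_gt0 hq m.
  have c0 : 0 <= V m * A `^ p * (P2 m / V m) `^ (p / 2).
    by rewrite !mulr_ge0 ?powR_ge0 ?(ltW V0).
  have avg : V m * A `^ p * (P2 m / V m) `^ (p / 2) * gauss_norm_moment m.+1 (p / 2) <=
      mass g ^+ m.+1 * (absmom g p / mass g) * norm_moment q m.+1 (p / 2).
    exact: (gauss_average_ge p1 c0 (fun a => lower_pointwise a p1 A0 HA)).
  have jen := norm_moment_jensen hq m p1 (or_intror (conj erefl (ltW p2))).
  rewrite mulN1r oppr_ge0 subr_le0 -/(V m) -/(P2 m) in jen.
  have low := gauss_norm_moment_lower m r0.
  rewrite gauss_norm_moment0 in low.
  have n0 : 0 < m.+1%:R :> R by rewrite ltr0n.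
  exact: (combine_lower_sharp n0 V0 P0 (exprn_gt0 _ Zg) r0 k0 Ap0 avg jen low).
have lim : A `^ p <= X.
  apply: (@le_of_vanishing_excess _ _ p) => // m.
  by have := main m; rewrite (_ : 2 * (p / 2) = p)//; field.
rewrite gamma_const_root// -/X -(powR_rootV p1 A0).
by apply: ler_powR_base => //; rewrite invr_ge0.
Qed.

End gamma_sharpness.

Theorem corollary4 (R : realType) (q : \bar R) (hq : (2%:E <= q)%E) :
  (forall (n : nat) (hn : (1 <= n)%N)
     (d : measure_display) (T : measurableType d) (P : probability T R)
     (X : {RV P >-> n.-tuple R}),
     uniformly_distributed X (lq_ball q n) ->
     forall (a : 'I_n -> R) (p : R), 1 <= p ->
       ((A_const p)%:E * 'N[P]_2%:E[EFin \o lincomb X a] <=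
          'N[P]_p%:E[EFin \o lincomb X a])%E /\
       ('N[P]_p%:E[EFin \o lincomb X a] <=
          (B_const p)%:E * 'N[P]_2%:E[EFin \o lincomb X a])%E) /\
  (forall p : R, 1 <= p ->
     (forall A : R, lower_moment_bound q p A -> A <= A_const p) /\
     (forall B : R, upper_moment_bound q p B -> B_const p <= B)).
Proof.
split=> [n hn d T P X uX a p p1|p p1]; first exact: (uniform_moment_bounds hq a hn uX p1).
rewrite /A_const /B_const; have [p2|p2] := ltP p 2; split.
- by move=> A; exact: lower_bound_le_gamma.
- by move=> B; exact: upper_bound_ge_cube.
- by move=> A; exact: lower_bound_le_cube.
- by move=> B; exact: upper_bound_ge_gamma.
Qed.
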